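(* Let $k\ge 2$, $n$ and $s$ be integers with $k\le\frac{n-1}{2}$ and $1\le s\le 6$. Then $\sigma_s(Gr(k,n))$ has the expected dimension, except for the following cases: $$(s,k,n)\in\{(3,2,6),\ (3,3,7),\ (4,3,7),\ (4,2,8)\}.$$
   Context: $Gr(k,n)$ is the Grassmannian of projective $k$-planes in $\mathbb{P}^n$ (over $\mathbb{C}$), i.e. of $(k+1)$-dimensional linear subspaces of $\mathbb{C}^{n+1}$, embedded by the Plücker embedding in $\mathbb{P}^N=\mathbb{P}(\wedge^{k+1}\mathbb{C}^{n+1})$, $N=\binom{n+1}{k+1}-1$; it has dimension $(k+1)(n-k)$. For a projective variety $X\subset\mathbb{P}^N$, $\sigma_s(X)$ is the Zariski closure of the union of the linear spans of $s$-tuples of points of $X$. One says $\sigma_s(Gr(k,n))$ has the expected dimension if $$\dim\sigma_s(Gr(k,n))=\min\Big\{s[(k+1)(n-k)+1]-1,\ \binom{n+1}{k+1}-1\Big\}.$$ *)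

(* Defs.v *)
From mathcomp Require Export all_boot all_order all_algebra.
From mathcomp Require Export boolp classical_sets reals.
From mathcomp Require Export complex mpoly.

Set Implicit Arguments.
Unset Strict Implicit.
Unset Printing Implicit Defensive.

Import GRing.Theory.
Local Open Scope classical_set_scope.
Local Open Scope ring_scope.

(* [pspace F m] is P(F^m), of dimension m - 1: its points are the lines of F^m. *)
Definition pspace (F : fieldType) (m : nat) : Type :=
  {L : {vspace 'rV[F]_m} | \dim L == 1%N}.

Section Zariski.
Variables (F : fieldType) (m : nat).
Implicit Types (X Z A B : set (pspace F m)) (p : pspace F m).

Definition vanishes_at (f : {mpoly F[m]}) p : Prop :=
  forall v : 'rV[F]_m, v \in \val p -> f.@[v 0] = 0.

Definition zariski_closed Z : Prop :=
  exists2 E : set {mpoly F[m]},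
    (forall f, E f -> exists d : nat, f \is d.-homog) &
    Z = [set p | forall f, E f -> vanishes_at f p].

Definition zariski_closure X : set (pspace F m) := smallest zariski_closed X.

Definition irreducible_closed Z : Prop :=
  [/\ zariski_closed Z, Z !=set0 &
      forall A B, zariski_closed A -> zariski_closed B ->
        Z `<=` A `|` B -> Z `<=` A \/ Z `<=` B].

(* C 0 < C 1 < ... < C l; the values of C beyond l are irrelevant. *)
Definition irreducible_chain X (l : nat) (C : nat -> set (pspace F m)) : Prop :=
  (forall i, (i <= l)%N -> irreducible_closed (C i) /\ C i `<=` X) /\
  (forall i, (i < l)%N -> C i `<` C i.+1).

(* Krull dimension of a Zariski closed X: since X is closed, the irreducible   *)
(* closed subsets of the subspace X are those of the whole space inside X.     *)
Definition has_dim X (d : nat) : Prop :=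
  (exists C, irreducible_chain X d C) /\
  (forall l C, irreducible_chain X l C -> (l <= d)%N).

(* The sum of the lines \val (x i) is the linear span of the points x i. *)
Definition secant_variety (s : nat) X : set (pspace F m) :=
  zariski_closure
    [set p | exists x : 'I_s -> pspace F m,
       (forall i, X (x i)) /\ (\val p <= \sum_(i < s) \val (x i))%VS].

End Zariski.

(* Subsets of {0, ..., n} with r elements, indexing the basis                  *)
(* e_S = e_(j_1) /\ ... /\ e_(j_r), S = {j_1 < ... < j_r}, of the r-th         *)
(* exterior power of F^(n+1).                                                  *)
Definition rsubsets (r n : nat) : {set {set 'I_n.+1}} :=
  [set S : {set 'I_n.+1} | #|S| == r]%SET.

(* Coordinates of v_1 /\ ... /\ v_r in the basis (e_S): maximal minors.        *)
(* [enum S] lists S increasingly, and its default [ord0] is never reached.     *)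
Definition wedge (F : fieldType) (r n : nat) (v : r.-tuple 'rV[F]_n.+1) :
    'rV[F]_#|rsubsets r n| :=
  \row_(i < #|rsubsets r n|)
    let S : {set 'I_n.+1} := enum_val i in
    \det (\matrix_(a < r, b < r) tnth v a 0 (nth ord0 (enum S) b)).

(* Plucker image of the Grassmannian of projective k-planes in P^n: the line   *)
(* spanned by the wedge of a basis of U only depends on U.                     *)
Definition Gr (F : fieldType) (k n : nat) : set (pspace F #|rsubsets k.+1 n|) :=
  [set p | exists (U : {vspace 'rV[F]_n.+1}) (b : k.+1.-tuple 'rV[F]_n.+1),
     [/\ \dim U = k.+1, basis_of U b & \val p = <[wedge b]>%VS]].
Arguments Gr : clear implicits.

Definition expected_dimension (F : fieldType) (s k n : nat) : Prop :=
  has_dim (secant_variety s (Gr F k n))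
    (minn (s * (k.+1 * (n - k) + 1) - 1) ('C(n.+1, k.+1) - 1))%N.

(* Main.v *)
From HB Require Import structures.
Require Import Defs.
From mathcomp Require Import zify perm.
Set Implicit Arguments.
Unset Strict Implicit.
Unset Printing Implicit Defensive.
Import Order.TTheory GRing.Theory Num.Theory.
Local Open Scope ring_scope.

(** Write r = k + 1 and N = n + 1.  The secant variety is the closure of the
    image of the polynomial map phi = [secmap] that sends s matrices of size
    r x N to the sum of their Plucker vectors, and its dimension is the generic
    rank of the differential of phi, minus one.  By multilinearity of the
    determinant the image of that differential is the sum of the tangent spaces
    at the s points ([jac_tangent], Terracini's lemma), so that everything
    reduces to linear algebra.

    The dimension here is the length of chains of irreducible closed sets.
    A chain of length l gives l + 1 elements that are algebraically independent
    modulo the ideal of the largest member, one for each strict inclusion of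
    prime ideals ([alg_indep_extend], [chain_alg_indep]).  They pull back along
    phi to independent polynomials, and in characteristic 0 independent
    polynomials have a non-degenerate Jacobian at a generic point
    ([alg_indep_generic_jac]); hence l is smaller than the generic rank
    ([chain_rank]).  Conversely, when the rank at v is larger than m, restrict
    phi to a flag of m + 1 linear subspaces that starts with the line of v and
    on which the differential at v is injective.  The closures of the images
    are irreducible, and they increase strictly, because the number of
    independent coordinates on the i-th image is exactly i ([flag_chain],
    [rank_chain]).

    Upper bounds.  At a point of full rank the tangent space of the cone has
    dimension at most r (N - r) + 1 ([rank_tangent]), which gives the expected
    dimension as an upper bound.  In the four exceptional cases the tangent
    spaces at generic points satisfy a further relation.  Three generic
    4-spaces of an 8-space are A, B and C = A + B row by row for suitable
    bases, and expanding the wedge of a sum shows that the wedge of C, doubled,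
    is the sum of the wedges with one row c_i replaced by a_i, modulo the
    tangent spaces at A and B; four generic 3-spaces of a 9-space behave in the
    same way ([wedge_sum_relation], [defect48], [defect39]).  For three generic
    3-spaces of a 7-space one wedge is missing from the sum of the tangent
    spaces ([defect37]).

    Lower bounds.  One choice of points is enough.  For k >= 4 there are six
    coordinate subspaces that pairwise differ in at least three basis vectors;
    their tangent spaces are spanned by disjoint sets of basis vectors
    ([code_tangent_rank]).  For k = 2 and k = 3 explicit points in a chart are
    used.  Gaussian elimination modulo 3 gives the rank for small n, and
    independence modulo 3 implies independence in characteristic 0
    ([tcheck_free]).  Once the six tangent spaces are independent they remain
    so in a space of larger dimension ([tfree_step]). *)


(** * Polynomials in several variables *)

Section MPolyPrelim.
Variable F : numFieldType.

Lemma meval_muni n (p : {mpoly F[n.+1]}) (v : 'I_n.+1 -> F) :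
  p.@[v] = (map_poly (meval (fun i => v (widen_ord (leqnSn n) i))) (muni p)).[v ord_max].
Proof.
rewrite muniE rmorph_sum horner_sum mevalE; apply: eq_bigr => m _ /=.
rewrite map_polyZ /= map_polyXn hornerZ hornerXn mevalZ mevalX big_ord_recr /=.
by rewrite mulrA; congr (_ * _ * _); apply: eq_bigr => i _; rewrite mnmE.
Qed.

Lemma widen_lift n (j : 'I_n) : widen_ord (leqnSn n) j = lift ord_max j.
Proof. by apply/val_inj; rewrite /= /bump leqNgt ltn_ord. Qed.

Lemma muni_eq0 n (p : {mpoly F[n.+1]}) : muni p = 0 -> p = 0.
Proof.
move=> p0; apply/mpolyP => m; rewrite mcoeff0; apply: contra_eq p0 => pm.
apply/negP => /eqP /(congr1 (fun q : {poly {mpoly F[n]}} =>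
  (q`_(m ord_max))@_[multinom m (widen_ord (leqnSn n) i) | i < n])).
rewrite coef0 mcoeff0 muniE coef_sum raddf_sum /= => /eqP.
rewrite (bigD1_seq m) ?msupp_uniq ?mcoeff_msupp //= coefZ coefXn eqxx mulr1.
rewrite mcoeffZ mcoeffX eqxx mulr1 big1 ?addr0 ?(negPf pm) // => m' nm.
rewrite coefZ coefXn; case: (eqVneq (m ord_max) (m' ord_max)) => [e|_]; last first.
  by rewrite mulr0 mcoeff0.
rewrite mulr1 mcoeffZ mcoeffX; case: eqP => [e'|_]; last by rewrite mulr0.
case/eqP: nm; apply/mnmP => i; case: (unliftP ord_max i) => [j ->|-> //].
have := congr1 (fun mm : 'X_{1..n} => mm j) e'; rewrite !mnmE.
by rewrite widen_lift.
Qed.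

(** The coefficients with respect to the last variable are polynomials in the
    other ones, and a polynomial in one variable has finitely many roots. *)
Lemma mpoly_eval0 n (p : {mpoly F[n]}) : (forall v, p.@[v] = 0) -> p = 0.
Proof.
elim: n p => [|n IHn] p p0.
  have /msize1_polyC e : (msize p <= 1)%N.
    rewrite msizeE; apply/bigmax_leqP_seq => m _ _.
    by rewrite mdegE big_ord0.
  by rewrite e; have := p0 (fun=> 0); rewrite {1}e mevalC => ->.
apply: muni_eq0; apply/polyP => k; rewrite coef0; apply: IHn => v.
have q0 : map_poly (meval v) (muni p) = 0.
  apply/eqP; apply: contraT => nz.
  have := max_poly_roots nz (rs := [seq i%:R | i <- iota 0 (size (map_poly (meval v) (muni p)))]).
  rewrite size_map size_iota ltnn; apply.
    apply/allP => _ /mapP [i _ ->]; apply/rootP.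
    pose w (j : 'I_n.+1) : F := if unlift ord_max j is Some j' then v j' else i%:R.
    rewrite -[RHS](p0 w) meval_muni /w unlift_none /=; congr (_.[_]).
    apply: eq_map_poly => q; apply: meval_eq => j.
    by rewrite widen_lift liftK.
  by rewrite map_inj_uniq ?iota_uniq //; exact: (mulrIn (oner_neq0 F)).
by have := congr1 (fun q : {poly F} => q`_k) q0; rewrite coef0 coef_map.
Qed.

Lemma mpoly_neq0_eval n (p : {mpoly F[n]}) : p != 0 -> exists v, p.@[v] != 0.
Proof.
move=> pn; apply: contrapT => /forallNP h; case/eqP: pn; apply: mpoly_eval0 => v.
by apply/eqP; apply/negPn/negP; apply: h.
Qed.

(** The ambient ring is fixed and S varies: a family of polynomials can then be
    enlarged without moving to another polynomial ring. *)
Definition vars_in n (S : {set 'I_n}) (G : {mpoly F[n]}) :=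
  forall (m : 'X_{1..n}) i, i \notin S -> m i != 0%N -> G@_m = 0.

Lemma vars_inT n (G : {mpoly F[n]}) : vars_in [set: 'I_n]%SET G.
Proof. by move=> m i; rewrite inE. Qed.

Lemma vars_in_mderiv n (S : {set 'I_n}) G k : vars_in S G -> vars_in S G^`M(k).
Proof.
move=> h m i iS mi; rewrite mcoeff_mderiv (h _ i iS) ?mul0rn //.
by rewrite mnmDE addn_eq0 negb_and mi.
Qed.

(** Characteristic zero is used here: the derivative of X^m keeps the factor m. *)
Lemma vars_in_mderiv0 n (S : {set 'I_n}) G k :
  vars_in (k |: S) G -> G^`M(k) = 0 -> vars_in S G.
Proof.
move=> h d0 m i iS mi; case: (eqVneq i k) => [ik|nik]; last first.
  by apply: (h m i) => //; rewrite !inE negb_or nik.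
have := congr1 (fun p : {mpoly F[n]} => p@_(m - U_(k))) d0.
rewrite mcoeff0 mcoeff_mderiv submK; last first.
  by apply/mnm_lepP => j; rewrite mnm1E; case: eqP => // <-; rewrite -ik lt0n.
by move/eqP; rewrite mulrn_eq0 /= => /eqP.
Qed.

Lemma msize_le n (G : {mpoly F[n]}) k :
  (forall m, G@_m != 0 -> (mdeg m < k)%N) -> (msize G <= k)%N.
Proof.
by move=> h; rewrite msizeE; apply/bigmax_leqP_seq => m; rewrite mcoeff_msupp => /h.
Qed.

Lemma msize_mderiv n (G : {mpoly F[n]}) k : G != 0 -> (msize G^`M(k) < msize G)%N.
Proof.
move=> G0; rewrite [X in (_ < X)%N]mpolySpred // ltnS; apply: msize_le => m.
rewrite mcoeff_mderiv mulrn_eq0 /= => nz.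
have := @msize_mdeg_lt _ _ G (m + U_(k))%MM; rewrite mcoeff_msupp => /(_ nz).
by rewrite mdegD mdeg1 addn1 [X in (_ < X)%N]mpolySpred.
Qed.

Lemma vars_in0_const n (G : {mpoly F[n]}) : vars_in finset.set0 G -> G = (G@_0)%:MP.
Proof.
move=> h; apply: msize1_polyC; apply: msize_le => m; apply: contraR.
rewrite -leqNgt; move=> md; apply/eqP.
case: (pickP (fun i => m i != 0%N)) => [i mi|m0]; first by apply: (h m i); rewrite ?inE.
by move: md; rewrite mdegE big1 // => i _; apply/eqP; rewrite -[_ == _]negbK m0.
Qed.

(** Division by X_i.  The quotient is smaller than G, which makes induction on
    the size possible. *)
Lemma vars_in_split n (S : {set 'I_n}) G i : vars_in (i |: S) G -> G != 0 ->
  exists G0 G1, [/\ G = G0 + 'X_i * G1, vars_in S G0, vars_in (i |: S) G1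
    & (msize G1 < msize G)%N].
Proof.
move=> hG Gn0.
pose G1 := \sum_(m <- msupp G | m i != 0%N) G@_m *: 'X_[m - U_(i)].
pose G0 := \sum_(m <- msupp G | m i == 0%N) G@_m *: 'X_[m].
have le (m : 'X_{1..n}) : m i != 0%N -> (U_(i) <= m)%MM.
  by move=> mi; apply/mnm_lepP => j; rewrite mnm1E; case: eqP => // <-; rewrite lt0n.
have cG1 m : G1@_m = G@_(m + U_(i)).
  rewrite /G1 raddf_sum /=.
  have nzi : (m + U_(i))%MM i != 0%N by rewrite mnmDE mnm1E eqxx addn1.
  case: (boolP ((m + U_(i))%MM \in msupp G)) => ms.
    rewrite big_mkcond (bigD1_seq (m + U_(i))%MM) ?msupp_uniq //= nzi.
    rewrite mcoeffZ mcoeffX addmK eqxx mulr1 big1 ?addr0 // => m' nm.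
    case: ifP => // m'i; rewrite mcoeffZ mcoeffX.
    by case: eqP => [e|]; rewrite ?mulr0 //; rewrite -e submK ?le ?eqxx // in nm.
  move: (ms); rewrite mcoeff_msupp negbK => /eqP ->.
  rewrite big_seq_cond big1 // => m' /andP[m's m'i]; rewrite mcoeffZ mcoeffX.
  case: eqP => [e|]; rewrite ?mulr0 //.
  by rewrite -e submK ?le // m's in ms.
exists G0, G1; split.
- rewrite {1}[G]mpolyE (bigID (fun m : 'X_{1..n} => m i == 0%N)) /=; congr (_ + _).
  rewrite /G1 mulr_sumr; apply: eq_bigr => m mi.
  by rewrite -scalerAr -mpolyXD addmC submK ?le.
- move=> m j jS mj; rewrite /G0 raddf_sum /= big1 // => m' m'i.
  rewrite mcoeffZ mcoeffX; case: eqP => [e|]; rewrite ?mulr0 //.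
  case: (eqVneq j i) => [e'|nji]; first by rewrite -e e' m'i in mj.
  by rewrite e (hG m j) ?mul0r // !inE negb_or nji.
- by move=> m j jS mj; rewrite cG1 (hG _ j) // mnmDE addn_eq0 negb_and mj.
- rewrite [X in (_ < X)%N]mpolySpred // ltnS; apply: msize_le => m.
  rewrite cG1 -mcoeff_msupp => /msize_mdeg_lt.
  by rewrite mdegD mdeg1 addn1 [X in (_ < X)%N]mpolySpred.
Qed.

Definition msubst n D (f : 'I_n -> {mpoly F[D]}) (G : {mpoly F[n]}) : {mpoly F[D]} :=
  G \mPo [tuple f i | i < n].

Lemma msubst_eval n D (f : 'I_n -> {mpoly F[D]}) G v :
  (msubst f G).@[v] = G.@[fun i => (f i).@[v]].
Proof. by rewrite /msubst comp_mpoly_meval; apply: meval_eq => i; rewrite tnth_mktuple. Qed.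

Lemma msubstX n D (f : 'I_n -> {mpoly F[D]}) i : msubst f 'X_i = f i.
Proof. by rewrite /msubst comp_mpolyXU -tnth_nth tnth_mktuple. Qed.

Lemma msubstM n D (f : 'I_n -> {mpoly F[D]}) G H : msubst f (G * H) = msubst f G * msubst f H.
Proof. exact: rmorphM. Qed.
Lemma msubstD n D (f : 'I_n -> {mpoly F[D]}) G H : msubst f (G + H) = msubst f G + msubst f H.
Proof. exact: rmorphD. Qed.
Lemma msubstC n D (f : 'I_n -> {mpoly F[D]}) c : msubst f c%:MP = c%:MP.
Proof. exact: comp_mpolyC. Qed.
Lemma msubstZ n D (f : 'I_n -> {mpoly F[D]}) c G : msubst f (c *: G) = c *: msubst f G.
Proof. exact: comp_mpolyZ. Qed.

(** The chain rule holds for variables and is inherited by products and linear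
    combinations. *)
Lemma msubst_mderiv n D (f : 'I_n -> {mpoly F[D]}) G j :
  (msubst f G)^`M(j) = \sum_i msubst f G^`M(i) * (f i)^`M(j).
Proof.
pose K H := (msubst f H)^`M(j) = \sum_i msubst f H^`M(i) * (f i)^`M(j).
have K1 : K 1.
  rewrite /K /msubst rmorph1 -mpolyC1 mderivC big1 // => i _.
  by rewrite -mpolyC1 mderivC rmorph0 mul0r.
have KM p q : K p -> K q -> K (p * q).
  rewrite /K => Kp Kq; rewrite msubstM mderivM Kp Kq mulr_suml mulr_sumr -big_split /=.
  apply: eq_bigr => i _; rewrite mderivM msubstD !msubstM mulrDl; congr (_ + _).
    by rewrite mulrAC.
  by rewrite mulrA.
have KX i : K 'X_i.
  rewrite /K msubstX (bigD1 i) //= mderivX mnm1E eqxx scale1r.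
  rewrite (_ : (U_(i) - U_(i))%MM = 0%MM); last by apply/mnmP => k; rewrite mnmBE subnn mnm0E.
  rewrite mpolyX0 /msubst rmorph1 mul1r big1 ?addr0 // => k ki.
  by rewrite mderivX mnm1E eq_sym (negPf ki) scale0r rmorph0 mul0r.
elim/mpolyind: G => [|c m p _ _ Kp].
  by rewrite /msubst rmorph0 mderiv0 big1 // => i _; rewrite mderiv0 rmorph0 mul0r.
have Km : K 'X_[m].
  rewrite mpolyXE_id; apply: (@big_ind _ K) => [||i _]; [exact: K1|exact: KM|].
  elim: (m i) => [|k IH]; first by rewrite expr0; exact: K1.
  by rewrite exprS; apply: KM; [exact: KX|exact: IH].
rewrite msubstD msubstZ mderivD mderivZ Km Kp scaler_sumr -big_split /=.
by apply: eq_bigr => i _; rewrite mderivD mderivZ msubstD msubstZ mulrDl scalerAl.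
Qed.

End MPolyPrelim.

(** * Algebraic independence *)

Section Indep.
Variable F : numFieldType.

(** For P the zero ideal this is algebraic independence of the members of S;
    for a prime ideal P it is their independence in the quotient by P. *)
Definition alg_indep n D (P : {mpoly F[D]} -> Prop) (S : {set 'I_n}) (f : 'I_n -> {mpoly F[D]}) :=
  forall G, vars_in S G -> P (msubst f G) -> G = 0.

(** Bounding each exponent separately makes the monomials in play a box, which
    is easier to count than a simplex. *)
Definition exps_le D (e : 'I_D -> nat) (p : {mpoly F[D]}) :=
  forall m : 'X_{1..D}, m \in msupp p -> forall j, (m j <= e j)%N.

Lemma exps_le1 D (e : 'I_D -> nat) : exps_le e 1.
Proof. by move=> m; rewrite msupp1 inE => /eqP -> j; rewrite mnm0E. Qed.

Lemma exps_leM D (e1 e2 : 'I_D -> nat) p q :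
  exps_le e1 p -> exps_le e2 q -> exps_le (fun j => e1 j + e2 j)%N (p * q).
Proof.
move=> b1 b2 m /msuppM_le /allpairsP [[m1 m2] /= [h1 h2 ->]] j.
by rewrite mnmDE leq_add ?b1 ?b2.
Qed.

Lemma exps_leX D (e : 'I_D -> nat) p k : exps_le e p -> exps_le (fun j => k * e j)%N (p ^+ k).
Proof.
move=> b; elim: k => [|k IH]; first by rewrite expr0; move=> m /exps_le1 h j; rewrite mul0n (h (fun=> 0%N)).
by rewrite exprS => m h j; rewrite mulSn; exact: (exps_leM b IH h).
Qed.

Lemma exps_le_msubst n D (e : 'I_D -> nat) (h : 'I_n -> {mpoly F[D]}) (m : 'X_{1..n}) q :
  (forall i, exps_le e (h i)) -> (forall i, (m i <= q)%N) ->
  exps_le (fun j => n * (q * e j))%N (msubst h 'X_[m]).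
Proof.
move=> bh mq; rewrite /msubst comp_mpolyX.
pose f i := tnth [tuple h i | i < n] i ^+ m i.
have bf i : exps_le (fun j => q * e j)%N (f i).
  move=> m' h' j; apply: leq_trans (exps_leX (bh i) _ j) _; first by rewrite -(tnth_mktuple h i) //; exact: h'.
  by rewrite leq_mul2r mq orbT.
have gen (s : seq 'I_n) : exps_le (fun j => size s * (q * e j))%N (\prod_(i <- s) f i).
  elim: s => [|i s IH]; first by rewrite big_nil => m' /exps_le1 h' j; exact: (h' (fun=> _)).
  by rewrite big_cons /= => m' /(exps_leM (bf i) IH) h' j; rewrite mulSn.
by have := gen (index_enum 'I_n); rewrite /index_enum -enumT size_enum_ord.
Qed.

(** Pigeonhole: the q ^ |S| monomials in the h_i, i in S, with exponents below q
    are combinations of (C q) ^ |T| monomials in the variables, C being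
    independent of q.  When |S| > |T| and q > C ^ |T| this forces a relation. *)
Lemma alg_indep_card n D (T : {set 'I_D}) (S : {set 'I_n}) (h : 'I_n -> {mpoly F[D]}) :
  (forall i, vars_in T (h i)) -> alg_indep (eq^~ 0) S h -> (#|S| <= #|T|)%N.
Proof.
move=> hT ind; rewrite leqNgt; apply/negP => lt.
pose d := (\max_(i < n) msize (h i))%N.
pose e (j : 'I_D) := if j \in T then d else 0%N.
have bh i : exps_le e (h i).
  move=> m ms j; rewrite /e; case: ifP => jT.
    apply: leq_trans (leq_bigmax i); apply: leq_trans (ltnW (msize_mdeg_lt ms)).
    by rewrite mdegE (bigD1 j) //= leq_addr.
  rewrite leqNgt -eqn0Ngt; apply: contraLR ms => mj.
  by rewrite mcoeff_msupp (hT i m j) ?eqxx ?jT.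
pose C := (n * d + 1)%N.
pose q := (C ^ #|T| + 1)%N.
pose A : finType := {ffun {i | i \in S} -> 'I_q}.
pose B : finType := {ffun {i | i \in T} -> 'I_(C * q)}.
have cA : #|A| = (q ^ #|S|)%N by rewrite card_ffun card_ord card_sig.
have cB : #|B| = ((C * q) ^ #|T|)%N by rewrite card_ffun card_ord card_sig.
have ltBA : (#|B| < #|A|)%N.
  rewrite cA cB expnMn; apply: (@leq_trans (q ^ #|T|.+1)).
    by rewrite expnS ltn_mul2r expn_gt0 {1 2}/q addn1 ltnS leqnn.
  by rewrite leq_pexp2l // /q addn1.
pose mon k (U : {set 'I_k}) Q (a : {ffun {i | i \in U} -> 'I_Q}) : 'X_{1..k} :=
  [multinom (if insub i is Some x then a x : nat else 0%N) | i < k].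
have mon_inj k U Q : injective (@mon k U Q).
  move=> a b ab; apply/ffunP => x; apply/val_inj.
  have := congr1 (fun m : 'X_{1..k} => m (val x)) ab.
  by rewrite !mnmE valK.
pose Mx := \matrix_(a < #|A|, b < #|B|)
  (msubst h 'X_[mon _ _ _ (enum_val a : A)])@_(mon _ _ _ (enum_val b : B)).
have : kermx Mx != 0.
  by rewrite -mxrank_eq0 mxrank_ker subn_eq0 -ltnNge (leq_ltn_trans (rank_leq_col _)).
case/rowV0Pn => u /sub_kermxP uM un0.
pose G := \sum_(a < #|A|) u 0 a *: 'X_[mon _ _ _ (enum_val a : A)] : {mpoly F[n]}.
case/eqP: un0; apply/rowP => a; rewrite mxE.
suff G0 : G = 0.
  have := congr1 (fun p : {mpoly F[n]} => p@_(mon _ _ _ (enum_val a : A))) G0.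
  rewrite mcoeff0 raddf_sum (bigD1 a) //= mcoeffZ mcoeffX eqxx mulr1 big1 ?addr0 // => b ba.
  rewrite mcoeffZ mcoeffX; case: eqP => [/mon_inj /enum_val_inj e'|]; last by rewrite mulr0.
  by rewrite e' eqxx in ba.
apply: ind.
  move=> m i iS mi; rewrite raddf_sum big1 //= => b _; rewrite mcoeffZ mcoeffX.
  case: eqP => [e'|]; last by rewrite mulr0.
  by move: mi; rewrite -e' mnmE insubF ?eqxx //; apply/negbTE.
apply/mpolyP => m; rewrite mcoeff0.
have cG : msubst h G = \sum_(a < #|A|) u 0 a *: msubst h 'X_[mon _ _ _ (enum_val a : A)].
  by rewrite /msubst raddf_sum; apply: eq_bigr => b _; exact: msubstZ.
rewrite cG raddf_sum /=.
case: (boolP [exists b : B, mon _ _ _ b == m]) => [/existsP [b /eqP <-]|/existsPn nb].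
  have := congr1 (fun w : 'rV_ _ => w 0 (enum_rank b)) uM; rewrite !mxE => E0; rewrite -[RHS]E0.
  by apply: eq_bigr => a' _; rewrite !mxE enum_rankK mcoeffZ.
rewrite big1 // => a' _; rewrite mcoeffZ.
suff -> : (msubst h 'X_[mon _ _ _ (enum_val a' : A)])@_m = 0 by rewrite mulr0.
apply/eqP; apply: contraT; rewrite -mcoeff_msupp => ms.
have bb := exps_le_msubst (q := q.-1) bh _ ms.
have {}bb : forall j, (m j <= n * (q.-1 * e j))%N.
  apply: bb => i; rewrite mnmE; case: insub => [x|//].
  by rewrite -ltnS prednK ?ltn_ord // /q addn1.
have mlt j : (m j < C * q)%N.
  apply: leq_ltn_trans (bb j) _; rewrite /C mulnDl mul1n -mulnA [(d * q)%N]mulnC.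
  have le : (n * (q.-1 * e j) <= n * (q * d))%N.
    by rewrite leq_mul2l leq_mul ?leq_pred ?orbT // /e; case: ifP.
  by apply: leq_ltn_trans le _; rewrite -addn1 leq_add2l /q addn1.
pose b : B := [ffun x => Ordinal (mlt (val x))].
have := nb b; rewrite (_ : mon _ _ _ b = m) ?eqxx //.
apply/mnmP => j; rewrite mnmE; case: insubP => [x _ <-|jT]; first by rewrite ffunE.
by apply/esym/eqP; rewrite -leqn0; apply: leq_trans (bb j) _; rewrite /e (negPf jT) !muln0.
Qed.

Lemma msubst_eq_on n D (S : {set 'I_n}) (f g : 'I_n -> {mpoly F[D]}) G :
  vars_in S G -> {in S, f =1 g} -> msubst f G = msubst g G.
Proof.
move=> hG fg; rewrite /msubst !comp_mpolyEX; apply: eq_big_seq => m ms.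
rewrite !comp_mpolyX; congr (_ *: _); apply: eq_bigr => i _; rewrite !tnth_mktuple.
case: (boolP (i \in S)) => [/fg -> //|iS].
have -> : m i = 0%N; last by rewrite !expr0.
by apply/eqP; apply: contraLR ms => mi; rewrite mcoeff_msupp (hG m i) ?eqxx.
Qed.

Lemma msubstA n k D (f : 'I_n -> {mpoly F[D]}) (g : 'I_k -> {mpoly F[n]}) G :
  msubst f (msubst g G) = msubst (fun i => msubst f (g i)) G.
Proof. by apply/eqP; rewrite -subr_eq0; apply/eqP/mpoly_eval0 => v; rewrite mevalB !msubst_eval; apply/eqP; rewrite subr_eq0; apply/eqP/meval_eq => i; rewrite msubst_eval. Qed.

Lemma msubst_id n G : msubst (fun i : 'I_n => 'X_i : {mpoly F[n]}) G = G.
Proof. exact: comp_mpoly_id. Qed.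

(** A strict inclusion of prime ideals makes the transcendence degree of the
    quotient grow.  In a minimal relation modulo P the part without X_i is a
    relation modulo Q, because f i is in Q, so it is zero; primeness of P then
    allows division by f i, which is not in P, and gives a smaller relation. *)
Lemma alg_indep_extend n D (P Q : {mpoly F[D]} -> Prop) (S : {set 'I_n}) f i :
  (forall a b, P (a * b) -> P a \/ P b) ->
  (forall a, P a -> Q a) -> (forall a b, Q a -> Q b -> Q (a - b)) ->
  (forall a b, Q a -> Q (a * b)) ->
  alg_indep Q S f -> Q (f i) -> ~ P (f i) -> alg_indep P (i |: S) f.
Proof.
move=> prime PQ QB QM ind Qi nPi G; have [k] := ubnP (msize G).
elim: k G => // k IH G /ltnSE le hG PG; apply/eqP; apply: contraT => Gn0.
have [G0 [G1 [eG hG0 hG1 lt]]] := vars_in_split hG Gn0.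
have eP : msubst f G = msubst f G0 + f i * msubst f G1 by rewrite {1}eG msubstD msubstM msubstX.
have G00 : G0 = 0.
  apply: ind => //; rewrite -(addrK (f i * msubst f G1) (msubst f G0)) -eP.
  by apply: QB; [apply: PQ | apply: QM].
have G10 : G1 = 0.
  apply: IH => //; first exact: leq_trans lt le.
  by case: (prime (f i) (msubst f G1)) => //; rewrite -[_ * _]add0r -[0](@raddf0 _ _ (comp_mpoly [tuple f i | i < n])) -G00 -/(msubst f G0) -eP.
by rewrite eG G00 G10 mulr0 addr0 eqxx in Gn0.
Qed.

Definition jac_free n D (S : {set 'I_n}) (h : 'I_n -> {mpoly F[D]}) (v : 'I_D -> F) :=
  forall c : 'I_n -> F, (forall i, i \notin S -> c i = 0) ->
    (forall j, \sum_i c i * (h i)^`M(j).@[v] = 0) -> forall i, c i = 0.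

(** Differentiating a relation of minimal size gives a linear relation between
    differentials, whose coefficients are values of smaller polynomials. *)
Lemma alg_indep_of_jac_free n D (S : {set 'I_n}) (h : 'I_n -> {mpoly F[D]}) v :
  jac_free S h v -> alg_indep (eq^~ 0) S h.
Proof.
move=> jf G; have [k] := ubnP (msize G).
elim: k G => // k IH G /ltnSE le hG G0; apply/eqP; apply: contraT => Gn0.
have dG i : i \notin S -> G^`M(i) = 0.
  move=> iS; apply/mpolyP => m; rewrite mcoeff_mderiv mcoeff0 (hG _ i) ?mul0rn //.
  by rewrite mnmDE mnm1E eqxx addn1.
pose J (p : {mpoly F[D]} -> F) := \matrix_(a < #|S|, j < D) p (h (enum_val a))^`M(j).
pose Jv := J (meval v).
have Jfree : row_free Jv.
  apply/inj_row_free => u uJ; apply/rowP => a; rewrite mxE.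
  pose c i := if i \in S then \sum_(a < #|S| | enum_val a == i) u 0 a else 0.
  have cE b : c (enum_val b) = u 0 b.
    rewrite /c enum_valP (bigD1 b) //= big1 ?addr0 // => b' /andP[/eqP /enum_val_inj ->].
    by rewrite eqxx.
  rewrite -cE; apply: jf => [i /negPf iS|j]; first by rewrite /c iS.
  have := congr1 (fun w : 'rV_ _ => w 0 j) uJ; rewrite !mxE => E0; rewrite -[RHS]E0.
  rewrite (bigID (mem S)) /= [X in _ + X]big1 ?addr0; last first.
    by move=> i iS; rewrite /c (negPf iS) mul0r.
  rewrite big_enum_val /=.
  by apply: eq_bigr => b _; rewrite cE mxE.
pose Jt := \matrix_(a < #|S|, j < D) (h (enum_val a))^`M(j).
pose B := pinvmx Jv.
pose N := Jt *m map_mx (@mpolyC _ _) B.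
have Nv : map_mx (meval v) N = 1%:M.
  rewrite /N map_mxM -(mulmxVp Jfree) /B; congr (_ *m _).
    by apply/matrixP => a j; rewrite !mxE.
  by apply/matrixP => a j; rewrite 2!mxE; exact: mevalC.
have detN : \det N != 0.
  apply: contra_eq_neq Nv => dN; apply/eqP => /(congr1 determinant).
  by rewrite det_map_mx dN det1 raddf0 => /eqP; rewrite eq_sym oner_eq0.
pose g := \row_(a < #|S|) msubst h G^`M(enum_val a).
have gJ : g *m Jt = 0.
  apply/rowP => j; rewrite !mxE.
  have := msubst_mderiv h G j; rewrite G0 mderiv0 => e.
  rewrite [RHS]e [RHS](bigID (mem S)) /= [X in _ = _ + X]big1 ?addr0; last first.
    by move=> i iS; rewrite dG // /msubst raddf0 mul0r.
  rewrite [RHS]big_enum_val /=.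
  by apply: eq_bigr => a _; rewrite !mxE.
have g0 : g = 0.
  have : \det N *: g = 0.
    by rewrite -mul_mx_scalar -mul_mx_adj mulmxA /N mulmxA gJ !mul0mx.
  by move/eqP; rewrite scalemx_eq0 (negPf detN) => /eqP.
have d0 i : G^`M(i) = 0.
  case: (boolP (i \in S)) => [iS|]; last exact: dG.
  apply: IH; first exact: leq_trans (msize_mderiv _ Gn0) le.
    exact: vars_in_mderiv.
  have := congr1 (fun w : 'rV_ _ => w 0 (enum_rank_in iS i)) g0; rewrite !mxE.
  by rewrite enum_rankK_in.
have sT T : vars_in T G -> vars_in finset.set0 G.
  have [m] := ubnP #|T|; elim: m T => // m IHm T /ltnSE lem hT.
  case: (set_0Vmem T) => [<- //|[i iT]].
  apply: (IHm (T :\ i)); first by move: lem; rewrite (cardsD1 i) iT.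
  by apply: (@vars_in_mderiv0 _ _ _ _ i) => //; rewrite finset.setD1K.
have eG := vars_in0_const (sT _ hG).
have : msubst h G = (G@_0)%:MP by rewrite {1}eG msubstC.
by rewrite G0 => /esym/eqP; rewrite mpolyC_eq0 => /eqP c0; move: Gn0; rewrite eG c0 mpolyC0 eqxx.
Qed.

End Indep.

(** * Algebraic independence and Jacobians *)

Section IndepJac.
Variable F : numFieldType.

Lemma mderivXU D (i j : 'I_D) : ('X_i : {mpoly F[D]})^`M(j) = (i == j)%:R.
Proof.
rewrite mderivX mnm1E; case: eqP => [->|_]; last by rewrite scale0r.
by rewrite scale1r (_ : (U_(j) - U_(j))%MM = 0%MM) ?mpolyX0 //; apply/mnmP => k; rewrite mnmBE subnn mnm0E.
Qed.

(** Enlarge S0 to a maximal independent subfamily S.  Each coordinate function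
    is algebraic over S, and differentiating a minimal equation expresses its
    differential through those of S, at all points where the derivative of the
    equation is not zero.  So the differentials of S generically span; there are
    at most D of them, and therefore they are independent. *)
Lemma alg_indep_family_jac n D (S0 : {set 'I_n}) (H : 'I_n -> {mpoly F[D]}) Delta :
  (forall j : 'I_D, exists i, H i = 'X_j) -> Delta != 0 ->
  alg_indep (eq^~ 0) S0 H -> exists2 v, Delta.@[v] != 0 & jac_free S0 H v.
Proof.
move=> HX Dn0 ind.
have [S /maxsetP[/asboolP indS maxS] sS0] :
    {S : {set 'I_n} | maxset [pred T | `[< alg_indep (eq^~ 0) T H >]] S & S0 \subset S}.
  by apply: maxset_exists; apply/asboolP.
have key j : exists2 d : {mpoly F[D]}, d != 0 & forall v, d.@[v] != 0 ->
    exists c : 'I_n -> F, (forall i, i \notin S -> c i = 0) /\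
      forall k, \sum_i c i * (H i)^`M(k).@[v] = (j == k)%:R.
  have [i Hi] := HX j; case: (boolP (i \in S)) => iS.
    exists 1; first exact: oner_neq0.
    move=> v _; exists (fun k => (k == i)%:R); split=> [k kS|k].
      by case: eqP kS => // ->; rewrite iS.
    rewrite (bigD1 i) //= eqxx mul1r Hi mderivXU big1 ?addr0 => [|k' /negPf ->]; last by rewrite mul0r.
    by case: eqP; rewrite ?meval1 ?meval0.
  have nind : ~ alg_indep (eq^~ 0) (i |: S) H.
    move=> ind'; have := maxS (i |: S); rewrite /= => /(_ _ _) e.
    by move: iS; rewrite -e ?finset.setU11 ?finset.subsetUr //; apply/asboolP.
  have {nind} [k] : exists k, exists G, [/\ (msize G < k)%N, vars_in (i |: S) G, msubst H G = 0 & G != 0].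
    apply: contrapT => nex; apply: nind => G sG G0; apply/eqP; apply: contraT => Gn0.
    by case: nex; exists (msize G).+1, G; split.
  elim: k => [|k IH] [G [// /ltnSE le sG G0 Gn0]].
  have sdG := vars_in_mderiv i sG.
  have dn0 : G^`M(i) != 0.
    apply: contra Gn0 => /eqP d0; apply/eqP/indS => //.
    exact: vars_in_mderiv0 sG d0.
  case: (eqVneq (msubst H G^`M(i)) 0) => [c0|cn0].
    apply: IH; exists G^`M(i); split => //.
    exact: leq_trans (msize_mderiv _ Gn0) le.
  exists (msubst H G^`M(i)) => // v dv.
  exists (fun l => if l \in S then - (msubst H G^`M(i)).@[v]^-1 * (msubst H G^`M(l)).@[v] else 0).
  split=> [l /negPf -> //|l].
  have := congr1 (meval v) (msubst_mderiv H G l); rewrite G0 mderiv0 meval0 raddf_sum /=.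
  rewrite (bigD1 i) //= mevalM Hi mderivXU => /eqP.
  rewrite eq_sym addrC addr_eq0 => /eqP E.
  rewrite (bigD1 i) //= (negPf iS) mul0r add0r.
  transitivity (- (msubst H G^`M(i)).@[v]^-1 * \sum_(i0 < n | i0 != i) (msubst H G^`M(i0) * (H i0)^`M(l)).@[v]).
    rewrite mulr_sumr; apply: eq_bigr => i0 ni0; rewrite mevalM mulrA.
    case: ifP => // i0S; rewrite mul0r.
    suff -> : G^`M(i0) = 0 by rewrite /msubst raddf0 meval0 mulr0 mul0r.
    apply/mpolyP => m; rewrite mcoeff_mderiv mcoeff0 (sG _ i0) ?mul0rn //.
      by rewrite !inE (negPf ni0) i0S.
    by rewrite mnmDE mnm1E eqxx addn1.
  rewrite E mulrN mulNr opprK mulrA mulVf // mul1r.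
  by case: eqP; rewrite ?meval1 ?meval0.
have {key} [d hd] := boolp.choice (fun j => let: ex_intro2 d d0 hd := key j in
  ex_intro (fun d => d != 0 /\ forall v, d.@[v] != 0 -> exists c : 'I_n -> F,
    (forall i, i \notin S -> c i = 0) /\
      forall k, \sum_i c i * (H i)^`M(k).@[v] = (j == k)%:R) d (conj d0 hd)).
have : Delta * \prod_j d j != 0.
  by rewrite mulf_neq0 //; apply/prodf_neq0 => j _; have [] := hd j.
case/mpoly_neq0_eval => v; rewrite mevalM mulf_eq0 negb_or rmorph_prod => /andP[Dv dv].
exists v => // c c0 cJ.
suff : jac_free S H v.
  by apply=> // i iS; apply: c0; apply: contra iS => /(fintype.subsetP sS0).
move=> {cJ c0}c c0 cJ.
pose J := \matrix_(a < #|S|, k < D) ((H (enum_val a))^`M(k)).@[v].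
have sumJ (e : 'I_n -> F) k : (forall i, i \notin S -> e i = 0) ->
    \sum_i e i * (H i)^`M(k).@[v] = ((\row_a e (enum_val a)) *m J) 0 k.
  move=> e0; rewrite mxE (bigID (mem S)) /= [X in _ + X]big1 ?addr0; last first.
    by move=> i iS; rewrite e0 ?mul0r.
  by rewrite big_enum_val; apply: eq_bigr => a _; rewrite !mxE.
have fullJ : row_full J.
  rewrite -sub1mx; apply/row_subP => j; rewrite rowE mulmx1.
  have [_ /(_ v)] := hd j; case; first by move/prodf_neq0: dv; exact.
  move=> e [e0 eJ]; apply/submxP; exists (\row_a e (enum_val a)).
  by apply/rowP => k; rewrite -sumJ // eJ mxE eqxx /= eq_sym.
have le : (#|S| <= D)%N.
  have := @alg_indep_card F n D [set: 'I_D]%SET S H _ indS; rewrite cardsT card_ord; apply=> i.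
  exact: vars_inT.
have freeJ : row_free J.
  by rewrite /row_free eqn_leq rank_leq_row /= (eqP fullJ).
have c_0 : \row_a c (enum_val a) = 0 :> 'rV_#|S|.
  apply: (row_free_inj freeJ); rewrite mul0mx; apply/rowP => k; rewrite -sumJ // cJ mxE //.
move=> i; case: (boolP (i \in S)) => [iS|/c0 //].
have := congr1 (fun w : 'rV_ _ => w 0 (enum_rank_in iS i)) c_0; rewrite !mxE.
by rewrite enum_rankK_in.
Qed.

(** The coordinate functions are appended to h, to have a family to which
    [alg_indep_family_jac] applies. *)
Lemma alg_indep_generic_jac m D (h : 'I_m -> {mpoly F[D]}) Delta :
  Delta != 0 -> alg_indep (eq^~ 0) [set: 'I_m]%SET h ->
  exists2 v, Delta.@[v] != 0 & jac_free [set: 'I_m]%SET h v.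
Proof.
move=> Dn0 ind.
pose H (i : 'I_(m + D)) : {mpoly F[D]} := match split i with inl a => h a | inr j => 'X_j end.
pose S0 : {set 'I_(m + D)} := [set lshift D a | a in 'I_m]%SET.
have HX (j : 'I_D) : exists i, H i = 'X_j.
  by exists (rshift m j); rewrite /H; case: split_ordP => [a /eqP|j' /rshift_inj ->] //; rewrite eq_rlshift.
have Hl a : H (lshift D a) = h a.
  by rewrite /H; case: split_ordP => [a' /lshift_inj ->|j /eqP] //; rewrite eq_lrshift.
have ind0 : alg_indep (eq^~ 0) S0 H.
  move=> G sG G0.
  pose g (i : 'I_(m + D)) : {mpoly F[m]} := match split i with inl a => 'X_a | inr j => 0 end.
  have gl a : g (lshift D a) = 'X_a.
    by rewrite /g; case: split_ordP => [a' /lshift_inj ->|j /eqP] //; rewrite eq_lrshift.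
  have E1 : msubst h (msubst g G) = 0.
    rewrite msubstA -[RHS]G0; apply: (msubst_eq_on sG) => _ /imsetP [a _ ->].
    by rewrite Hl gl msubstX.
  have E2 := ind _ (@vars_inT _ _ _) E1.
  rewrite -[G]msubst_id -(@msubst_eq_on _ _ _ _ (fun i => msubst (fun a => 'X_(lshift D a)) (g i)) _ _ sG).
    by rewrite -msubstA E2 /msubst raddf0.
  by move=> _ /imsetP [a _ ->]; rewrite gl msubstX.
have [v Dv jf] := alg_indep_family_jac HX Dn0 ind0.
exists v => // c _ cJ a.
pose c' (i : 'I_(m + D)) := match split i with inl a => c a | inr j => 0 end.
have c'l b : c' (lshift D b) = c b.
  by rewrite /c'; case: split_ordP => [a' /lshift_inj ->|j /eqP] //; rewrite eq_lrshift.
rewrite -c'l; apply: jf => [i|j].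
  rewrite /c'; case: split_ordP => [b ->|//]; case/negP; exact: imset_f.
rewrite big_split_ord /= [X in _ + X]big1 ?addr0; last first.
  move=> k _; rewrite /c'; case: split_ordP => [b /eqP|]; first by rewrite eq_rlshift.
  by rewrite mul0r.
by rewrite -[RHS](cJ j); apply: eq_bigr => b _; rewrite c'l Hl.
Qed.

End IndepJac.

(** * Closed sets and cones over them *)

Section Zar.
Local Open Scope classical_set_scope.
Local Open Scope ring_scope.
Variables (F : numFieldType) (M : nat).
Implicit Types (f g : {mpoly F[M]}) (p : pspace F M) (X : set (pspace F M)).

Lemma pointP (u : 'rV[F]_M) : u != 0 -> exists p : pspace F M, \val p = <[u]>%VS.
Proof.
move=> un0; have h : \dim <[u]>%VS == 1%N by rewrite dim_vline un0.
by exists (exist (fun L : {vspace 'rV[F]_M} => \dim L == 1%N) _ h).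
Qed.

Lemma point_line p : exists2 u : 'rV[F]_M, u != 0 & \val p = <[u]>%VS.
Proof.
case: p => L /= dL; exists (vpick L); first by rewrite vpick0 -dimv_eq0 (eqP dL).
by apply/esym/eqP; rewrite eqEdim -memvE memv_pick (eqP dL) dim_vline vpick0 -dimv_eq0 (eqP dL).
Qed.

Lemma vanishes_atE f p (u : 'rV[F]_M) : \val p = <[u]>%VS ->
  (vanishes_at f p <-> forall c, f.@[fun j => c * u 0 j] = 0).
Proof.
move=> pu; split=> [h c|h v].
  rewrite -[RHS](h (c *: u)); last by rewrite pu memvZ ?memv_line.
  by apply: meval_eq => j; rewrite mxE.
rewrite pu => /vlineP [c ->]; rewrite -[RHS](h c).
by apply: meval_eq => j; rewrite mxE.
Qed.

Lemma dhomog_scale n d (f : {mpoly F[n]}) (c : F) (u : 'I_n -> F) :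
  f \is d.-homog -> f.@[fun j => c * u j] = c ^+ d * f.@[u].
Proof.
move=> /dhomogP hf; rewrite !mevalE mulr_sumr; apply: eq_big_seq => m /hf md.
have -> : d = (\sum_i m i)%N by rewrite -mdegE -md.
rewrite mulrCA; congr (_ * _); rewrite -prodrXr -big_split /=.
by apply: eq_bigr => i _; rewrite exprMn.
Qed.

Lemma poly_all0 (q : {poly F}) : (forall c, q.[c] = 0) -> q = 0.
Proof.
move=> h; apply/eqP; apply: contraT => nz.
have := max_poly_roots nz (rs := [seq i%:R | i <- iota 0 (size q)]).
rewrite size_map size_iota ltnn; apply.
  by apply/allP => _ /mapP [i _ ->]; apply/rootP.
by rewrite map_inj_uniq ?iota_uniq //; exact: (mulrIn (oner_neq0 F)).
Qed.

(** On the multiples of u the polynomial f is a polynomial in one variable whose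
    coefficients are the values at u of the homogeneous parts of f. *)
Lemma pihomog_vanish n d (f : {mpoly F[n]}) (u : 'I_n -> F) : (0 < d)%N ->
  (forall c, f.@[fun j => c ^+ d * u j] = 0) -> forall e, (pihomog mdeg e f).@[u] = 0.
Proof.
move=> d0 h e.
pose q := \sum_(e < msize f) (pihomog mdeg e f).@[u] *: 'X^(d * e) : {poly F}.
have q0 : q = 0.
  apply: poly_all0 => c; rewrite -[RHS](h c) [in RHS](pihomog_partitionE (leqnn (msize f))).
  rewrite /q horner_sum raddf_sum /=; apply: eq_bigr => i _.
  by rewrite hornerZ hornerXn (dhomog_scale _ _ (pihomogP _ _ _)) -exprM mulrC.
case: (ltnP e (msize f)) => [lt|le]; last first.
  rewrite pihomogE big_seq_cond big_pred0 ?meval0 // => m; apply/negbTE/negP.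
  by move=> /andP[/msize_mdeg_lt lt /eqP me]; move: (leq_trans lt le); rewrite me ltnn.
have := congr1 (fun q : {poly F} => q`_(d * e)) q0; rewrite coef0 coef_sum.
rewrite (bigD1 (Ordinal lt)) //= coefZ coefXn eqxx mulr1 big1 ?addr0 // => i ni.
rewrite coefZ coefXn eqn_pmul2l // eq_sym.
by move: ni; rewrite -val_eqE /= => /negPf ->; rewrite mulr0.
Qed.

Lemma vanishes_pihomog f p : vanishes_at f p <-> forall e, vanishes_at (pihomog mdeg e f) p.
Proof.
have [u _ pu] := point_line p; rewrite (vanishes_atE f pu); split=> [h e|h c].
  apply/(vanishes_atE _ pu) => c; rewrite (dhomog_scale _ _ (pihomogP _ _ _)).
  by rewrite (@pihomog_vanish _ 1%N) ?mulr0 // => c'; rewrite expr1.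
rewrite (pihomog_partitionE (leqnn (msize f))) raddf_sum big1 //= => i _.
by have /(vanishes_atE _ pu) := h i; exact.
Qed.

Lemma closed_vset f : zariski_closed [set p | vanishes_at f p].
Proof.
exists [set g | exists e, g = pihomog mdeg e f].
  by move=> g [e ->]; exists e; exact: pihomogP.
apply/seteqP; split=> p /=; first by move/vanishes_pihomog => h g [e ->].
by move=> h; apply/vanishes_pihomog => e; apply: h; exists e.
Qed.

Lemma sub_closure X : X `<=` zariski_closure X.
Proof. by move=> p Xp A [_]; exact. Qed.

Lemma closure_sub X A : zariski_closed A -> X `<=` A -> zariski_closure X `<=` A.
Proof. by move=> cA XA p; apply; split. Qed.

Lemma closed_closure X : zariski_closed (zariski_closure X).
Proof.
exists [set f | (exists d : nat, f \is d.-homog) /\ forall q, X q -> vanishes_at f q].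
  by move=> f [].
apply/seteqP; split=> p /= h.
  move=> f [_ hf]; have := h [set p | vanishes_at f p]; apply; split=> //.
  exact: closed_vset.
move=> A [[E hE eA] XA]; rewrite eA => f Ef; apply: h; split; first exact: hE.
by move=> q /XA; rewrite eA; exact.
Qed.

Lemma closure_mono X Y : X `<=` Y -> zariski_closure X `<=` zariski_closure Y.
Proof. by move=> XY; apply: closure_sub; [exact: closed_closure|move=> p /XY; exact: sub_closure]. Qed.

(** Inhomogeneous polynomials are included: the quotient by this ideal is the
    coordinate ring of the affine cone over X. *)
Definition vanid X f := forall p, X p -> vanishes_at f p.

Lemma vanid_closure X f : vanid X f -> vanid (zariski_closure X) f.
Proof. by move=> h p Zp; exact: (@closure_sub X _ (closed_vset f) h p Zp). Qed.

Lemma vanidB X f g : vanid X f -> vanid X g -> vanid X (f - g).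
Proof. by move=> hf hg p Xp v vp; rewrite mevalB (hf p Xp v vp) (hg p Xp v vp) subr0. Qed.

Lemma vanidM X f g : vanid X f -> vanid X (f * g).
Proof. by move=> hf p Xp v vp; rewrite mevalM (hf p Xp v vp) mul0r. Qed.

(** On each line of the cone f * g is a polynomial in one variable, so f or g
    vanishes on that line; irreducibility makes the choice uniform. *)
Lemma vanid_prime X f g : irreducible_closed X -> vanid X (f * g) -> vanid X f \/ vanid X g.
Proof.
move=> [_ _ irr] fg.
apply: (irr _ _ (closed_vset f) (closed_vset g)) => p Xp /=.
have [u _ pu] := point_line p.
have /(vanishes_atE _ pu) h := fg _ Xp.
rewrite !(vanishes_atE _ pu).
pose r f := msubst (fun j => u 0 j *: 'X_0 : {mpoly F[1]}) f.
have rE k c : (r k).@[fun=> c] = k.@[fun j => c * u 0 j].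
  by rewrite msubst_eval; apply: meval_eq => j; rewrite mevalZ mevalXU mulrC.
have : r f * r g = 0.
  apply: mpoly_eval0 => w; rewrite -msubstM -[RHS](h (w 0)) -rE; apply: meval_eq => i.
  by rewrite ord1.
by move/eqP; rewrite mulf_eq0 => /orP [] /eqP e0; [left|right] => c; rewrite -rE e0 meval0.
Qed.

End Zar.

(** * Krull dimension is at most the generic rank of the Jacobian *)

Section Cone.
Local Open Scope classical_set_scope.
Local Open Scope ring_scope.
Variables (F : numFieldType) (M : nat).
Implicit Types (f g : {mpoly F[M]}) (p : pspace F M) (X : set (pspace F M)).

Definition evalrow D (phi : 'I_M -> {mpoly F[D]}) (v : 'I_D -> F) : 'rV[F]_M :=
  \row_j (phi j).@[v].

(** Only the v with phi(v) nonzero contribute, since a point is a line. *)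
Definition proj_image D (phi : 'I_M -> {mpoly F[D]}) : set (pspace F M) :=
  [set p | exists v, \val p = <[evalrow phi v]>%VS].

Definition homogeneous_map D d (phi : 'I_M -> {mpoly F[D]}) :=
  forall j v c, (phi j).@[fun i => c * v i] = c ^+ d * (phi j).@[v].

Definition jac D (phi : 'I_M -> {mpoly F[D]}) (v : 'I_D -> F) : 'M[F]_(D, M) :=
  \matrix_(k, j) ((phi j)^`M(k)).@[v].

(** As phi is homogeneous, the homogeneous parts of f vanish on its image too. *)
Lemma vanid_proj_image D d (phi : 'I_M -> {mpoly F[D]}) f : (0 < d)%N -> homogeneous_map d phi ->
  msubst phi f = 0 -> vanid (zariski_closure (proj_image phi)) f.
Proof.
move=> d0 hom f0; apply: vanid_closure => p [v pv]; apply/vanishes_pihomog => e.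
apply/(vanishes_atE _ pv) => c.
rewrite (dhomog_scale _ _ (pihomogP _ _ _)) (@pihomog_vanish _ _ d) ?mulr0 // => c'.
transitivity ((msubst phi f).@[fun j => c' * v j]); last by rewrite f0 meval0.
rewrite msubst_eval.
by apply: meval_eq => j; rewrite hom mxE.
Qed.

Lemma vanid_homog_proj_image D (phi : 'I_M -> {mpoly F[D]}) f e : f \is e.-homog ->
  msubst phi f = 0 -> vanid (zariski_closure (proj_image phi)) f.
Proof.
move=> hf f0; apply: vanid_closure => p [v pv]; apply/(vanishes_atE _ pv) => c.
rewrite (dhomog_scale _ _ hf).
have -> : f.@[fun j => evalrow phi v 0 j] = (msubst phi f).@[v].
  by rewrite msubst_eval; apply: meval_eq => j; rewrite mxE.
by rewrite f0 meval0 mulr0.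
Qed.

Lemma proj_image_msubst_eq0 D (phi : 'I_M -> {mpoly F[D]}) f j :
  phi j != 0 -> vanid (proj_image phi) f -> msubst phi f = 0.
Proof.
move=> pj van; apply/eqP; apply: contraT => fn0.
have [v] := mpoly_neq0_eval (mulf_neq0 pj fn0); rewrite mevalM mulf_eq0 negb_or => /andP[pv].
rewrite msubst_eval => fv.
have un0 : evalrow phi v != 0.
  by apply: contra pv => /eqP /rowP /(_ j); rewrite !mxE => ->.
have [p pE] := pointP un0.
have := van p (ex_intro _ v pE) (evalrow phi v).
rewrite pE => /(_ (memv_line _)) e0; case/eqP: fv; rewrite -[RHS]e0.
by apply: meval_eq => i; rewrite mxE.
Qed.

(** Forms that do not vanish on the image pull back to nonzero polynomials, and
    so does their product. *)
Lemma irreducible_proj_image D (phi : 'I_M -> {mpoly F[D]}) j : phi j != 0 ->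
  irreducible_closed (zariski_closure (proj_image phi)).
Proof.
move=> pj; split; first exact: closed_closure.
  have [v pv] := mpoly_neq0_eval pj.
  have un0 : evalrow phi v != 0.
    by apply: contra pv => /eqP /rowP /(_ j); rewrite !mxE => ->.
  by have [p pE] := pointP un0; exists p; apply: sub_closure; exists v.
have sep A : zariski_closed A -> ~ (zariski_closure (proj_image phi) `<=` A) ->
    exists f, [/\ msubst phi f != 0, vanid A f & exists e : nat, f \is e.-homog].
  move=> [E hE ->] /existsNP [p /not_implyP [Zp /existsNP [f /not_implyP [Ef nf]]]].
  exists f; split; [apply/eqP => f0|by move=> q /(_ f Ef)|exact: hE].
  by have [e he] := hE f Ef; apply/nf/(vanid_homog_proj_image he f0).
move=> A B cA cB cov; apply: contrapT => /not_orP [/(sep _ cA) [f [f0 fA _]] /(sep _ cB) [g [g0 gB _]]].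
suff /eqP : msubst phi (f * g) = 0 by rewrite msubstM mulf_eq0 (negPf f0) (negPf g0).
apply: (proj_image_msubst_eq0 pj).
move=> p Xp v vp; rewrite mevalM.
have [Ap|Bp] := cov p (@sub_closure _ _ _ p Xp); first by rewrite (fA p Ap v vp) mul0r.
by rewrite (gB p Bp v vp) mulr0.
Qed.

Lemma alg_indep_ext n D (P : {mpoly F[D]} -> Prop) (S : {set 'I_n}) (f f' : 'I_n -> {mpoly F[D]}) :
  {in S, f =1 f'} -> alg_indep P S f -> alg_indep P S f'.
Proof. by move=> e ind G sG; rewrite -(msubst_eq_on sG e); exact: ind. Qed.

(** The ideals of the cones over C l, ..., C 0 and the ideal of the origin form a
    strictly increasing sequence of l + 2 prime ideals. *)
Lemma chain_alg_indep l (C : nat -> set (pspace F M)) :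
  (forall i, (i <= l)%N -> irreducible_closed (C i)) ->
  (forall i, (i < l)%N -> C i `<` C i.+1) ->
  exists f : 'I_l.+1 -> {mpoly F[M]}, alg_indep (vanid (C l)) [set: 'I_l.+1]%SET f.
Proof.
move=> irr strict.
pose Q k : {mpoly F[M]} -> Prop :=
  if k is k'.+1 then vanid (C k') else fun f => f.@[fun=> 0] = 0.
have sub k : (k <= l)%N -> forall f, vanid (C k) f -> Q k f.
  case: k => [|k] kl f h /=.
    have [_ [p Cp] _] := irr 0%N kl; have := h p Cp 0; rewrite mem0v => /(_ isT) E0; rewrite -[RHS]E0.
    by apply: meval_eq => j; rewrite mxE.
  by move=> p Cp; apply: h; have [s _] := strict k kl; apply: s.
have sep k : (k <= l)%N -> exists2 f, Q k f & ~ vanid (C k) f.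
  case: k => [|k] kl /=.
    have [_ [p Cp] _] := irr 0%N kl; have [u un0 pu] := point_line p.
    have /rV0Pn [j uj] := un0.
    exists 'X_j; first by rewrite mevalXU.
    move=> /(_ p Cp u); rewrite pu memv_line mevalXU => /(_ isT) /eqP.
    by rewrite (negPf uj).
  have [_ ns] := strict k kl.
  have [p /not_implyP [Cp nCp]] : exists p, ~ (C k.+1 p -> C k p) by apply/existsNP.
  have [[E hE eC] _ _] := irr k (ltnW kl).
  move: nCp; rewrite {1}eC => /existsNP [f /not_implyP [Ef nf]].
  exists f; first by move=> q; rewrite eC => /(_ f Ef).
  by move=> h; apply: nf; apply: h.
pose S k : {set 'I_l.+1} := [set i : 'I_l.+1 | (i < k)%N]%SET.
have main k : (k <= l.+1)%N -> exists f : 'I_l.+1 -> {mpoly F[M]}, alg_indep (Q k) (S k) f.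
  elim: k => [|k IH] kl.
    exists (fun=> 0) => G sG /=.
    have -> : G = (G@_0)%:MP.
      by apply: vars_in0_const => m i _; apply: sG; rewrite inE.
    by rewrite msubstC mevalC => ->; rewrite mpolyC0.
  have [f indf] := IH (ltnW kl).
  have [g Qg nPg] := sep k kl.
  pose i0 := Ordinal kl.
  exists (fun i => if i == i0 then g else f i).
  have -> : S k.+1 = (i0 |: S k)%SET.
    by apply/setP => i; rewrite !inE ltnS leq_eqVlt -val_eqE.
  (* The new index k is the next step of the sequence of prime ideals. *)
  apply: (@alg_indep_extend _ _ _ _ (Q k)); rewrite ?eqxx //.
  - by move=> a b; apply: vanid_prime; apply: irr.
  - exact: sub.
  - case: (k) => [|k'] a b /=; last exact: vanidB.
    by move=> ha hb; rewrite mevalB ha hb subr0.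
  - case: (k) => [|k'] a b /=; last exact: vanidM.
    by move=> ha; rewrite mevalM ha mul0r.
  - apply: (alg_indep_ext _ indf) => i; rewrite inE => ik.
    by case: eqP => // e; rewrite e /= ltnn in ik.
have [f indf] := main l.+1 (leqnn _); exists f.
by move=> G sG; apply: indf => m i; rewrite inE ltn_ord.
Qed.

(** The chain rule factors the Jacobian of the pulled back polynomials through
    the Jacobian of phi. *)
Theorem chain_rank D d (phi : 'I_M -> {mpoly F[D]}) l C Delta :
  (0 < d)%N -> homogeneous_map d phi ->
  irreducible_chain (zariski_closure (proj_image phi)) l C -> Delta != 0 ->
  exists2 v, Delta.@[v] != 0 & (l < \rank (jac phi v))%N.
Proof.
move=> d0 hom [irrC strict] Dn0.
have [f indf] := @chain_alg_indep l C (fun i il => proj1 (irrC i il)) strict.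
have indh : alg_indep (eq^~ 0) [set: 'I_l.+1]%SET (fun i => msubst phi (f i)).
  move=> G sG; rewrite -msubstA => G0; apply: indf => // p Cp.
  by apply: (vanid_proj_image d0 hom G0); have [_ s] := irrC l (leqnn l); apply: s.
have [v Dv jf] := alg_indep_generic_jac Dn0 indh; exists v => //.
pose B := \matrix_(j < M, i < l.+1) (f i)^`M(j).@[fun j => (phi j).@[v]].
suff : row_full (jac phi v *m B).
  by move/eqP <-; exact: mxrankM_maxl.
rewrite /row_full -mxrank_tr -/(row_free _); apply/inj_row_free => u u0.
apply/rowP => i; rewrite mxE; apply: (jf (fun i => u 0 i)) => [k|j]; first by rewrite inE.
have := congr1 (fun w : 'rV_ _ => w 0 j) u0; rewrite !mxE => E0; rewrite -[RHS]E0.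
apply: eq_bigr => k _; congr (_ * _); rewrite !mxE msubst_mderiv raddf_sum /=.
by apply: eq_bigr => t _; rewrite mevalM msubst_eval !mxE mulrC.
Qed.

End Cone.

(** * Krull dimension is at least the rank of the Jacobian *)

Section Lower.
Local Open Scope classical_set_scope.
Local Open Scope ring_scope.
Variables (F : numFieldType) (M : nat).

Lemma rank_minor p q (J : 'M[F]_(p, q)) m : (m <= \rank J)%N ->
  exists (A : 'M[F]_(m, p)) (B : 'M[F]_(q, m)), A *m J *m B = 1%:M.
Proof.
move=> mJ; exists (pid_mx m *m invmx (col_ebase J)), (invmx (row_ebase J) *m pid_mx m).
rewrite -{2}[J]mulmx_ebase !mulmxA mulmxKV ?col_ebase_unit // mulmxK ?row_ebase_unit //.
rewrite !mul_pid_mx -[RHS]pid_mx_1; congr pid_mx.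
have mD := leq_trans mJ (rank_leq_row J); have mM := leq_trans mJ (rank_leq_col J).
lia.
Qed.

(** A minor that is not zero at v0 is a nonzero polynomial. *)
Lemma rank_open D p q (Jt : 'M[{mpoly F[D]}]_(p, q)) v0 m :
  (m <= \rank (map_mx (meval v0) Jt))%N ->
  exists2 Delta : {mpoly F[D]}, Delta != 0 &
    forall v, Delta.@[v] != 0 -> (m <= \rank (map_mx (meval v) Jt))%N.
Proof.
case/rank_minor => A [B AB].
pose N := map_mx (@mpolyC D F) A *m Jt *m map_mx (@mpolyC D F) B.
have NE v : map_mx (meval v) N = A *m map_mx (meval v) Jt *m B.
  rewrite /N !map_mxM; congr (_ *m _ *m _); apply/matrixP => i j.
  - by rewrite 2!mxE; exact: mevalC.
  - by rewrite 2!mxE; exact: mevalC.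
exists (\det N).
  apply/eqP => d0; have := congr1 (meval v0) d0; rewrite -det_map_mx NE AB det1 meval0.
  by apply/eqP; exact: oner_neq0.
move=> v; rewrite -det_map_mx NE => dn0.
have /mxrank_unit {1}<- : A *m map_mx (meval v) Jt *m B \in unitmx by rewrite unitmxE unitfE.
exact: leq_trans (mxrankM_maxl _ _) (mxrankM_maxr _ _).
Qed.

Lemma euler D d (f : {mpoly F[D]}) (v : 'I_D -> F) : f \is d.-homog ->
  \sum_k v k * f^`M(k).@[v] = d%:R * f.@[v].
Proof.
move=> /dhomogP hf.
have dE k : f^`M(k).@[v] = \sum_(m <- msupp f) (m k)%:R * f@_m * ('X_[m - U_(k)] : {mpoly F[D]}).@[v].
  by rewrite /mderiv raddf_sum; apply: eq_bigr => m _; exact: mevalZ.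
under eq_bigr do rewrite dE mulr_sumr.
rewrite exchange_big /= {3}[f]mpolyE raddf_sum mulr_sumr /=; apply: eq_big_seq => m ms.
have -> : d = (\sum_i m i)%N by rewrite -mdegE -(hf m ms).
rewrite raddf_sum mulr_suml; apply: eq_bigr => k _ /=; rewrite mevalZ.
case: (eqVneq (m k) 0%N) => [->|mk]; first by rewrite !mul0r !mulr0.
rewrite mulrCA -!mulrA; congr (_ * _); congr (_ * _).
have -> : m = (U_(k) + (m - U_(k)))%MM :> 'X_{1..D}.
  by rewrite addmC submK //; apply/mnm_lepP => j; rewrite mnm1E; case: eqP => // <-; rewrite lt0n.
rewrite [in RHS]mpolyXD mevalM mevalXU; congr (_ * _.@[_]); congr 'X_[_].
by rewrite [X in (X - _)%MM]addmC addmK.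
Qed.

Section Flag.
Variables (D d : nat) (phi : 'I_M -> {mpoly F[D]}).
Hypotheses (d0 : (0 < d)%N) (hphi : forall j, phi j \is d.-homog).

Lemma homogeneous_map_homog : homogeneous_map d phi.
Proof. by move=> j v c; rewrite (dhomog_scale _ _ (hphi j)). Qed.

Lemma euler_jac (v : 'rV[F]_D) : v *m jac phi (v 0) = d%:R *: evalrow phi (v 0).
Proof.
apply/rowP => j; rewrite !mxE -(euler _ (hphi j)).
by apply: eq_bigr => k _; rewrite !mxE.
Qed.

(** The flag has to start with v: this keeps the image of its first member from
    being empty. *)
Lemma flag_basis (J : 'M[F]_(D, M)) (v : 'rV[F]_D) m : v *m J != 0 ->
  (m < \rank J)%N -> exists b : nat -> 'rV[F]_D, b 0%N = v /\
    row_free (\matrix_(i < m.+1) (b i *m J)).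
Proof.
move=> vJ; elim: m => [|m IH] mJ.
  exists (fun=> v); split=> //; rewrite /row_free eqn_leq rank_leq_row lt0n mxrank_eq0.
  by apply: contra vJ => /eqP /(congr1 (row 0)); rewrite rowK row0 => ->.
have [b [b0 bfree]] := IH (ltnW mJ).
set N := \matrix_(i < m.+1) (b i *m J) in bfree.
have /row_subPn [i ni] : ~~ (J <= N)%MS.
  apply: contraL mJ => /mxrankS; rewrite -leqNgt => /leq_trans; apply.
  exact: rank_leq_row.
exists (fun k => if k == m.+1 then delta_mx 0 i else b k); split=> //.
apply/inj_row_free => u; rewrite mulmx_sum_row big_ord_recr /= rowK eqxx -rowE => u0.
have {}u0 : u 0 ord_max *: row i J = - (\row_(k < m.+1) u 0 (widen_ord (leqnSn _) k) *m N).
  apply/eqP; rewrite -addr_eq0 addrC -[X in _ == X]u0; apply/eqP; congr (_ + _).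
  rewrite mulmx_sum_row; apply: eq_bigr => k _; rewrite !rowK mxE /=.
  by rewrite ltn_eqF // ltn_ord.
have um : u 0 ord_max = 0.
  apply/eqP; apply: contraT => un; case/negP: ni.
  by rewrite -(eqmx_scale _ un) u0 eqmx_opp submxMl.
move: u0; rewrite um scale0r => /esym/eqP; rewrite oppr_eq0 => /eqP u0.
have {}u0 : \row_(k < m.+1) u 0 (widen_ord (leqnSn _) k) = 0.
  by apply: (row_free_inj bfree); rewrite mul0mx.
apply/rowP => k; case: (unliftP ord_max k) => [k' ->|->]; last by rewrite um mxE.
have := congr1 (fun w : 'rV_ _ => w 0 k') u0; rewrite !mxE => E0; rewrite -[RHS]E0.
by rewrite widen_lift.
Qed.

Variables (m : nat) (b : nat -> 'rV[F]_D).

(** Linear coordinates of the point with parameters X_0, ..., X_(i-1) in the span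
    of the first i vectors; the m variables are the same for all i, so that the
    images can be compared. *)
Definition flag_coord i (l : 'I_D) : {mpoly F[m]} := \sum_(j < m | (j < i)%N) b j 0 l *: 'X_j.
Definition flag_phi i (k : 'I_M) : {mpoly F[m]} := msubst (flag_coord i) (phi k).

Lemma flag_coord_eval i l x : (flag_coord i l).@[x] = \sum_(j < m | (j < i)%N) b j 0 l * x j.
Proof. by rewrite /flag_coord raddf_sum; apply: eq_bigr => j _ /=; rewrite mevalZ mevalXU. Qed.

Lemma flag_phi_eval i k x : (flag_phi i k).@[x] = (phi k).@[fun l => (flag_coord i l).@[x]].
Proof. exact: msubst_eval. Qed.

Lemma flag_phi_homogeneous_map i : homogeneous_map d (flag_phi i).
Proof.
move=> k x c; rewrite !flag_phi_eval -homogeneous_map_homog; apply: meval_eq => l.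
rewrite !flag_coord_eval mulr_sumr; apply: eq_bigr => j _; exact: mulrCA.
Qed.

Lemma proj_image_flag_phi i : proj_image (flag_phi i) `<=` proj_image phi.
Proof.
move=> p [x pE]; exists (fun l => (flag_coord i l).@[x]); rewrite pE; congr <[_]>%VS.
by apply/rowP => k; rewrite !mxE flag_phi_eval.
Qed.

Lemma proj_image_flag_phiS i : proj_image (flag_phi i) `<=` proj_image (flag_phi i.+1).
Proof.
move=> p [x pE]; exists (fun j : 'I_m => if (j < i)%N then x j else 0); rewrite pE; congr <[_]>%VS.
apply/rowP => k; rewrite !mxE !flag_phi_eval; apply: meval_eq => l; rewrite !flag_coord_eval.
rewrite big_mkcond [RHS]big_mkcond; apply: eq_bigr => j _.
by rewrite ltnS; case: ltngtP; rewrite ?mulr0.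
Qed.

Lemma vars_in_msubst n e (T : {set 'I_e}) (f : 'I_n -> {mpoly F[e]}) G :
  (forall i, vars_in T (f i)) -> vars_in T (msubst f G).
Proof.
move=> hf; pose K (p : {mpoly F[e]}) := vars_in T p.
have K1 : K 1.
  move=> q i _ qi; rewrite mcoeff1; case: eqP => // e0; by rewrite e0 mnm0E in qi.
have KM (p q : {mpoly F[e]}) : K p -> K q -> K (p * q).
  move=> Kp Kq r i iT ri; apply/eqP; apply: contraT; rewrite -mcoeff_msupp.
  move=> /msuppM_le /allpairsP [[m1 m2] /= [h1 h2 er]].
  rewrite !mcoeff_msupp in h1 h2; move: ri; rewrite er mnmDE addn_eq0 negb_and.
  by case/orP => z; [rewrite (Kp _ _ iT z) eqxx in h1|rewrite (Kq _ _ iT z) eqxx in h2].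
rewrite /msubst comp_mpolyEX => q i iT qi; rewrite raddf_sum big1 // => r _ /=.
rewrite mcoeffZ comp_mpolyX.
suff /(_ q i iT qi) -> : K (\prod_(t < n) tnth [tuple f t0 | t0 < n] t ^+ r t) by rewrite mulr0.
apply: (@big_ind _ K) => [||t _]; [exact: K1|exact: KM|]; rewrite tnth_mktuple.
elim: (r t) => [|s IH]; first by rewrite expr0; exact: K1.
by rewrite exprS; apply: KM; [exact: hf|exact: IH].
Qed.

Lemma vars_in_flag_phi i k : vars_in [set j : 'I_m | (j < i)%N]%SET (flag_phi i k).
Proof.
apply: vars_in_msubst => l q j; rewrite inE => jT qj; rewrite /flag_coord raddf_sum big1 //= => t ti.
rewrite mcoeffZ mcoeffX; case: eqP => [e|]; last by rewrite mulr0.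
move: qj; rewrite -e mnm1E; case: (t =P j) => [et _|_ //]; by rewrite -et ti in jT.
Qed.

Hypothesis bJ : row_free (\matrix_(i < m) (b i *m jac phi (b 0%N 0))).

(** The Jacobian of the restriction at b 0, the point with parameters (1, 0, ..., 0),
    has rank i + 1. *)
Lemma flag_phi_alg_indep i : (i < m)%N -> exists S : {set 'I_M}, #|S| = i.+1 /\
  alg_indep (eq^~ 0) S (flag_phi i.+1).
Proof.
move=> im; pose N := \matrix_(k < i.+1) (b k *m jac phi (b 0%N 0)).
have Nfree : row_free N.
  apply/inj_row_free => u uN.
  pose u' := \row_(k < m) (if insub (val k) is Some k' then u 0 k' else 0 : F).
  have /rowP : u' = 0.
    apply: (row_free_inj bJ); rewrite mul0mx -uN !mulmx_sum_row.
    rewrite (bigID (fun k : 'I_m => (k < i.+1)%N)) /= [X in _ + X]big1 ?addr0; last first.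
      by move=> k ki; rewrite mxE insubF ?scale0r //; apply/negbTE.
    rewrite (big_ord_narrow im); apply: eq_bigr => k _; rewrite !rowK !mxE /=.
    by rewrite insubT ?ltn_ord // => h; congr (u 0 _ *: _); apply/val_inj.
  move=> u'0; apply/rowP => k; have := u'0 (widen_ord im k); rewrite !mxE /=.
  by rewrite insubT ?ltn_ord // => h <-; congr (u 0 _); apply/val_inj.
have fullN : row_full N^T by rewrite /row_full mxrank_tr.
pose g := fullrankfun fullN.
exists [set g k | k in 'I_i.+1]%SET.
split; first by rewrite card_imset ?card_ord //; exact: fullrankfun_inj.
pose e0 (j : 'I_m) : F := (val j == 0%N)%:R.
apply: (@alg_indep_of_jac_free _ _ _ _ _ e0) => c c0 cJ.
have coord0 l : (flag_coord i.+1 l).@[e0] = b 0%N 0 l.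
  rewrite flag_coord_eval (bigD1 (Ordinal (leq_ltn_trans (leq0n i) im))) //= /e0 /= mulr1.
  by rewrite big1 ?addr0 // => j /andP[_]; rewrite -val_eqE /= => /negPf ->; rewrite mulr0.
have cN : (\row_k c k) *m N^T = 0.
  apply/rowP => j; rewrite mxE [RHS]mxE -[RHS](cJ (widen_ord im j)).
  apply: eq_bigr => k _; rewrite !mxE; congr (_ * _).
  rewrite msubst_mderiv raddf_sum; apply: eq_bigr => l _ /=.
  rewrite mevalM msubst_eval mulrC mxE; congr (_ * _).
    by apply: meval_eq => l'; rewrite coord0.
  rewrite /flag_coord (big_morph (mderiv _) (mderivD _) (mderiv0 _ _)).
  rewrite (bigD1 (widen_ord im j)) //= mderivZ mderivXU eqxx.
  rewrite big1 => [|t /andP[_ /negPf nt]]; last by rewrite mderivZ mderivXU nt scaler0.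
  by rewrite addr0 mevalZ meval1 mulr1.
(* Only the i + 1 selected columns occur, and they form an invertible matrix. *)
have gN : (\row_t c (g t)) *m rowsub g N^T = 0.
  rewrite -[RHS]cN !mulmx_sum_row.
  rewrite [RHS](bigID (fun k => k \in [set g k | k in 'I_i.+1]%SET)) /= [X in _ = _ + X]big1 ?addr0; last first.
    by move=> k /c0; rewrite mxE => ->; rewrite scale0r.
  rewrite big_imset /=; last by move=> x y _ _; exact: fullrankfun_inj.
  by apply: eq_bigr => t _; rewrite !mxE row_rowsub.
have cg t : c (g t) = 0.
  have U : rowsub g N^T \in unitmx by rewrite -row_full_unit fullrowsub_full.
  have := congr1 (fun w => w *m invmx (rowsub g N^T)) gN; rewrite mulmxK // mul0mx.
  by move/rowP/(_ t); rewrite !mxE.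
move=> k; case: (boolP (k \in [set g k | k in 'I_i.+1]%SET)) => [/imsetP [t _ ->] //|/c0 //].
Qed.

Hypothesis phib : evalrow phi (b 0%N 0) != 0.

Lemma flag_phi_neq0 : exists j, forall i, (i < m)%N -> flag_phi i.+1 j != 0.
Proof.
have /rV0Pn [j pj] := phib; exists j => i im; apply: contra pj => /eqP r0.
pose e0 (j : 'I_m) : F := (val j == 0%N)%:R.
have := congr1 (meval e0) r0; rewrite flag_phi_eval meval0 mxE => E0; rewrite -[X in _ == X]E0.
apply/eqP/meval_eq => l.
rewrite flag_coord_eval (bigD1 (Ordinal (leq_ltn_trans (leq0n i) im))) //= /e0 /= mulr1.
by rewrite big1 ?addr0 // => k /andP[_]; rewrite -val_eqE /= => /negPf ->; rewrite mulr0.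
Qed.

(** The image of the i-th member of the flag has only i parameters, so any i + 1
    of its coordinates satisfy an equation; for a suitable choice of coordinates
    that equation fails on the next image. *)
Lemma flag_chain : (0 < m)%N ->
  irreducible_chain (zariski_closure (proj_image phi)) m.-1
    (fun i => zariski_closure (proj_image (flag_phi i.+1))).
Proof.
move=> m0; have [j0 nz] := flag_phi_neq0; split=> i im.
  have {}im : (i < m)%N by rewrite -(prednK m0) ltnS.
  split; first exact: irreducible_proj_image (nz i im).
  apply: closure_mono; exact: proj_image_flag_phi.
have {}im : (i.+1 < m)%N by rewrite -(prednK m0) ltnS.
split; first by apply: closure_mono; exact: proj_image_flag_phiS.
have [S [cS indS]] := flag_phi_alg_indep im.
have : ~ alg_indep (eq^~ 0) S (flag_phi i.+1).
  move=> /(alg_indep_card (@vars_in_flag_phi i.+1)); rewrite cS.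
  suff -> : #|[set j : 'I_m | (j < i.+1)%N]%SET| = i.+1 by rewrite ltnn.
  rewrite -sum1_card; under eq_bigl do rewrite inE.
  by rewrite (big_ord_narrow (ltnW im)) sum1_card card_ord.
move=> /existsNP [G /not_implyP [sG /not_implyP [G0 Gn0]]].
have Gn : msubst (flag_phi i.+2) G != 0 by apply/eqP => /indS; auto.
have [x] := mpoly_neq0_eval (mulf_neq0 (nz i.+1 im) Gn).
rewrite mevalM mulf_eq0 negb_or => /andP[xj xG] sub.
have un0 : evalrow (flag_phi i.+2) x != 0.
  by apply: contra xj => /eqP /rowP /(_ j0); rewrite !mxE => ->.
have [p pE] := pointP un0.
have Zp : zariski_closure (proj_image (flag_phi i.+1)) p.
  by apply: sub; apply: sub_closure; exists x.
have := vanid_proj_image d0 (flag_phi_homogeneous_map i.+1) G0 Zp (v := evalrow (flag_phi i.+2) x).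
rewrite pE => /(_ (memv_line _)) E0; case/eqP: xG; rewrite -[RHS]E0 msubst_eval.
by apply: meval_eq => k; rewrite mxE.
Qed.

End Flag.

(** A generic v has rank at least as large and phi(v) nonzero, and then, by
    Euler, v is not in the kernel of the differential at v. *)
Theorem rank_chain D d (phi : 'I_M -> {mpoly F[D]}) v0 m :
  (0 < d)%N -> (forall j, phi j \is d.-homog) -> (m < \rank (jac phi v0))%N ->
  exists C, irreducible_chain (zariski_closure (proj_image phi)) m C.
Proof.
move=> d0 hphi rk.
have [j pj] : exists j, phi j != 0.
  apply: contrapT => /forallNP h; suff J0 : jac phi v0 = 0 by rewrite J0 mxrank0 in rk.
  apply/matrixP => k j; rewrite !mxE; have /negP := h j; rewrite negbK => /eqP ->.
  by rewrite mderiv0 meval0.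
have jacE v : jac phi v = map_mx (meval v) (\matrix_(k < D, j < M) (phi j)^`M(k)).
  by apply/matrixP => k i; rewrite !mxE.
rewrite jacE in rk; have [Delta Dn0 hD] := rank_open rk.
have [w] := mpoly_neq0_eval (mulf_neq0 pj Dn0).
rewrite mevalM mulf_eq0 negb_or => /andP[wj /hD]; rewrite -jacE => rkw.
pose v : 'rV[F]_D := \row_k w k.
have vw : v 0 =1 w by move=> k; rewrite mxE.
have evw : evalrow phi (v 0) = evalrow phi w.
  by apply/rowP => k; rewrite !mxE; exact: meval_eq.
have phiv : evalrow phi (v 0) != 0.
  by rewrite evw; apply: contra wj => /eqP /rowP /(_ j); rewrite !mxE => ->.
have rkv : (m < \rank (jac phi (v 0%R)))%N.
  rewrite (_ : jac phi (v 0) = jac phi w) //.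
  by apply/matrixP => k l; rewrite !mxE; exact: meval_eq.
have vJ : v *m jac phi (v 0) != 0.
  by rewrite (@euler_jac _ d _ hphi) scalemx_eq0 negb_or phiv andbT pnatr_eq0 -lt0n.
have [b [b0 bfree]] := flag_basis vJ rkv; rewrite -b0 in phiv bfree.
by eexists; apply: (@flag_chain D d phi d0 hphi m.+1 b).
Qed.

End Lower.

(** * Minors and tangent spaces of the Grassmannian *)

Section Minors.
Variables (R : comNzRingType) (r N : nat).
Implicit Types (A : 'M[R]_(r, N)) (f : 'I_r -> 'I_N) (w : 'rV[R]_N).

(** The columns f may be listed in any order and with repetitions. *)
Definition minor A f : R := \det (colsub f A).

Definition set_row A a w := \matrix_(i, j) (if i == a then w 0 j else A i j).

Lemma minor_mul (x : 'M_r) A f : minor (x *m A) f = \det x * minor A f.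
Proof.
rewrite /minor -det_mulmx; congr (\det _).
by apply/matrixP => i j; rewrite !mxE; apply: eq_bigr => k _; rewrite !mxE.
Qed.

(** Cofactors of row a do not see row a.  In this form, linearity in the new row
    and the effect of a base change are both read off the adjugate. *)
Lemma minor_set_row A a w f : minor (set_row A a w) f = (colsub f w *m \adj (colsub f A)) 0 a.
Proof.
rewrite /minor (expand_det_row _ a) mxE; apply: eq_bigr => b _; rewrite !mxE eqxx.
congr (_ * (_ * \det _)); apply/matrixP => i j.
by rewrite !mxE eq_sym (negPf (neq_lift _ _)).
Qed.

Lemma set_row_row A a : set_row A a (row a A) = A.
Proof. by apply/matrixP => i j; rewrite !mxE; case: eqP => [->|]. Qed.

Lemma minor_set_row_row A a b f : minor (set_row A a (row b A)) f = if a == b then minor A f else 0.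
Proof.
rewrite minor_set_row (_ : colsub f (row b A) = row b (colsub f A)); last first.
  by apply/rowP => j; rewrite !mxE.
rewrite -row_mul mul_mx_adj !mxE eq_sym.
by case: eqP => _; rewrite ?mulr1n ?mulr0n.
Qed.

Lemma minor_set_row_sum A a q (c : 'rV_q) (u : 'M_(q, N)) f :
  minor (set_row A a (c *m u)) f = \sum_t c 0 t * minor (set_row A a (row t u)) f.
Proof.
rewrite minor_set_row (_ : colsub f (c *m u) = c *m colsub f u); last first.
  by apply/rowP => j; rewrite !mxE; apply: eq_bigr => k _; rewrite !mxE.
rewrite -mulmxA mxE; apply: eq_bigr => t _; rewrite minor_set_row; congr (_ * _).
rewrite !mxE; apply: eq_bigr => k _; rewrite !mxE //.
Qed.

End Minors.

(** For invertible matrices this is the inverse of a product up to determinants.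
    The matrices X + x and X + y over the polynomial ring have nonzero
    determinant; the general case is their value at X = 0. *)
Lemma adj_mulmx (F : fieldType) r (x y : 'M[F]_r) :
  \adj (x *m y) = \adj y *m \adj x.
Proof.
case: r x y => [|r] x y; first by apply/matrixP => -[].
pose X (z : 'M[F]_r.+1) := char_poly_mx (- z).
have X0 z : map_mx (horner_eval 0) (X z) = z.
  by apply/matrixP => i j; rewrite !mxE /= /horner_eval hornerD hornerN hornerC hornerMn hornerX mul0rn add0r opprK.
have Xd z : \det (X z) != 0.
  by rewrite -/(char_poly _) monic_neq0 ?char_poly_monic.
(* The determinants cancel because the polynomial ring is a domain. *)
have main : \adj (X x *m X y) = \adj (X y) *m \adj (X x).
  set Z := X x *m X y.
  have Zd : \det Z != 0 by rewrite det_mulmx mulf_neq0.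
  have E : \adj Z *m Z *m (\adj (X y) *m \adj (X x)) = \det Z *: \adj Z.
    rewrite /Z -!mulmxA [X y *m _]mulmxA mul_mx_adj mul_scalar_mx -!scalemxAr.
    by rewrite mul_mx_adj mul_mx_scalar scalerA mulrC det_mulmx.
  apply/eqP; rewrite -subr_eq0.
  have : \det Z *: (\adj Z - \adj (X y) *m \adj (X x)) == 0.
    by rewrite scalerBr -E mul_adj_mx mul_scalar_mx subrr.
  by rewrite scalemx_eq0 (negPf Zd).
have := congr1 (map_mx (horner_eval 0)) main.
by rewrite map_mxM !map_mx_adj map_mxM !X0.
Qed.

Section Tangent.
Variables (F : fieldType) (r n : nat).
Local Notation N := n.+1.
Local Notation M := #|rsubsets r n|.
Implicit Types (A B C : 'M[F]_(r, N)) (w : 'rV[F]_N).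

Definition subset_elt (R : nat) (x : 'I_#|rsubsets R n|) (b : 'I_R) : 'I_N :=
  nth ord0 (enum (enum_val x)) b.

Definition plucker A : 'rV[F]_M := \row_x minor A (subset_elt x).

Lemma plucker_wedge (v : r.-tuple 'rV[F]_N) : wedge v = plucker (\matrix_(a < r) tnth v a).
Proof.
apply/rowP => x; rewrite !mxE; congr (\det _).
by apply/matrixP => i j; rewrite !mxE.
Qed.

Lemma plucker_mul (x : 'M_r) A : plucker (x *m A) = \det x *: plucker A.
Proof. by apply/rowP => s; rewrite !mxE minor_mul. Qed.

Lemma plucker_set_row_sum A a q (c : 'rV_q) (u : 'M_(q, N)) :
  plucker (set_row A a (c *m u)) = \sum_t c 0 t *: plucker (set_row A a (row t u)).
Proof.
apply/rowP => s; rewrite summxE mxE minor_set_row_sum.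
by apply: eq_bigr => t _; rewrite !mxE.
Qed.

Lemma plucker_set_rowD A a w w' : plucker (set_row A a (w + w')) = plucker (set_row A a w) + plucker (set_row A a w').
Proof.
apply/rowP => s; rewrite !mxE !minor_set_row (_ : colsub _ (w + w') = colsub (subset_elt s) w + colsub (subset_elt s) w').
  by rewrite mulmxDl mxE.
by apply/rowP => j; rewrite !mxE.
Qed.

Lemma plucker_set_row_row A a b : plucker (set_row A a (row b A)) = if a == b then plucker A else 0.
Proof. by apply/rowP => s; rewrite !mxE minor_set_row_row; case: eqP; rewrite ?mxE. Qed.

Lemma plucker_set_row_mul (y : 'M_r) A a w :
  plucker (set_row (y *m A) a w) = \sum_b \adj y b a *: plucker (set_row A b w).
Proof.
apply/rowP => s; rewrite summxE mxE minor_set_row.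
rewrite (_ : colsub _ (y *m A) = y *m colsub (subset_elt s) A); last first.
  by apply/matrixP => i j; rewrite !mxE; apply: eq_bigr => k _; rewrite !mxE.
rewrite adj_mulmx mulmxA mxE; apply: eq_bigr => b _.
by rewrite [RHS]mxE [plucker _ _ _]mxE minor_set_row mulrC.
Qed.

(** When u is a complement of A, these vectors together with the wedge of A span
    the tangent space of the cone over the Grassmannian at that wedge. *)
Definition tangent_along q A (u : 'M[F]_(q, N)) : 'M[F]_(#|{: 'I_r * 'I_q}|, M) :=
  \matrix_(x < #|{: 'I_r * 'I_q}|) plucker (set_row A (enum_val x).1 (row (enum_val x).2 u)).

Definition tangent A := tangent_along A (1%:M : 'M_N).

Lemma tangent_along_row q A (u : 'M[F]_(q, N)) a t : (plucker (set_row A a (row t u)) <= tangent_along A u)%MS.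
Proof.
rewrite (_ : plucker _ = row (enum_rank (a, t)) (tangent_along A u)) ?row_sub //.
by rewrite rowK enum_rankK.
Qed.

Lemma tangent_along_sub q p A (u : 'M[F]_(q, N)) (E : 'M_(p, M)) :
  (forall a t, (plucker (set_row A a (row t u)) <= E)%MS) -> (tangent_along A u <= E)%MS.
Proof. by move=> h; apply/row_subP => x; rewrite rowK. Qed.

Lemma tangent_along_mem q A (u : 'M[F]_(q, N)) a w : (w <= u)%MS -> (plucker (set_row A a w) <= tangent_along A u)%MS.
Proof.
case/submxP => c ->; rewrite plucker_set_row_sum; apply: summx_sub => t _.
by apply: scalemx_sub; apply: tangent_along_row.
Qed.

Lemma tangent_mem A a w : (plucker (set_row A a w) <= tangent A)%MS.
Proof. by apply: tangent_along_mem; apply: submx1. Qed.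

Lemma plucker_tangent A : (0 < r)%N -> (plucker A <= tangent A)%MS.
Proof. by move=> r0; rewrite -[A in plucker A](set_row_row A (Ordinal r0)); apply: tangent_mem. Qed.

(** The tangent space depends on the space spanned by the rows only. *)
Lemma tangent_mul (y : 'M_r) A : (tangent (y *m A) <= tangent A)%MS.
Proof.
apply: tangent_along_sub => a t; rewrite plucker_set_row_mul; apply: summx_sub => b _.
by apply: scalemx_sub; apply: tangent_mem.
Qed.

Lemma tangent_subspace A B : (A <= B)%MS -> (tangent A <= tangent B)%MS.
Proof. by case/submxP => y ->; apply: tangent_mul. Qed.

(** Replacing a row of A by a combination of the rows of A gives a multiple of
    the wedge of A. *)
Lemma tangent_complement q A (u : 'M[F]_(q, N)) : row_full (col_mx A u) ->
  (tangent A <= plucker A + tangent_along A u)%MS.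
Proof.
move=> full; apply: tangent_along_sub => a t.
have /submxP [c ->] : (row t (1%:M : 'M_N) <= col_mx A u)%MS by apply: submx_full.
rewrite -[c]hsubmxK mul_row_col plucker_set_rowD; apply: addmx_sub; last first.
  by apply: submx_trans (addsmxSr _ _); apply: tangent_along_mem; apply: submxMl.
rewrite plucker_set_row_sum; apply: summx_sub => b _; apply: scalemx_sub.
rewrite plucker_set_row_row; case: eqP => _; last exact: sub0mx.
exact: addsmxSl.
Qed.

Lemma rank_tangent_along q A (u : 'M[F]_(q, N)) : (\rank (tangent_along A u) <= r * q)%N.
Proof. by apply: leq_trans (rank_leq_row _) _; rewrite card_prod !card_ord. Qed.

Lemma rank_adds p1 p2 q (X : 'M[F]_(p1, q)) (Y : 'M[F]_(p2, q)) a b :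
  (\rank X <= a)%N -> (\rank Y <= b)%N -> (\rank (X + Y)%MS <= a + b)%N.
Proof. by move=> xa yb; rewrite (leq_trans (mxrank_adds_leqif X Y)) // leq_add. Qed.

Lemma rank_tangent_complement q A (u : 'M[F]_(q, N)) : row_full (col_mx A u) ->
  (\rank (tangent A) <= r * q + 1)%N.
Proof.
move=> full; apply: leq_trans (mxrankS (tangent_complement full)) _.
by rewrite addnC rank_adds ?rank_tangent_along // rank_leq_row.
Qed.

Lemma rank_tangent A : row_free A -> (\rank (tangent A) <= r * (N - r) + 1)%N.
Proof.
move=> fA; have rk : \rank (A^C)%MS = (N - r)%N by rewrite mxrank_compl (eqP fA).
rewrite -rk; apply: (@rank_tangent_complement _ _ (row_base (A^C)%MS)).
rewrite -sub1mx -addsmxE (submx_trans (submx_full _ (addsmx_compl_full A))) //.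
by rewrite addsmxS // eq_row_base.
Qed.

End Tangent.

(** * The parametrisation of the secant variety *)

Section Param.
Local Open Scope classical_set_scope.
Local Open Scope ring_scope.
Variables (F : numFieldType) (s k n : nat).
Local Notation r := k.+1.
Local Notation N := n.+1.
Local Notation M := #|rsubsets r n|.
Local Notation D := #|{: 'I_s * 'I_r * 'I_N}|.

Definition points (v : 'I_D -> F) (i : 'I_s) : 'M[F]_(r, N) :=
  \matrix_(a, j) v (enum_rank (i, a, j)).

Definition unpoints (V : 'I_s -> 'M[F]_(r, N)) (x : 'I_D) : F :=
  let: (i, a, j) := enum_val x in V i a j.

Lemma unpointsK V i : points (unpoints V) i = V i.
Proof. by apply/matrixP => a j; rewrite mxE /unpoints enum_rankK. Qed.

Definition generic_points (i : 'I_s) : 'M[{mpoly F[D]}]_(r, N) :=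
  \matrix_(a, j) 'X_(enum_rank (i, a, j)).

(** No coefficients are needed in front of the wedges: they can be absorbed in the
    first row of each matrix. *)
Definition secmap (x : 'I_M) : {mpoly F[D]} := \sum_i minor (generic_points i) (subset_elt x).

Lemma generic_points_eval v i : map_mx (meval v) (generic_points i) = points v i.
Proof. by apply/matrixP => a j; rewrite !mxE mevalXU. Qed.

Lemma evalrow_secmap v : evalrow secmap v = \sum_i plucker (points v i).
Proof.
apply/rowP => x; rewrite summxE mxE raddf_sum; apply: eq_bigr => i _ /=.
rewrite mxE -generic_points_eval /minor -det_map_mx; congr (\det _).
by apply/matrixP => a b; rewrite !mxE.
Qed.

Lemma secmap_homog x : secmap x \is r.-homog.
Proof.
apply: rpred_sum => i _; apply: rpred_sum => p _; rewrite -signr_odd.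
have hL (L : seq 'I_r) : \prod_(a <- L) colsub (subset_elt x) (generic_points i) a (p a) \is (size L).-homog.
  elim: L => [|a L IH]; first by rewrite big_nil dhomog1.
  rewrite big_cons /= -[(size L).+1]add1n; apply: dhomogM IH.
  by rewrite !mxE dhomogX /= mdeg1.
have := hL (index_enum 'I_r); rewrite /index_enum -enumT size_enum_ord => h.
by case: (odd _); rewrite ?expr1 ?expr0 ?mul1r // mulN1r dhomogN.
Qed.

Lemma mderiv_det m (A : 'M[{mpoly F[D]}]_m) x :
  (forall a b, (A a b)^`M(x) = 0) -> (\det A)^`M(x) = 0.
Proof.
move=> h; rewrite /determinant raddf_sum /= big1 // => p _.
rewrite -signr_odd mulrC.
have -> : forall q : {mpoly F[D]}, q^`M(x) = 0 -> (q * (-1) ^+ odd p)^`M(x) = 0.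
- by move=> q hq; case: (odd p); rewrite ?expr1 ?expr0 ?mulrN1 ?mderivN ?mulr1 hq ?oppr0.
- by [].
apply: (@big_ind _ (fun q : {mpoly F[D]} => q^`M(x) = 0)) => //.
  by rewrite -mpolyC1 mderivC.
by move=> p1 p2 h1 h2; rewrite mderivM h1 h2 mul0r mulr0 addr0.
Qed.

(** The variable occurs in row a of the i-th matrix only, so the cofactors of
    that row are constants. *)
Lemma mderiv_minor i i' a j f :
  (minor (generic_points i') f)^`M(enum_rank (i, a, j)) =
  (if i == i' then minor (set_row (generic_points i) a (delta_mx 0 j)) f else 0).
Proof.
case: eqP => [<-|ni]; last first.
  apply: mderiv_det => b c; rewrite !mxE mderivXU.
  by case: eqP => // /enum_rank_inj [] e; rewrite e in ni.
rewrite /minor (expand_det_row _ a) (big_morph (mderiv _) (mderivD _) (mderiv0 _ _)).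
rewrite (expand_det_row _ a); apply: eq_bigr => b _.
rewrite mderivM [X in _ + _ * X](_ : _ = 0) ?mulr0 ?addr0; last first.
  rewrite /cofactor mulrC.
  have hd : (\det (row' a (col' b (colsub f (generic_points i)))))^`M(enum_rank (i, a, j)) = 0.
    apply: mderiv_det => c e; rewrite !mxE mderivXU.
    by case: eqP => // /enum_rank_inj [] /eqP; rewrite eq_sym (negPf (neq_lift _ _)).
  by rewrite -signr_odd; case: (odd _); rewrite ?expr1 ?expr0 ?mulrN1 ?mderivN ?mulr1 hd ?oppr0.
have cE : cofactor (colsub f (set_row (generic_points i) a (delta_mx 0 j))) a b =
    cofactor (colsub f (generic_points i)) a b.
  rewrite /cofactor; congr (_ * _); congr determinant.
  by apply/matrixP => c e; rewrite !mxE eq_sym (negPf (neq_lift _ _)).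
have eE : (colsub f (generic_points i) a b)^`M(enum_rank (i, a, j)) =
    colsub f (set_row (generic_points i) a (delta_mx 0 j)) a b.
  rewrite [in LHS]mxE [in LHS]mxE mderivXU [RHS]mxE [RHS]mxE eqxx [RHS]mxE eqxx /=.
  by rewrite (inj_eq (@enum_rank_inj _)) !xpair_eqE !eqxx.
by rewrite eE cE.
Qed.

Lemma jac_row v i a j : row (enum_rank (i, a, j)) (jac secmap v) =
  plucker (set_row (points v i) a (delta_mx 0 j)).
Proof.
apply/rowP => x; rewrite !mxE.
rewrite (big_morph (mderiv _) (mderivD _) (mderiv0 _ _)) raddf_sum (bigD1 i) //=.
rewrite mderiv_minor eqxx big1 ?addr0 => [|i' /negPf ni]; last first.
  by rewrite mderiv_minor eq_sym ni meval0.
rewrite /minor -det_map_mx -generic_points_eval; congr (\det _); apply/matrixP => b c; rewrite !mxE.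
case: (b == a) => //=.
by case: (subset_elt x c == j); rewrite ?mulr1n ?mulr0n ?meval1 ?meval0.
Qed.

(** Terracini: the image of the differential of the sum map is the sum of the
    tangent spaces. *)
Lemma jac_tangent v : (jac secmap v :=: \sum_i <<tangent (points v i)>>)%MS.
Proof.
apply/eqmxP/andP; split.
  apply/row_subP => x; rewrite -[x]enum_valK; case: (enum_val x) => [[i a] j].
  rewrite jac_row; apply: (sumsmx_sup i) => //.
  by rewrite genmxE tangent_mem.
apply/sumsmx_subP => i _; rewrite genmxE; apply: tangent_along_sub => a t.
by rewrite row1 -jac_row row_sub.
Qed.

Lemma plucker_neq0_free (A : 'M[F]_(r, N)) : plucker A != 0 -> row_free A.
Proof.
move=> pn; apply/inj_row_free => u uA; apply/eqP; apply: contraNT pn => un.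
apply/eqP/rowP => x; rewrite !mxE; apply/eqP/det0P; exists u => //.
have -> : colsub (subset_elt x) A = A *m \matrix_(j, b) (j == subset_elt x b)%:R.
  apply/matrixP => a b; rewrite !mxE (bigD1 (subset_elt x b)) //= mxE eqxx mulr1.
  by rewrite big1 ?addr0 // => j /negPf nj; rewrite mxE nj mulr0.
by rewrite mulmxA uA mul0mx.
Qed.

Lemma Gr_plucker (A : 'M[F]_(r, N)) (p : pspace F M) : plucker A != 0 ->
  \val p = <[plucker A]>%VS -> Gr F k n p.
Proof.
move=> pn pE; pose b : r.-tuple 'rV[F]_N := [tuple row a A | a < r].
have bA : \matrix_a tnth b a = A.
  by apply/row_matrixP => a; rewrite rowK tnth_mktuple.
have fb : free b.
  apply/freeP => c cb a; have := row_free_inj (plucker_neq0_free pn) (_ : (\row_a c a) *m A = 0 *m A).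
  move=> /(_ _) e; have : \row_a c a = 0 by apply: e; rewrite mul0mx mulmx_sum_row -[RHS]cb; apply: eq_bigr => i _; rewrite mxE -tnth_nth tnth_mktuple.
  by move/rowP/(_ a); rewrite !mxE.
exists <<b>>%VS, b; split; last by rewrite plucker_wedge bA.
  by move: fb; rewrite /free size_tuple => /eqP.
by rewrite /basis_of eqxx fb.
Qed.

(** A matrix whose wedge is zero contributes nothing to the sum and may stand for
    any point of the Grassmannian. *)
Lemma secant_proj_image : secant_variety s (Gr F k n) = zariski_closure (proj_image secmap).
Proof.
congr zariski_closure; apply/seteqP; split=> p /=.
  move=> [x [xG px]].
  have [u un pu] := point_line p.
  have {px} : u \in (\sum_(i < s) \val (x i))%VS by rewrite (subvP px) // pu memv_line.
  case/memv_sumP => w wx uE.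
  have /boolp.choice [V hV] : forall i, exists A : 'M[F]_(r, N), w i = plucker A.
    move=> i; have [U [b [_ _ xE]]] := xG i.
    have := wx i isT; rewrite xE plucker_wedge => /vlineP [c ->].
    (* The coefficient c is absorbed in the first row. *)
    exists (diag_mx (\row_a if a == ord0 then c else 1) *m \matrix_a tnth b a).
    rewrite plucker_mul det_diag big_ord_recl mxE eqxx big1 ?mulr1 //.
    by move=> a _; rewrite mxE.
  exists (unpoints V); rewrite evalrow_secmap pu; congr <[_]>%VS; rewrite uE.
  by apply: eq_bigr => i _; rewrite unpointsK.
move=> [v pE].
have un : evalrow secmap v != 0.
  have [u u0 pu] := point_line p; apply: contra u0 => /eqP w0.
  by have := memv_line u; rewrite -pu pE w0 => /vlineP [c ->]; rewrite scaler0.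
have [i0 pi0] : exists i, plucker (points v i) != 0.
  apply: contrapT => /forallNP h; move: un; rewrite evalrow_secmap big1 ?eqxx // => i _.
  by apply/eqP; have /negP := h i; rewrite negbK.
have ex (i : 'I_s) : exists q : pspace F M, Gr F k n q /\ plucker (points v i) \in \val q.
  case: (eqVneq (plucker (points v i)) 0) => [->|ni].
    have [q qE] := pointP pi0; exists q; split; first exact: Gr_plucker qE.
    exact: mem0v.
  have [q qE] := pointP ni; exists q; split; first exact: Gr_plucker qE.
  by rewrite qE memv_line.
have [x hx] := boolp.choice ex; exists x; split; first by move=> i; have [] := hx i.
rewrite pE -memvE evalrow_secmap; apply: memv_sumr => i _; by have [] := hx i.
Qed.

Definition generic (P : ('I_D -> F) -> Prop) :=
  exists2 Delta : {mpoly F[D]}, Delta != 0 & forall v, Delta.@[v] != 0 -> P v.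

Lemma genericI P Q : generic P -> generic Q -> generic (fun v => P v /\ Q v).
Proof.
move=> [d1 n1 h1] [d2 n2 h2]; exists (d1 * d2); first exact: mulf_neq0.
by move=> v; rewrite mevalM mulf_eq0 negb_or => /andP[/h1 ? /h2 ?].
Qed.

Lemma generic_imp (P Q : ('I_D -> F) -> Prop) : (forall v, P v -> Q v) -> generic P -> generic Q.
Proof. by move=> PQ [d d0 h]; exists d => // v /h /PQ. Qed.

Lemma generic_all (P : 'I_s -> ('I_D -> F) -> Prop) :
  (forall i, generic (P i)) -> generic (fun v => forall i, P i v).
Proof.
move=> h; have [d hd] := boolp.choice (fun i => let: ex_intro2 d d0 h' := h i in
  ex_intro (fun d => d != 0 /\ forall v, d.@[v] != 0 -> P i v) d (conj d0 h')).
exists (\prod_i d i); first by apply/prodf_neq0 => i _; have [] := hd i.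
move=> v; rewrite rmorph_prod => /prodf_neq0 dv i; have [_] := hd i.
by apply; apply: dv.
Qed.

Lemma generic_rank p (E : ('I_s -> 'M[F]_(r, N)) -> 'M[F]_(p, N))
    (Et : 'M[{mpoly F[D]}]_(p, N)) V m :
  (forall v, map_mx (meval v) Et = E (points v)) -> (m <= \rank (E V))%N ->
  generic (fun v => m <= \rank (E (points v)))%N.
Proof.
move=> hE; have e : E V = map_mx (meval (unpoints V)) Et.
  by rewrite hE; congr E; apply/funext => i; rewrite unpointsK.
rewrite e => /rank_open [d dn0 h]; exists d => // v /h; by rewrite hE.
Qed.

Lemma upper_bound b l C : generic (fun v => \rank (\sum_i <<tangent (points v i)>>)%MS <= b)%N ->
  irreducible_chain (secant_variety s (Gr F k n)) l C -> (l < b)%N.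
Proof.
move=> [d dn0 h]; rewrite secant_proj_image => ch.
have [v dv lt] := chain_rank (ltn0Sn k) (homogeneous_map_homog secmap_homog) ch dn0.
by apply: leq_trans lt _; rewrite jac_tangent; exact: h.
Qed.

Lemma lower_bound V m : (m < \rank (\sum_(i < s) <<tangent (V i : 'M[F]_(r, N))>>)%MS)%N ->
  exists C, irreducible_chain (secant_variety s (Gr F k n)) m C.
Proof.
move=> lt; rewrite secant_proj_image; apply: (rank_chain (v0 := unpoints V) (ltn0Sn k) secmap_homog).
by rewrite jac_tangent; under eq_bigr do rewrite unpointsK.
Qed.

End Param.

(** * Relations between tangent spaces on Gr(3,7) and Gr(2,8) *)

Section Mix.
Variables (F : numFieldType) (k n : nat).
Local Notation r := k.+1.
Local Notation N := n.+1.
Implicit Types (A B C : 'M[F]_(r, N)).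

(** A term in the expansion of the wedge of a sum of matrices: sg tells from which
    summand each row is taken. *)
Definition mix p (m : 'I_p -> 'M[F]_(r, N)) (sg : 'I_r -> 'I_p) : 'M[F]_(r, N) :=
  \matrix_(a, j) m (sg a) a j.

Lemma plucker_sum p (m : 'I_p -> 'M[F]_(r, N)) :
  plucker (\sum_t m t) = \sum_(sg : {ffun 'I_r -> 'I_p}) plucker (mix m sg).
Proof.
apply/rowP => x; rewrite summxE mxE.
under [RHS]eq_bigr do rewrite mxE.
rewrite /minor /determinant exchange_big /=; apply: eq_bigr => q _.
rewrite -mulr_sumr; congr (_ * _).
under eq_bigr => a _ do rewrite mxE summxE.
rewrite bigA_distr_bigA /=; apply: eq_bigr => sg _; apply: eq_bigr => a _.
by rewrite !mxE.
Qed.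

Lemma plucker_row0 A a : (forall j, A a j = 0) -> plucker A = 0.
Proof.
move=> A0; rewrite -(set_row_row A a) (_ : row a A = 0 *m A); last first.
  by rewrite mul0mx; apply/rowP => j; rewrite !mxE A0.
by rewrite plucker_set_row_sum big1 // => t _; rewrite mxE scale0r.
Qed.

Lemma plucker_set_row_mix p (m : 'I_p -> 'M[F]_(r, N)) i t0 :
  plucker (set_row (\sum_t m t) i (row i (m t0))) =
  \sum_(sg : {ffun 'I_r -> 'I_p} | sg i == t0) plucker (mix m sg).
Proof.
(* Deleting row i from all summands but t0 leaves the terms with sg i = t0. *)
pose m' t : 'M[F]_(r, N) := \matrix_(a, j) (if (a == i) && (t != t0) then 0 else m t a j).
have -> : set_row (\sum_t m t) i (row i (m t0)) = \sum_t m' t.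
  apply/matrixP => a j; rewrite !mxE !summxE; case: eqP => [->|/eqP ai].
    rewrite (bigD1 t0) //= !mxE !eqxx /= big1 ?addr0 // => t nt.
    by rewrite mxE eqxx nt.
  by apply: eq_bigr => t _; rewrite mxE (negPf ai).
rewrite plucker_sum (bigID (fun sg : {ffun 'I_r -> 'I_p} => sg i == t0)) /=.
rewrite [X in _ + X]big1 ?addr0 => [|sg ni]; last first.
  by apply: (@plucker_row0 _ i) => j; rewrite !mxE eqxx ni.
apply: eq_bigr => sg /eqP si; congr plucker; apply/matrixP => a j; rewrite !mxE.
by case: eqP => //= ->; rewrite si eqxx.
Qed.

(** Up to a base change such a B is A with one row replaced. *)
Lemma plucker_almost A B b : (forall a, a != b -> (row a B <= A)%MS) -> (plucker B <= tangent A)%MS.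
Proof.
move=> h; pose X := \matrix_a (if a == b then 0 else row a B).
have XA : (X <= A)%MS.
  by apply/row_subP => a; rewrite rowK; case: eqP => [_|/eqP /h //]; apply: sub0mx.
apply: submx_trans (tangent_subspace XA); rewrite (_ : B = set_row X b (row b B)) ?tangent_mem //.
apply/matrixP => a j; rewrite [RHS]mxE; case: (eqVneq a b) => [->|ab]; first by rewrite mxE.
by rewrite mxE (negPf ab) mxE.
Qed.

(** Expand all wedges over the choices sg of a summand for every row.  The
    coefficient of a choice is c minus the number of rows taken from summand t0;
    where it is not zero, all rows but one come from a single summand, and the
    term is tangent there. *)
Lemma wedge_sum_relation p (m : 'I_p -> 'M[F]_(r, N)) t0 (c : F) (E : 'M_#|rsubsets r n|) :
  (forall t, (tangent (m t) <= E)%MS) ->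
  (forall sg : {ffun 'I_r -> 'I_p}, (\sum_(i | sg i == t0) 1)%:R != c ->
     exists t b, forall a, a != b -> sg a = t) ->
  (c *: plucker (\sum_t m t) - \sum_i plucker (set_row (\sum_t m t)%R i (row i (m t0))) <= E)%MS.
Proof.
move=> mE h.
rewrite (eq_bigr (fun i => \sum_(sg : {ffun 'I_r -> 'I_p} | sg i == t0) plucker (mix m sg))); last first.
  by move=> i _; exact: plucker_set_row_mix.
rewrite plucker_sum (exchange_big_dep predT) //= scaler_sumr -sumrB.
apply: summx_sub => sg _; rewrite sumr_const -sum1_card -scaler_nat -scalerBl.
case: (eqVneq ((\sum_(i | sg i == t0) 1)%:R : F) c) => [->|ne].
  by rewrite subrr scale0r sub0mx.
have [t [b hb]] := h _ ne; apply: scalemx_sub; apply: submx_trans (mE t).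
apply: (@plucker_almost _ _ b) => a /hb at_; rewrite (_ : row a _ = row a (m t)) ?row_sub //.
by apply/rowP => j; rewrite !mxE at_.
Qed.

End Mix.

Section Defects.
Variables (F : numFieldType).

(** The combinatorial condition of [wedge_sum_relation] for two summands with
    four rows, where c = 2. *)
Lemma almost_constant42 (sg : {ffun 'I_4 -> 'I_2}) :
  (\sum_(i | sg i == ord0) 1)%:R != 2%:R :> F ->
  exists t b, forall a, a != b -> sg a = t.
Proof.
rewrite eqr_nat big_mkcond /=.
rewrite (eq_bigr (fun i : 'I_4 => if sg (inord i) == ord0 then 1%N else 0%N)); last first.
  by move=> i _; rewrite inord_val.
rewrite !big_ord_recl big_ord0 /bump /= => ne.
have T (y : 'I_2) : y = ord0 \/ y = ord_max.
  by case: y => -[|[|//]] h; [left|right]; apply/val_inj.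
have O (P : 'I_4 -> Prop) : P (inord 0) -> P (inord 1) -> P (inord 2) -> P (inord 3) -> forall a, P a.
  by move=> ? ? ? ? a; rewrite -(inord_val a); case: a => -[|[|[|[|//]]]].
move: ne.
have [e0|e0] := T (sg (inord 0)); have [e1|e1] := T (sg (inord 1));
have [e2|e2] := T (sg (inord 2)); have [e3|e3] := T (sg (inord 3));
rewrite e0 e1 e2 e3 //= => _;
  first [exists ord0, (inord 0); apply: O; rewrite ?eqxx //; done
   | exists ord0, (inord 1); apply: O; rewrite ?eqxx //; done
   | exists ord0, (inord 2); apply: O; rewrite ?eqxx //; done
   | exists ord0, (inord 3); apply: O; rewrite ?eqxx //; done
   | exists ord_max, (inord 0); apply: O; rewrite ?eqxx //; done
   | exists ord_max, (inord 1); apply: O; rewrite ?eqxx //; done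
   | exists ord_max, (inord 2); apply: O; rewrite ?eqxx //; done
   | exists ord_max, (inord 3); apply: O; rewrite ?eqxx //; done].
Qed.

(** The combinatorial condition of [wedge_sum_relation] for three summands with
    three rows, where c = 1. *)
Lemma almost_constant33 (sg : {ffun 'I_3 -> 'I_3}) :
  (\sum_(i | sg i == ord0) 1)%:R != 1%:R :> F ->
  exists t b, forall a, a != b -> sg a = t.
Proof.
rewrite eqr_nat big_mkcond /=.
rewrite (eq_bigr (fun i : 'I_3 => if sg (inord i) == ord0 then 1%N else 0%N)); last first.
  by move=> i _; rewrite inord_val.
rewrite !big_ord_recl big_ord0 /bump /= => ne.
have T (y : 'I_3) : [\/ y = ord0, y = inord 1 | y = ord_max].
  by rewrite -(inord_val y); case: y => -[|[|[|//]]] h; [apply: Or31|apply: Or32|apply: Or33]; apply/val_inj; rewrite /= inordK.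
have O (P : 'I_3 -> Prop) : P (inord 0) -> P (inord 1) -> P (inord 2) -> forall a, P a.
  by move=> ? ? ? a; rewrite -(inord_val a); case: a => -[|[|[|//]]].
have n1 : (inord 1 : 'I_3) == ord0 = false by apply/negbTE; rewrite -val_eqE /= inordK.
move: ne.
have [e0|e0|e0] := T (sg (inord 0)); have [e1|e1|e1] := T (sg (inord 1));
have [e2|e2|e2] := T (sg (inord 2));
rewrite e0 e1 e2 ?n1 //= => _;
  first [exists ord0, (inord 0); apply: O; rewrite ?eqxx //; done
   | exists ord0, (inord 1); apply: O; rewrite ?eqxx //; done
   | exists ord0, (inord 2); apply: O; rewrite ?eqxx //; done
   | exists (inord 1), (inord 0); apply: O; rewrite ?eqxx //; done
   | exists (inord 1), (inord 1); apply: O; rewrite ?eqxx //; done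
   | exists (inord 1), (inord 2); apply: O; rewrite ?eqxx //; done
   | exists ord_max, (inord 0); apply: O; rewrite ?eqxx //; done
   | exists ord_max, (inord 1); apply: O; rewrite ?eqxx //; done
   | exists ord_max, (inord 2); apply: O; rewrite ?eqxx //; done].
Qed.

(** As c is not zero, the relation expresses the wedge of C by the other
    generators of the sum of the tangent spaces. *)
Lemma wedge_in_tangents k n p (m : 'I_p -> 'M[F]_(k.+1, n.+1)) t0 (c : F) (C A0 : 'M[F]_(k.+1, n.+1))
    (E : 'M_#|rsubsets k.+1 n|) :
  C = \sum_t m t -> (m t0 <= A0)%MS -> c != 0 ->
  (forall t, (tangent (m t) <= E)%MS) ->
  (forall sg : {ffun 'I_k.+1 -> 'I_p}, (\sum_(i | sg i == t0) 1)%:R != c ->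
     exists t b, forall a, a != b -> sg a = t) ->
  (plucker C <= E + tangent_along C A0)%MS.
Proof.
move=> eC mA c0 mE h; rewrite -(eqmx_scale _ c0) eC.
rewrite -[c *: _](subrK (\sum_i plucker (set_row (\sum_t m t)%R i (row i (m t0))))).
apply: addmx_sub.
  by apply: submx_trans (addsmxSl _ _); apply: wedge_sum_relation.
apply: submx_trans (addsmxSr _ _); apply: summx_sub => i _; apply: tangent_along_mem.
by apply: submx_trans mA; apply: row_sub.
Qed.

Lemma sub_colu p q e (A : 'M[F]_(p, e)) (B : 'M_(q, e)) : (A <= col_mx A B)%MS.
Proof. by rewrite -addsmxE addsmxSl. Qed.

Lemma sub_cold p q e (A : 'M[F]_(p, e)) (B : 'M_(q, e)) : (B <= col_mx A B)%MS.
Proof. by rewrite -addsmxE addsmxSr. Qed.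

Lemma row_full_sub p q e (A : 'M[F]_(p, e)) (B : 'M_(q, e)) :
  row_full A -> (A <= B)%MS -> row_full B.
Proof. by rewrite -!sub1mx; exact: submx_trans. Qed.

(** C is the sum of a matrix over A and a matrix over B, and A is a complement of
    C: the bound is 17 + 17 + 16, where 16 counts the tangent directions at C
    without the wedge of C itself. *)
Lemma defect48 (A B C : 'M[F]_(4, 8)) :
  row_full (col_mx A B) -> row_full (col_mx C A) ->
  (\rank (tangent A + tangent B + tangent C)%MS <= 50)%N.
Proof.
move=> fAB fCA; set E := (tangent A + tangent B)%MS.
have fBA : row_full (col_mx B A) by rewrite -sub1mx -addsmxE addsmxC addsmxE sub1mx.
have [u uE] : exists u, C = u *m col_mx A B by apply/submxP; apply: submx_full.
pose m (t : 'I_2) := if t == ord0 then lsubmx u *m A else rsubmx u *m B.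
have CE : C = \sum_t m t.
  by rewrite !big_ord_recl big_ord0 addr0 /m /= -mul_row_col hsubmxK -uE.
have pC : (plucker C <= E + tangent_along C A)%MS.
  have := @wedge_in_tangents 3 7 2 m ord0 2%:R C A E CE; apply.
  - by rewrite /m eqxx submxMl.
  - by rewrite pnatr_eq0.
  - move=> t; rewrite /m; case: ifP => _.
      by apply: submx_trans (addsmxSl _ _); apply: tangent_mul.
    by apply: submx_trans (addsmxSr _ _); apply: tangent_mul.
  exact: almost_constant42.
have le : (tangent A + tangent B + tangent C <= (plucker A + tangent_along A B) + (plucker B + tangent_along B A) + tangent_along C A)%MS.
  have EE : (E <= (plucker A + tangent_along A B) + (plucker B + tangent_along B A))%MS.
    by rewrite addsmxS ?tangent_complement.
  rewrite addsmx_sub; apply/andP; split; first exact: submx_trans EE (addsmxSl _ _).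
  apply: submx_trans (tangent_complement fCA) _; rewrite addsmx_sub addsmxSr andbT.
  apply: submx_trans pC _; rewrite addsmx_sub addsmxSr andbT.
  exact: submx_trans EE (addsmxSl _ _).
apply: leq_trans (mxrankS le) _.
by rewrite (@rank_adds _ _ _ _ _ _ 34 16) ?(@rank_adds _ _ _ _ _ _ 17 17) ?(@rank_adds _ _ _ _ _ _ 1 16) ?rank_leq_row ?rank_tangent_along.
Qed.

(** As in [defect48], with a decomposition of G over A, B and C; the bound is
    19 + 19 + 19 + 18. *)
Lemma defect39 (A B C G : 'M[F]_(3, 9)) :
  row_full (col_mx A (col_mx B C)) -> row_full (col_mx G (col_mx A B)) ->
  (\rank (tangent A + tangent B + tangent C + tangent G)%MS <= 75)%N.
Proof.
move=> fABC fGAB; set E := (tangent A + tangent B + tangent C)%MS.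
have fBAC : row_full (col_mx B (col_mx A C)).
  apply: row_full_sub fABC _; rewrite !col_mx_sub sub_colu.
  by rewrite (submx_trans (sub_colu A C)) ?(submx_trans (sub_cold A C)) ?sub_cold.
have fCAB : row_full (col_mx C (col_mx A B)).
  apply: row_full_sub fABC _; rewrite !col_mx_sub sub_colu.
  by rewrite (submx_trans (sub_colu A B)) ?(submx_trans (sub_cold A B)) ?sub_cold.
have [u uE] : exists u, G = u *m col_mx A (col_mx B C) by apply/submxP; apply: submx_full.
pose uA := lsubmx u; pose uB := lsubmx (rsubmx u); pose uC := rsubmx (rsubmx u).
pose m (t : 'I_3) := if t == ord0 then uA *m A else if t == ord_max then uC *m C else uB *m B.
have GE : G = \sum_t m t.
  by rewrite !big_ord_recl big_ord0 addr0 /m /= /uA /uB /uC -!mul_row_col !hsubmxK -uE.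
have pG : (plucker G <= E + tangent_along G A)%MS.
  have := @wedge_in_tangents 2 8 3 m ord0 1%:R G A E GE; apply.
  - by rewrite /m eqxx submxMl.
  - by rewrite pnatr_eq0.
  - move=> t; rewrite /m; case: ifP => _; last case: ifP => _.
    + by apply: submx_trans (tangent_mul _ _) _; rewrite /E -addsmxA addsmxSl.
    + by apply: submx_trans (tangent_mul _ _) _; rewrite /E addsmxSr.
    + by apply: submx_trans (tangent_mul _ _) _; rewrite /E (submx_trans _ (addsmxSl _ _)) // addsmxSr.
  exact: almost_constant33.
have le : (E + tangent G <= (plucker A + tangent_along A (col_mx B C)) + (plucker B + tangent_along B (col_mx A C))
    + (plucker C + tangent_along C (col_mx A B)) + tangent_along G (col_mx A B))%MS.
  have EE : (E <= (plucker A + tangent_along A (col_mx B C)) + (plucker B + tangent_along B (col_mx A C))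
    + (plucker C + tangent_along C (col_mx A B)))%MS by rewrite !addsmxS ?tangent_complement.
  rewrite addsmx_sub; apply/andP; split; first exact: submx_trans EE (addsmxSl _ _).
  apply: submx_trans (tangent_complement fGAB) _; rewrite addsmx_sub addsmxSr andbT.
  apply: submx_trans pG _; rewrite addsmx_sub; apply/andP; split.
    exact: submx_trans EE (addsmxSl _ _).
  apply: submx_trans (addsmxSr _ _); apply: tangent_along_sub => a t; apply: tangent_along_mem.
  by apply: submx_trans (row_sub _ _) _; rewrite -addsmxE addsmxSl.
apply: leq_trans (mxrankS le) _.
by rewrite (@rank_adds _ _ _ _ _ _ 57 18) ?(@rank_adds _ _ _ _ _ _ 38 19) ?(@rank_adds _ _ _ _ _ _ 19 19) ?(@rank_adds _ _ _ _ _ _ 1 18) ?rank_leq_row ?(leq_trans (rank_tangent_along _ _)).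
Qed.

End Defects.

(** * Relations between tangent spaces on Gr(2,6) *)

Section Triple.
Variables (F : numFieldType) (n : nat).
Local Notation N := n.+1.
Implicit Types (x y z : 'rV[F]_N) (A B : 'M[F]_(3, N)).

Definition rows3 x y z : 'M[F]_(3, N) :=
  \matrix_(i < 3) (if i == ord0 then x else if i == ord_max then z else y).
Definition wedge3 x y z := plucker (rows3 x y z).

Let i1 : 'I_3 := lift ord0 ord0.

Lemma rows3_row0 x y z : row ord0 (rows3 x y z) = x. Proof. by rewrite rowK. Qed.
Lemma rows3_row1 x y z : row i1 (rows3 x y z) = y. Proof. by rewrite rowK. Qed.
Lemma rows3_row2 x y z : row ord_max (rows3 x y z) = z. Proof. by rewrite rowK. Qed.

Lemma ord3P (P : 'I_3 -> Prop) : P ord0 -> P i1 -> P ord_max -> forall i, P i.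
Proof.
move=> h0 h1 h2 [[|[|[|//]]] h].
- by rewrite (_ : Ordinal h = ord0) //; apply/val_inj.
- by rewrite (_ : Ordinal h = i1) //; apply/val_inj.
- by rewrite (_ : Ordinal h = ord_max) //; apply/val_inj.
Qed.

Lemma set_row0 x y z w : set_row (rows3 x y z) ord0 w = rows3 w y z.
Proof. by apply/matrixP => i j; move: i; apply: ord3P; rewrite !mxE. Qed.
Lemma set_row1 x y z w : set_row (rows3 x y z) i1 w = rows3 x w z.
Proof. by apply/matrixP => i j; move: i; apply: ord3P; rewrite !mxE. Qed.
Lemma set_row2 x y z w : set_row (rows3 x y z) ord_max w = rows3 x y w.
Proof. by apply/matrixP => i j; move: i; apply: ord3P; rewrite !mxE. Qed.

Lemma wedge3D0 x x' y z : wedge3 (x + x') y z = wedge3 x y z + wedge3 x' y z.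
Proof. by rewrite /wedge3 -(set_row0 x) plucker_set_rowD !set_row0. Qed.
Lemma wedge3D1 x y y' z : wedge3 x (y + y') z = wedge3 x y z + wedge3 x y' z.
Proof. by rewrite /wedge3 -(set_row1 x y) plucker_set_rowD !set_row1. Qed.
Lemma wedge3_01 x z : wedge3 x x z = 0.
Proof.
have := plucker_set_row_row (rows3 x x z) ord0 i1.
by rewrite rows3_row1 set_row0.
Qed.
Lemma wedge3_02 x y : wedge3 x y x = 0.
Proof.
have := plucker_set_row_row (rows3 x y x) ord0 ord_max.
by rewrite rows3_row2 set_row0.
Qed.
Lemma wedge3_12 x y : wedge3 x y y = 0.
Proof.
have := plucker_set_row_row (rows3 x y y) i1 ord_max.
by rewrite rows3_row2 set_row1.
Qed.

Lemma wedge3_swap x y z : wedge3 x y z = - wedge3 y x z.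
Proof.
apply/eqP; rewrite -addr_eq0; apply/eqP.
by rewrite -[RHS](wedge3_01 (x + y) z) wedge3D0 !wedge3D1 !wedge3_01 add0r addr0.
Qed.

Lemma wedge3_almost A x y z : [|| (x <= A)%MS && (y <= A)%MS, (x <= A)%MS && (z <= A)%MS
  | (y <= A)%MS && (z <= A)%MS] -> (wedge3 x y z <= tangent A)%MS.
Proof.
case/or3P => /andP[h1 h2]; [apply: (@plucker_almost _ _ _ _ _ ord_max)|
  apply: (@plucker_almost _ _ _ _ _ i1)|apply: (@plucker_almost _ _ _ _ _ ord0)];
by apply: ord3P; rewrite ?rows3_row0 ?rows3_row1 ?rows3_row2.
Qed.

(** All wedges of a row of A, a row of B and z, except for the last rows of both
    A and B. *)
Definition wedge3_span A B z : 'M[F]_(8, #|rsubsets 3 n|) :=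
  \matrix_(i < 8) wedge3 (row (inord (i %/ 3)) A) (row (inord (i %% 3)) B) z.

Lemma wedge3_bilin A B z (p q : 'rV[F]_3) : p 0 ord_max * q 0 ord_max = 0 ->
  (wedge3 (p *m A) (q *m B) z <= wedge3_span A B z)%MS.
Proof.
move=> pq.
have -> : wedge3 (p *m A) (q *m B) z = \sum_j \sum_k (p 0 j * q 0 k) *: wedge3 (row j A) (row k B) z.
  rewrite /wedge3 -(set_row0 0) plucker_set_row_sum; apply: eq_bigr => j _.
  rewrite set_row0 -(set_row1 _ 0) plucker_set_row_sum scaler_sumr; apply: eq_bigr => k _.
  by rewrite set_row1 scalerA.
apply: summx_sub => j _; apply: summx_sub => k _.
case: (ltnP (j * 3 + k) 8) => [lt|ge].
  apply: scalemx_sub; rewrite (_ : wedge3 _ _ _ = row (Ordinal lt) (wedge3_span A B z)) ?row_sub //.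
  rewrite rowK /= divnMDl // modnMDl divn_small ?ltn_ord // modn_small ?ltn_ord //.
  by rewrite addn0 !inord_val.
have [-> ->] : j = ord_max /\ k = ord_max.
  have := ltn_ord j; have := ltn_ord k; split; apply/val_inj => /=; lia.
by rewrite pq scale0r sub0mx.
Qed.

End Triple.

Section Defect37.
Variables (F : numFieldType).

(** Two vectors in a space of dimension 3 lie in a plane; g is a basis of the
    space that begins with a basis of such a plane. *)
Lemma half_frame (al : 'M[F]_(2, 3)) : exists (g : 'M[F]_3) (y : 'M[F]_(2, 3)),
  [/\ g \in unitmx, al = y *m g & forall i, y i ord_max = 0].
Proof.
exists (row_ebase al), (col_ebase al *m pid_mx (\rank al)); split.
- exact: row_ebase_unit.
- by rewrite mulmx_ebase.
move=> i; rewrite mxE big1 // => k _; rewrite mxE.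
by rewrite (_ : (k == ord_max :> nat) = false) ?mulr0 // ltn_eqF.
Qed.

(** Let e be the last row of C.  The space of C has a basis a_0 + b_0, a_1 + b_1, e
    with a_i in A and b_i in B.  Take bases A' and B' of A and B whose first two
    vectors span planes containing the a_i and the b_i.  Modulo the tangent
    spaces at A and B, of dimension 13 each, the tangent space at C lies in the
    span of the 8 wedges of A'_j, B'_k and e with (j, k) not (2, 2). *)
Lemma defect37 (A B C : 'M[F]_(3, 7)) :
  row_full (col_mx A (col_mx B (row ord_max C))) ->
  (\rank (tangent A + tangent B + tangent C)%MS <= 34)%N.
Proof.
set e := row ord_max C => full.
pose i1 : 'I_3 := lift ord0 ord0.
pose c : 'M[F]_(2, 7) := \matrix_(i < 2) row (if i == ord0 then ord0 else i1) C.
have /submxP [u uE] : (c <= col_mx A (col_mx B e))%MS by apply: submx_full.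
have [g [y [gU gE y2]]] := half_frame (lsubmx u).
have [h [z [hU hE z2]]] := half_frame (lsubmx (rsubmx u)).
pose t := rsubmx (rsubmx u).
pose A' := g *m A; pose B' := h *m B.
have cE : c = y *m A' + (z *m B' + t *m e).
  by rewrite uE -{1}[u]hsubmxK mul_row_col -{1}[rsubmx u]hsubmxK mul_row_col gE hE /A' /B' !mulmxA.
have AA' : (A <= A')%MS by rewrite -[A](mulKmx gU) submxMl.
have BB' : (B <= B')%MS by rewrite -[B](mulKmx hU) submxMl.
have fA : row_full (col_mx A' (col_mx B' e)).
  apply: row_full_sub full _; rewrite !col_mx_sub (submx_trans AA' (sub_colu _ _)).
  rewrite (submx_trans BB') ?(submx_trans (sub_colu B' e)) ?sub_cold //.
  by rewrite (submx_trans (sub_cold B' e)) ?sub_cold.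
have fB : row_full (col_mx B' (col_mx A' e)).
  apply: row_full_sub fA _; rewrite !col_mx_sub sub_colu.
  by rewrite (submx_trans (sub_colu A' e)) ?(submx_trans (sub_cold A' e)) ?sub_cold.
pose a i := row i y *m A'; pose b i := row i z *m B'.
pose C' := rows3 (a ord0 + b ord0) (a ord_max + b ord_max) e.
have CC' : (C <= C')%MS.
  have rC (i : 'I_2) (v : 'rV_7) : ((a i + b i)%R <= C')%MS -> v = row i c -> (v <= C')%MS.
    move=> le ->.
    have -> : row i c = (a i + b i) + row i t *m e.
      by rewrite cE !linearD /= !row_mul addrA.
    have eC : (e <= C')%MS.
      by rewrite -[X in (X <= _)%MS](rows3_row2 (a ord0 + b ord0) (a ord_max + b ord_max) e) row_sub.
    by rewrite addmx_sub ?le //; exact: submx_trans (submxMl _ _) eC.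
  apply/row_subP; apply: ord3P.
  - apply: (rC ord0); last by rewrite rowK.
    by rewrite -[X in (X <= _)%MS](rows3_row0 _ (a ord_max + b ord_max) e) row_sub.
  - apply: (rC ord_max); last by rewrite rowK.
    by rewrite -[X in (X <= _)%MS](rows3_row1 (a ord0 + b ord0) _ e) row_sub.
  - by rewrite -/e -[X in (X <= _)%MS](rows3_row2 (a ord0 + b ord0) (a ord_max + b ord_max) e) row_sub.
pose W := (tangent A' + tangent B' + wedge3_span A' B' e)%MS.
have WA X : (X <= tangent A')%MS -> (X <= W)%MS.
  by move=> le; rewrite (submx_trans le) // /W -addsmxA addsmxSl.
have WB X : (X <= tangent B')%MS -> (X <= W)%MS.
  by move=> le; rewrite (submx_trans le) // /W (submx_trans _ (addsmxSl _ _)) // addsmxSr.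
have WK X : (X <= wedge3_span A' B' e)%MS -> (X <= W)%MS.
  by move=> le; rewrite (submx_trans le) // /W addsmxSr.
have aA i : (a i <= A')%MS by apply: submxMl.
have bB i : (b i <= B')%MS by apply: submxMl.
have K1 i k : (wedge3 (a i) (row k B') e <= W)%MS.
  by apply: WK; rewrite rowE; apply: wedge3_bilin; rewrite mxE y2 mul0r.
have K2 i k : (wedge3 (row k A') (b i) e <= W)%MS.
  by apply: WK; rewrite rowE; apply: wedge3_bilin; rewrite [row i z _ _]mxE z2 mulr0.
have K3 i j : (wedge3 (a i) (b j) e <= W)%MS.
  by apply: WK; apply: wedge3_bilin; rewrite !mxE y2 mul0r.
have CW : (tangent C' <= W)%MS.
  have gen (w : 'rV_7) (i : 'I_3) : (w <= col_mx A' (col_mx B' e))%MS ->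
      (forall k, (plucker (set_row C' i (row k A')) <= W)%MS) ->
      (forall k, (plucker (set_row C' i (row k B')) <= W)%MS) ->
      (plucker (set_row C' i e) <= W)%MS -> (plucker (set_row C' i w) <= W)%MS.
    case/submxP => p ->; rewrite -[p]hsubmxK -[rsubmx p]hsubmxK !mul_row_col => hA hB he.
    rewrite !plucker_set_rowD !addmx_sub //.
    - by rewrite plucker_set_row_sum; apply: summx_sub => k _; apply: scalemx_sub.
    - by rewrite plucker_set_row_sum; apply: summx_sub => k _; apply: scalemx_sub.
    - rewrite plucker_set_row_sum; apply: summx_sub => k _; apply: scalemx_sub.
      by rewrite (_ : row k e = e) // ord1; apply/rowP => j; rewrite !mxE.
  apply: tangent_along_sub => i0 k0; move: i0; apply: ord3P; (apply: gen => [|k|k|]; first exact: submx_full);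
    rewrite /C' ?set_row0 ?set_row1 ?set_row2 -[plucker _]/(wedge3 _ _ _).
  - rewrite wedge3D1 addmx_sub ?K2 //; apply/WA/wedge3_almost; by rewrite row_sub aA.
  - rewrite wedge3D1 addmx_sub //; first by rewrite wedge3_swap eqmx_opp K1.
    by apply/WB/wedge3_almost; rewrite row_sub bB.
  - by rewrite wedge3_02 sub0mx.
  - rewrite wedge3D0 addmx_sub //; first by apply/WA/wedge3_almost; rewrite row_sub aA.
    by rewrite wedge3_swap eqmx_opp K2.
  - rewrite wedge3D0 addmx_sub ?K1 //; by apply/WB/wedge3_almost; rewrite row_sub bB.
  - by rewrite wedge3_12 sub0mx.
  - rewrite wedge3D0 !wedge3D1 !addmx_sub //.
    + by apply/WA/wedge3_almost; rewrite !aA.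
    + by apply/WA/wedge3_almost; rewrite aA row_sub orbT.
    + by apply/WA/wedge3_almost; rewrite aA row_sub !orbT.
    + by apply/WB/wedge3_almost; rewrite !bB.
  - rewrite wedge3D0 !wedge3D1 !addmx_sub //.
    + by apply/WA/wedge3_almost; rewrite !aA.
    + by apply/WB/wedge3_almost; rewrite bB row_sub !orbT.
    + by apply/WB/wedge3_almost; rewrite bB row_sub !orbT.
    + by apply/WB/wedge3_almost; rewrite !bB.
  - rewrite wedge3D0 !wedge3D1 !addmx_sub //.
    + by apply/WA/wedge3_almost; rewrite !aA.
    + by rewrite wedge3_swap eqmx_opp K3.
    + by apply/WB/wedge3_almost; rewrite !bB.
have le : (tangent A + tangent B + tangent C <= (plucker A' + tangent_along A' (col_mx B' e)) + (plucker B' + tangent_along B' (col_mx A' e))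
    + wedge3_span A' B' e)%MS.
  have /submx_trans -> // : (tangent A + tangent B + tangent C <= W)%MS.
    rewrite !addsmx_sub (submx_trans (tangent_subspace CC') CW) andbT.
    by rewrite WA ?WB ?tangent_subspace.
  by rewrite !addsmxS ?tangent_complement.
apply: leq_trans (mxrankS le) _.
by rewrite (@rank_adds _ _ _ _ _ _ 26 8) ?(@rank_adds _ _ _ _ _ _ 13 13) ?(@rank_adds _ _ _ _ _ _ 1 12) ?rank_leq_row ?(leq_trans (rank_tangent_along _ _)).
Qed.

End Defect37.

(** * Gaussian elimination modulo 3 *)

(** The field with three elements, in a form that evaluates fast. *)
Inductive trit := TZ | TP | TM.

Definition trit_eqb x y :=
  match x, y with TZ, TZ | TP, TP | TM, TM => true | _, _ => false end.
Lemma trit_eqP : Equality.axiom trit_eqb.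
Proof. by case=> -[]; constructor. Qed.
HB.instance Definition _ := hasDecEq.Build trit trit_eqP.

Definition tadd x y := match x, y with
  | TZ, z => z | z, TZ => z
  | TP, TP => TM | TM, TM => TP | _, _ => TZ end.
Definition tmul x y := match x, y with
  | TZ, _ | _, TZ => TZ
  | TP, z => z | z, TP => z | TM, TM => TP end.

Definition tval (R : pzRingType) x : R := match x with TZ => 0 | TP => 1 | TM => -1 end.

Lemma tvalD x y : tval 'F_3 (tadd x y) = tval 'F_3 x + tval 'F_3 y.
Proof. by case: x; case: y; apply/val_inj. Qed.
Lemma tvalM x y : tval 'F_3 (tmul x y) = tval 'F_3 x * tval 'F_3 y.
Proof. by case: x; case: y; apply/val_inj. Qed.

Fixpoint tdet n (g : nat -> nat -> trit) : trit :=
  if n is n'.+1 then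
    foldr (fun j acc => if g 0%N j is TZ then acc else
      tadd (tmul (if odd j then TM else TP)
        (tmul (g 0%N j) (tdet n' (fun a b => g a.+1 (bump j b))))) acc) TZ (iota 0 n)
  else TP.

Lemma tdetE n g : tval 'F_3 (tdet n g) = \det (\matrix_(a < n, b < n) tval 'F_3 (g a b)).
Proof.
elim: n g => [|n IH] g; first by rewrite det_mx00.
transitivity (\sum_(0 <= j < n.+1) tval 'F_3 (g 0%N j) *
    ((-1) ^+ j * \det (\matrix_(a < n, b < n) tval 'F_3 (g a.+1 (bump j b))))).
  rewrite /tdet -/tdet /index_iota subn0.
  elim: (iota 0 n.+1) => [|j s IHs]; first by rewrite big_nil.
  rewrite big_cons /= -IHs -(IH (fun a b => g a.+1 (bump j b))); case E: (g 0%N j) => /=; rewrite ?mul0r ?add0r //;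
    rewrite !(tvalD, tvalM) /= ?mul1r ?mulN1r; congr (_ + _);
    rewrite mulrC -signr_odd; case: (odd j); rewrite /= ?expr1 ?expr0 ?mulrN1 ?mulr1 ?mulN1r ?mul1r ?mulrN ?mulNr ?mulr1 ?opprK //;
    by case: (tdet n _); rewrite /= ?opprK ?oppr0.
rewrite big_mkord (expand_det_row _ ord0); apply: eq_bigr => j _.
rewrite mxE /cofactor add0n; congr (_ * (_ * \det _)).
by apply/matrixP => a b; rewrite !mxE.
Qed.

(** The sum u + c v; missing entries count as zero. *)
Fixpoint trow_add c (u v : seq trit) : seq trit :=
  match u, v with
  | [::], _ => [seq tmul c y | y <- v]
  | _, [::] => u
  | x :: u', y :: v' => tadd x (tmul c y) :: trow_add c u' v'
  end.

Lemma nth_trow_add c u v j :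
  tval 'F_3 (nth TZ (trow_add c u v) j) =
  tval 'F_3 (nth TZ u j) + tval 'F_3 c * tval 'F_3 (nth TZ v j).
Proof.
elim: u v j => [|x u IH] [|y v] [|j] //=; rewrite ?mulr0 ?addr0 ?add0r ?tvalD ?tvalM //.
by elim: v j => [|z v IHv] [|j] //=; rewrite ?mulr0 ?tvalM.
Qed.

Definition nonzero x := if x is TZ then false else true.

(** The result marks the rows that are independent of the earlier ones.  A nonzero
    pivot a is its own inverse modulo 3, hence the multiplier - a b. *)
Fixpoint pivots n (rows : seq (seq trit)) : seq bool :=
  match n, rows with
  | n'.+1, r1 :: rest =>
      let j := find nonzero r1 in
      let a := nth TZ r1 j in
      if nonzero a then
        true :: pivots n' [seq (let b := nth TZ r j in
          if nonzero b then trow_add (tmul TM (tmul a b)) r r1 else r) | r <- rest]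
      else false :: pivots n' rest
  | _, _ => [::]
  end.

(** The pivot column determines the coefficient of the first row from the others,
    and the others form a relation between the reduced rows. *)
Lemma pivots_sound n rows (c : nat -> 'F_3) : (size rows <= n)%N ->
  all id (pivots n rows) ->
  (forall j, \sum_(x < size rows) c x * tval 'F_3 (nth TZ (nth [::] rows x) j) = 0) ->
  forall x, (x < size rows)%N -> c x = 0.
Proof.
elim: n rows c => [|n IH] [|r1 rest] c //= /ltnSE szn.
set j := find _ _; set a := nth TZ r1 j; case: ifP => //= an0 allp sum0.
pose b x := nth TZ (nth [::] rest x) j.
pose e x : 'F_3 := tval 'F_3 (if nonzero (b x) then tmul TM (tmul a (b x)) else TZ).
set rest' := [seq _ | r <- rest] in allp.
have rE x t : (x < size rest)%N -> tval 'F_3 (nth TZ (nth [::] rest' x) t) =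
    tval 'F_3 (nth TZ (nth [::] rest x) t) + e x * tval 'F_3 (nth TZ r1 t).
  move=> xs; rewrite /rest' (nth_map [::]) //= /e /b.
  by case: ifP => _; rewrite ?nth_trow_add //= mul0r addr0.
have aa : tval 'F_3 a * tval 'F_3 a = 1 by case: (a) an0 => // _; apply/val_inj.
have aU : tval 'F_3 a != 0 by apply: contra_eq_neq aa => ->; rewrite mul0r eq_sym oner_eq0.
have eE x : tval 'F_3 (b x) + e x * tval 'F_3 a = 0.
  rewrite /e; case: (b x) => //=; rewrite ?mul0r ?addr0 //;
  by case: (a) an0 => // _; apply/val_inj.
have sumS t : c 0%N * tval 'F_3 (nth TZ r1 t) +
    \sum_(x < size rest) c x.+1 * tval 'F_3 (nth TZ (nth [::] rest x) t) = 0.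
  by rewrite -[RHS](sum0 t) big_ord_recl; congr (_ + _).
have c0E : c 0%N = \sum_(x < size rest) c x.+1 * e x.
  apply: (mulIf aU); apply/eqP; rewrite mulr_suml -subr_eq0 -sumrN -[X in _ == X](sumS j) /=.
  apply/eqP; congr (_ + _); apply: eq_bigr => x _; rewrite -mulrA -mulrN; congr (_ * _).
  by apply/eqP; rewrite eq_sym -subr_eq0 opprK; apply/eqP; exact: eE.
(* The reduced rows satisfy the relation with the same coefficients. *)
have cS x : (x < size rest)%N -> c x.+1 = 0.
  have sz : size rest' = size rest by rewrite size_map.
  rewrite -sz; apply: (IH rest' (fun x => c x.+1)) => //; first by rewrite sz.
  move=> t; rewrite sz -[RHS](sumS t) c0E mulr_suml -big_split /=.
  by apply: eq_bigr => y _; rewrite rE ?ltn_ord // mulrDr addrC mulrA.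
by case=> [_|x /cS //]; rewrite c0E big1 // => x _; rewrite cS ?mul0r.
Qed.

(** * From independence modulo 3 to characteristic 0 *)

Section Columns.
Variable F : numFieldType.

Lemma minor_eqcol r N (A : 'M[F]_(r, N)) f b0 b1 : b0 != b1 -> f b0 = f b1 -> minor A f = 0.
Proof.
move=> nb fb; rewrite /minor -det_tr; apply: (determinant_alternate nb) => a.
by rewrite !mxE fb.
Qed.

Lemma minor_norow r N (A : 'M[F]_(r, N)) f a : (forall b, A a (f b) = 0) -> minor A f = 0.
Proof.
by move=> h; rewrite /minor (expand_det_row _ a) big1 // => b _; rewrite mxE h mul0r.
Qed.

Lemma subset_elt_surj r n (f : 'I_r -> 'I_n.+1) : injective f ->
  exists x : 'I_#|rsubsets r n|, exists sg : 'S_r, f =1 subset_elt x \o sg.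
Proof.
move=> fi; pose S := [set f b | b in 'I_r]%SET.
have cS : #|S| = r by rewrite card_imset ?card_ord.
have Sr : S \in rsubsets r n by rewrite inE cS.
exists (enum_rank_in Sr S).
have sE b : subset_elt (enum_rank_in Sr S) b = nth ord0 (enum S) b.
  by rewrite /subset_elt enum_rankK_in.
have ix b : (index (f b) (enum S) < r)%N.
  by rewrite -[X in (_ < X)%N]cS cardE index_mem mem_enum imset_f.
pose g b := Ordinal (ix b).
have gi : injective g.
  move=> b b' /(congr1 val) /= e; apply: fi.
  by rewrite -[LHS](@nth_index _ ord0 _ (enum S)) ?e ?nth_index ?mem_enum ?imset_f.
exists (perm gi) => b; rewrite /= sE permE /= nth_index // mem_enum imset_f //.
Qed.

Lemma minor_perm r N (A : 'M[F]_(r, N)) (f : 'I_r -> 'I_N) (sg : 'S_r) :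
  minor A (f \o sg) = (-1) ^+ sg * minor A f.
Proof.
rewrite /minor (_ : colsub (f \o sg) A = col_perm sg (colsub f A)); last first.
  by apply/matrixP => a b; rewrite !mxE.
by rewrite col_permE det_mulmx det_perm ?odd_permV mulrC.
Qed.

Lemma minor_ext r N (A : 'M[F]_(r, N)) f g : f =1 g -> minor A f = minor A g.
Proof. by move=> e; rewrite /minor; congr determinant; apply/matrixP => a b; rewrite !mxE e. Qed.

(** Repeated columns give zero, and reordering the columns changes all minors by
    the same sign. *)
Lemma minors_of_coords r n (T : finType) (Q : T -> 'M[F]_(r, n.+1)) (c : T -> F) :
  \sum_x c x *: plucker (Q x) = 0 -> forall f, \sum_x c x * minor (Q x) f = 0.
Proof.
move=> h f; case: (boolP (injectiveb f)) => [/injectiveP fi|].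
  have [x [sg fE]] := subset_elt_surj fi.
  have := congr1 (fun u : 'rV_ _ => (-1) ^+ sg * u 0 x) h; rewrite mxE mulr0 summxE => E0.
  rewrite -[RHS]E0 mulr_sumr; apply: eq_bigr => z _.
  by rewrite !mxE (minor_ext _ fE) minor_perm mulrCA.
case/injectivePn => b0 [b1 nb fb]; rewrite big1 // => z _.
by rewrite (minor_eqcol _ nb fb) mulr0.
Qed.

Lemma rank_free r n (T : finType) (Q : T -> 'M[F]_(r, n.+1)) p (E : 'M_(p, #|rsubsets r n|)) :
  (forall x, (plucker (Q x) <= E)%MS) ->
  (forall c : T -> F, (forall f, \sum_x c x * minor (Q x) f = 0) -> forall x, c x = 0) ->
  (#|T| <= \rank E)%N.
Proof.
move=> QE ind; pose G := \matrix_(x < #|T|) plucker (Q (enum_val x)).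
have Gfree : row_free G.
  apply/inj_row_free => u uG; apply/rowP => x; rewrite mxE.
  have := @ind (fun z => u 0 (enum_rank z)) _ (enum_val x); rewrite enum_valK; apply.
  apply: minors_of_coords; rewrite -[RHS]uG mulmx_sum_row.
  rewrite (reindex (enum_val : 'I_#|T| -> T)) /=; last by apply: onW_bij; exact: enum_val_bij.
  by apply: eq_bigr => z _; rewrite enum_valK rowK.
rewrite -(eqP Gfree); apply: mxrankS; apply/row_subP => x; rewrite rowK; exact: QE.
Qed.

Definition mxt (R : pzRingType) r N (q : seq (seq trit)) : 'M[R]_(r, N) :=
  \matrix_(a, j) tval R (nth TZ (nth [::] q a) j).

Definition trow r (cols : seq (seq nat)) (q : seq (seq trit)) : seq trit :=
  [seq tdet r (fun a b => nth TZ (nth [::] q a) (nth 0%N C b)) | C <- cols].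

Definition tcheck r cols (qs : seq (seq (seq trit))) :=
  all id (pivots (size qs) [seq trow r cols q | q <- qs]).

(** A right inverse modulo 3 lifts to an integer matrix.  Its product with the
    integral matrix of minors has determinant 1 modulo 3, hence not zero. *)
Lemma tcheck_free r n cols (qs : seq (seq (seq trit))) (c : nat -> F) :
  all (all (fun j => j < n.+1)%N) cols -> tcheck r cols qs ->
  (forall f : 'I_r -> 'I_n.+1,
     \sum_(x < size qs) c x * minor (mxt F r n.+1 (nth [::] qs x)) f = 0) ->
  forall x, (x < size qs)%N -> c x = 0.
Proof.
move=> cN chk rel.
pose f (y : 'I_(size cols)) (b : 'I_r) : 'I_n.+1 := inord (nth 0%N (nth [::] cols y) b).
have fE y b : f y b = nth 0%N (nth [::] cols y) b :> nat.
  rewrite inordK //; have /all_nthP := allP cN _ (mem_nth [::] (ltn_ord y)).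
  move=> /(_ 0%N); case: (ltnP b (size (nth [::] cols y))) => [lt /(_ _ lt) //|ge _].
  by rewrite nth_default.
pose G (R : comNzRingType) := \matrix_(x < size qs, y < size cols)
  minor (mxt R r n.+1 (nth [::] qs x)) (f y).
have GZ (R : comNzRingType) : map_mx (intr : int -> R) (G int) = G R.
  apply/matrixP => x y; rewrite mxE mxE [RHS]mxE /minor -det_map_mx; congr determinant.
  apply/matrixP => a b; rewrite !mxE; by case: (nth _ _ _) => /=; rewrite ?mulr0z ?mulr1z ?mulrN1z.
have G3 : row_free (G 'F_3).
  apply/inj_row_free => u uG.
  pose d x : 'F_3 := if insub x is Some x' then u 0 x' else 0.
  have dE (x : 'I_(size qs)) : d x = u 0 x by rewrite /d valK.
  have sz : size [seq trow r cols q | q <- qs] = size qs by rewrite size_map.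
  have d0 : forall x, (x < size [seq trow r cols q | q <- qs])%N -> d x = 0.
    apply: (pivots_sound (n := size qs)); rewrite ?sz // => j.
    case: (ltnP j (size cols)) => [lt|ge].
      have := congr1 (fun w : 'rV_ _ => w 0 (Ordinal lt)) uG; rewrite !mxE => E0.
      rewrite -[RHS]E0; apply: eq_bigr => x _; rewrite dE mxE; congr (_ * _).
      rewrite (nth_map [::]) // /trow (nth_map [::]) // tdetE; congr determinant.
      by apply/matrixP => a b; rewrite !mxE fE.
    rewrite big1 // => x _; rewrite (nth_map [::]) // nth_default ?mulr0 //.
    by rewrite size_map.
  by apply/rowP => x; rewrite mxE -dE d0 // sz.
pose B := pinvmx (G 'F_3).
pose Bi := map_mx (fun z : 'F_3 => (z : nat)%:Z) B.
have BiE : map_mx intr Bi = B.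
  by apply/matrixP => x y; rewrite !mxE -pmulrn natr_Zp.
have dn0 : \det (G int *m Bi) != 0.
  apply/eqP => d0; have : \det (map_mx (intr : int -> 'F_3) (G int *m Bi)) = 0.
    by rewrite det_map_mx d0.
  by rewrite map_mxM GZ BiE mulmxVp // det1 => /eqP; rewrite oner_eq0.
have GF : row_free (G F).
  have : map_mx (intr : int -> F) (G int *m Bi) \in unitmx.
    by rewrite unitmxE unitfE det_map_mx intr_eq0.
  rewrite map_mxM GZ -row_free_unit /row_free => /eqP e.
  by rewrite eqn_leq rank_leq_row -{1}e mxrankM_maxl.
have c0 : \row_(x < size qs) c x = 0.
  apply: (row_free_inj GF); rewrite mul0mx; apply/rowP => y; rewrite mxE [RHS]mxE -[RHS](rel (f y)).
  by apply: eq_bigr => x _; rewrite !mxE.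
move=> x lt; have := congr1 (fun w : 'rV_ _ => w 0 (Ordinal lt)) c0.
by rewrite !mxE.
Qed.

End Columns.

(** * Points in a chart *)

Section Chart.
Variable F : numFieldType.

(** When V i begins with the identity matrix, the wedges occurring here are a basis
    of the tangent space at V i, and the condition says that the sum of the s
    tangent spaces is direct. *)
Definition tfree s r q (V : 'I_s -> 'M[F]_(r, r + q)) :=
  forall (c : 'I_s -> F) (W : 'I_s -> 'M[F]_(r, q)),
    (forall f, \sum_i (c i * minor (V i) f + \sum_a \sum_t
        W i a t * minor (set_row (V i) a (delta_mx 0 (rshift r t))) f) = 0) ->
    (forall i, c i = 0) /\ (forall i, W i = 0).

Lemma tfree_rank s k q (V : 'I_s -> 'M[F]_(k.+1, k.+1 + q)) : tfree V ->
  (s * (k.+1 * q + 1) <= \rank (\sum_i <<tangent (V i : 'M[F]_(k.+1, (k + q).+1))>>)%MS)%N.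
Proof.
move=> ind; pose T : finType := ('I_s + 'I_s * 'I_k.+1 * 'I_q)%type.
pose Q (x : T) : 'M[F]_(k.+1, (k + q).+1) := match x with inl i => V i
  | inr (i, a, t) => set_row (V i) a (delta_mx 0 (rshift k.+1 t)) end.
have <- : #|T| = (s * (k.+1 * q + 1))%N.
  by rewrite card_sum !card_prod !card_ord; lia.
apply: (rank_free (Q := Q)).
  case=> [i|[[i a] t]] /=; apply: (sumsmx_sup i) => //; rewrite genmxE; last exact: tangent_mem.
  exact: plucker_tangent.
move=> c h.
have [|c0 W0] := ind (fun i => c (inl i)) (fun i => \matrix_(a, t) c (inr (i, a, t))).
  move=> f; rewrite -[RHS](h f) big_sumType /= big_split /=; congr (_ + _).
  rewrite pair_bigA pair_bigA /=; apply: eq_bigr => -[[i a] t] _ /=; by rewrite mxE.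
case=> [i|[[i a] t]]; first exact: c0.
by have /matrixP /(_ a t) := W0 i; rewrite !mxE.
Qed.

Definition widenV s r q (V : 'I_s -> 'M[F]_(r, r + q)) (i : 'I_s) : 'M[F]_(r, r + q.+1) :=
  \matrix_(a, j) (if insub (val j) is Some j0 then V i a j0 else 0).

Lemma widenVE s r q (V : 'I_s -> 'M[F]_(r, r + q)) i a (j : 'I_(r + q.+1)) (j0 : 'I_(r + q)) :
  val j = val j0 -> widenV V i a j = V i a j0.
Proof. by move=> e; rewrite mxE e valK. Qed.

(** The new tangent directions replace a row by the new basis vector.  Only minors
    with the new column see them, so the old directions are independent of them.
    A relation between new directions remains true when the new basis vector is
    replaced by an old one outside the identity block, which makes it a relation
    between old directions. *)
Lemma tfree_step s r q (V : 'I_s -> 'M[F]_(r, r + q)) : (0 < q)%N ->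
  tfree V -> tfree (widenV V).
Proof.
move=> q0 ind c W rel.
have leq : (r + q <= r + q.+1)%N by rewrite leq_add2l.
pose W0 i := \matrix_(a < r, t < q) W i a (widen_ord (leqnSn q) t).
have [c0 W00] : (forall i, c i = 0) /\ (forall i, W0 i = 0).
  apply: ind => f; pose f' b := widen_ord leq (f b).
  rewrite -[RHS](rel f'); apply: eq_bigr => i _; congr (_ + _).
    congr (_ * _); rewrite /minor; congr determinant; apply/matrixP => a b.
    by rewrite !mxE -(@widenVE _ _ _ V i a (f' b) (f b)) // mxE.
  apply: eq_bigr => a _; rewrite big_ord_recr /= [X in _ + X](_ : _ = 0) ?addr0; last first.
    rewrite (@minor_norow _ _ _ _ _ a) ?mulr0 // => b; rewrite mxE eqxx mxE eqxx /=.
    by case: eqP => // /(congr1 val) /= e; have := ltn_ord (f b); rewrite e ltnn.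
  apply: eq_bigr => t _; rewrite mxE; congr (_ * _); rewrite /minor; congr determinant.
  apply/matrixP => a' b; rewrite mxE [RHS]mxE mxE [RHS]mxE; case: eqP => _; last first.
    by rewrite -(@widenVE _ _ _ V i a' (f' b) (f b)).
  by rewrite !mxE.
split=> // i.
pose t0 := Ordinal q0; pose j0 : 'I_(r + q) := rshift r t0.
pose jm : 'I_(r + q.+1) := rshift r ord_max.
have [_ Wm] : (forall i : 'I_s, 0 = 0 :> F) /\
    (forall i, \matrix_(a < r, t < q) ((t == t0)%:R * W i a ord_max) = 0).
  apply: (ind (fun=> 0)) => f.
  under eq_bigr => i' _ do rewrite mul0r add0r.
  have E i' a : \sum_t (\matrix_(a, t) ((t == t0)%:R * W i' a ord_max)) a t *
      minor (set_row (V i') a (delta_mx 0 (rshift r t))) f =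
      W i' a ord_max * minor (set_row (V i') a (delta_mx 0 j0)) f.
    rewrite (bigD1 t0) //= mxE eqxx mul1r big1 ?addr0 // => t /negPf nt.
    by rewrite mxE nt !mul0r.
  under eq_bigr => i' _ do under eq_bigr => a _ do rewrite E.
  (* A minor in which the column j0 occurs exactly once is also a minor of the
     enlarged matrices, with the new column at that place. *)
  case: (pickP (fun b => f b == j0)) => [b0 /eqP fb0|nof]; last first.
    rewrite big1 // => i' _; rewrite big1 // => a _.
    rewrite (@minor_norow _ _ _ _ _ a) ?mulr0 // => b; rewrite mxE eqxx mxE eqxx /=.
    by rewrite nof.
  case: (pickP (fun b => (f b == j0) && (b != b0))) => [b1 /andP[/eqP fb1 nb]|once].
    rewrite big1 // => i' _; rewrite big1 // => a _.
    by rewrite (@minor_eqcol _ _ _ _ _ b1 b0) ?mulr0 ?fb1.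
  pose g b := if b == b0 then jm else widen_ord leq (f b).
  rewrite -[RHS](rel g); apply: eq_bigr => i' _; rewrite c0 mul0r add0r.
  apply: eq_bigr => a _; rewrite big_ord_recr /= big1 ?add0r => [|t _]; last first.
    have /matrixP /(_ a t) := W00 i'; rewrite !mxE => ->; exact: mul0r.
  congr (_ * _); rewrite /minor !(expand_det_row _ a); apply: eq_bigr => b _.
  rewrite mxE [in RHS]mxE mxE [in RHS]mxE !eqxx !mxE !eqxx /=.
  case: (eqVneq b b0) => [->|nb]; last first.
    rewrite {1}/g (negPf nb).
    have -> : (f b == j0) = false by have := once b; rewrite nb andbT.
    rewrite (_ : (widen_ord leq (f b) == rshift r ord_max) = false) ?mul0r //.
    apply/negbTE; rewrite -val_eqE /=; have := ltn_ord (f b); lia.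
  rewrite {1}/g eqxx fb0 !eqxx; congr (_ * _).
  rewrite /cofactor; congr (_ * \det _); apply/matrixP => a' b'; rewrite !mxE.
  rewrite eq_sym (negPf (neq_lift _ _)) /g eq_sym (negPf (neq_lift _ _)).
  by rewrite valK.
apply/matrixP => a t; rewrite [RHS]mxE; case: (unliftP ord_max t) => [t' ->|->].
  by have /matrixP /(_ a t') := W00 i; rewrite !mxE -widen_lift.
by have /matrixP /(_ a t0) := Wm i; rewrite !mxE eqxx mul1r.
Qed.

(** The entries are pseudo-random; the constants are such that the ranks asserted
    by [tselect_computed] and [tfree_computed] are attained modulo 3. *)
Definition tentry i a t : trit :=
  let y := ((24 * i + a + 15 * t + 6) %% 31)%N in
  match ((((y * y) %% 31) * y) %% 31 %% 3)%N with 0 => TZ | 1 => TP | _ => TM end.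

Definition tpoint r q i : seq (seq trit) :=
  mkseq (fun a => mkseq (fun j => if (j < r)%N then (if j == a then TP else TZ)
    else tentry i a (j - r)) (r + q)) r.

Definition treplace r q (p : seq (seq trit)) a t : seq (seq trit) :=
  mkseq (fun a' => if a' == a then mkseq (fun j => if j == (r + t)%N then TP else TZ) (r + q)
    else nth [::] p a') r.

Definition tgens s r q : seq (seq (seq trit)) :=
  let points := mkseq (tpoint r q) s in
  points ++ [seq treplace r q (nth [::] points x.1.1) x.1.2 x.2 |
    x <- [seq (x, t) | x <- [seq (i, a) | i <- iota 0 s, a <- iota 0 r], t <- iota 0 q]].

Fixpoint combs r (l : seq nat) : seq (seq nat) :=
  match r, l with
  | 0, _ => [:: [::]]
  | _, [::] => [::]
  | r'.+1, x :: l' => [seq x :: c | c <- combs r' l'] ++ combs r l'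
  end.

Definition chart_point s r q (i : 'I_s) : 'M[F]_(r, r + q) := mxt F r (r + q) (tpoint r q i).

Lemma mxt_replace s r q (i : 'I_s) (a : 'I_r) (t : 'I_q) :
  mxt F r (r + q) (treplace r q (tpoint r q i) a t) =
  set_row (chart_point r q i) a (delta_mx 0 (rshift r t)).
Proof.
apply/matrixP => b j; rewrite !mxE nth_mkseq // -val_eqE /=; case: eqP => // _.
by rewrite nth_mkseq // -val_eqE /=; case: eqP.
Qed.

Lemma tgens_free s k q (r := k.+1) :
  all (all (fun j => j < r + q)%N) (combs r (iota 0 (r + q))) ->
  tcheck r (combs r (iota 0 (r + q))) (tgens s r q) -> tfree (@chart_point s r q).
Proof.
move=> cN chk c W rel.
pose T := ('I_s + 'I_s * 'I_r * 'I_q)%type.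
pose L3 : seq ('I_s * 'I_r * 'I_q) :=
  [seq (x, t) | x <- [seq (i, a) | i <- enum 'I_s, a <- enum 'I_r], t <- enum 'I_q].
pose L : seq T := [seq inl i | i <- enum 'I_s] ++ [seq inr z | z <- L3].
pose gen (x : T) := match x with inl i => tpoint r q i
  | inr (i, a, t) => treplace r q (tpoint r q i) a t end.
pose u (x : T) : F := match x with inl i => c i | inr (i, a, t) => W i a t end.
have L3E : [seq (val x.1.1, val x.1.2, val x.2) | x <- L3] =
    [seq (x, t) | x <- [seq (i, a) | i <- iota 0 s, a <- iota 0 r], t <- iota 0 q].
  rewrite -!val_enum_ord !allpairs_mapl !allpairs_mapr map_allpairs.
  rewrite /L3 !map_allpairs -!enumT map_flatten map_allpairs; congr flatten.
  by apply: eq_allpairs => x y; rewrite -map_comp.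
have LE : tgens s r q = [seq gen x | x <- L].
  rewrite /tgens /L map_cat -!map_comp -L3E -map_comp; congr (_ ++ _).
    by rewrite /mkseq -val_enum_ord -map_comp enumT.
  by apply: eq_map => -[[i a] t] /=; rewrite nth_mkseq.
have sumL (h : seq (seq trit) -> F) (K : seq T) :
    \sum_(x < size K) nth 0 [seq u x | x <- K] x *
    h (nth [::] [seq gen x | x <- K] x) = \sum_(x <- K) u x * h (gen x).
  elim: K => [|y K IH]; first by rewrite big_ord0 big_nil.
  by rewrite big_ord_recl big_cons -IH.
have main x : (x < size (tgens s r q))%N -> nth 0 [seq u x | x <- L] x = 0.
  have lt := size_map gen L; rewrite -LE in lt.
  apply: (@tcheck_free F r (k + q) (combs r (iota 0 (r + q))) (tgens s r q)) => // f.
  rewrite lt LE (sumL (fun p => minor (mxt F r (k + q).+1 p) f)) big_cat !big_map /=.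
  rewrite -enumT big_enum -[RHS](rel f) big_split /=; congr (_ + _).
  rewrite /L3 big_allpairs big_allpairs -?enumT big_enum /=; apply: eq_bigr => i _.
  rewrite -?enumT big_enum /=; apply: eq_bigr => a _.
  by rewrite -?enumT big_enum /=; apply: eq_bigr => t _; rewrite mxt_replace.
have uL x : x \in L -> u x = 0.
  move=> xL; have /(nthP 0) [x0 ks <-] : u x \in [seq u x | x <- L] by apply: map_f.
  by apply: main; rewrite LE size_map; rewrite size_map in ks.
split=> i.
  by apply: (uL (inl i)); rewrite mem_cat map_f ?mem_enum.
apply/matrixP => a t; rewrite mxE; apply: (uL (inr (i, a, t))).
rewrite mem_cat orbC map_f //; apply/allpairsP; exists (i, a, t) => /=; split; rewrite ?mem_enum //.
by apply/allpairsP; exists (i, a); rewrite !mem_enum.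
Qed.

End Chart.

(** * Lower bounds for the rank *)

Section Lowers.
Variable F : numFieldType.

Definition tangent_rank s k n m := exists V : 'I_s -> 'M[F]_(k.+1, n.+1),
  (m <= \rank (\sum_i <<tangent (V i)>>)%MS)%N.

(** A maximal independent set of generators. *)
Definition tselect s r q : seq (seq (seq trit)) :=
  let gs := tgens s r q in
  mask (pivots (size gs) [seq trow r (combs r (iota 0 (r + q))) g | g <- gs]) gs.

Definition tselect_ok s r q m :=
  let cols := combs r (iota 0 (r + q)) in let qs := tselect s r q in
  [&& all (all (fun j => j < r + q)%N) cols, tcheck r cols qs & size qs == m].

Lemma tgens_tangent s k q (g : seq (seq trit)) : g \in tgens s k.+1 q ->
  (plucker (mxt F k.+1 (k + q).+1 g) <=
     \sum_(i < s) <<tangent (chart_point F k.+1 q i : 'M[F]_(k.+1, (k + q).+1))>>)%MS.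
Proof.
rewrite mem_cat => /orP [].
  case/mapP => i; rewrite mem_iota add0n /= => lt ->; apply: (sumsmx_sup (Ordinal lt)) => //.
  by rewrite genmxE; exact: plucker_tangent.
case/mapP => x /allpairsP [[y t0] [/allpairsP [[i0 a0] [ilt alt ey]] tlt ->]] ->.
move: ilt alt tlt; rewrite [(y, t0).1]ey !mem_iota !add0n /= => ilt alt tlt.
apply: (sumsmx_sup (Ordinal ilt)) => //; rewrite genmxE /= nth_mkseq //.
by rewrite (mxt_replace F (Ordinal ilt) (Ordinal alt : 'I_k.+1) (Ordinal tlt)) tangent_mem.
Qed.

Lemma tselect_rank s k q m : tselect_ok s k.+1 q m -> tangent_rank s k (k + q) m.
Proof.
case/and3P => cN chk /eqP sz; exists (@chart_point F s k.+1 q).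
rewrite -sz -[X in (X <= _)%N]card_ord.
apply: (rank_free (Q := fun x : 'I_(size (tselect s k.+1 q)) =>
  mxt F k.+1 (k + q).+1 (nth [::] (tselect s k.+1 q) x))) => [x|c h x].
  by apply: tgens_tangent; apply: mem_mask (mem_nth [::] (ltn_ord x)).
pose c' y := if insub y is Some z then c z else 0.
have c'E (z : 'I_(size (tselect s k.+1 q))) : c' z = c z by rewrite /c' valK.
rewrite -c'E; apply: (@tcheck_free F k.+1 (k + q) _ _ c' cN chk) => // f.
by rewrite -[RHS](h f); apply: eq_bigr => z _; rewrite c'E.
Qed.

Definition tfree_ok s r q :=
  let cols := combs r (iota 0 (r + q)) in
  all (all (fun j => j < r + q)%N) cols && tcheck r cols (tgens s r q).

Lemma tfree_tangent_rank s k q0 q : (0 < q0)%N -> (q0 <= q)%N -> tfree_ok s k.+1 q0 ->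
  tangent_rank s k (k + q) (s * (k.+1 * q + 1)).
Proof.
move=> p0 le /andP[cN chk].
have : exists V : 'I_s -> 'M[F]_(k.+1, k.+1 + q), tfree V.
  elim: q le => [|q IH]; first by rewrite leqn0 => /eqP e; rewrite e in p0.
  rewrite leq_eqVlt => /orP [/eqP <-|]; first by exists (@chart_point F s k.+1 q0); exact: tgens_free.
  rewrite ltnS => le; have [V fV] := IH le; exists (widenV V).
  by apply: tfree_step => //; exact: leq_trans p0 le.
by case=> V /tfree_rank fV; exists V.
Qed.

(** The tangent spaces at coordinate points are spanned by wedges of basis vectors,
    that is, up to sign, by coordinate vectors indexed by sets.  The second
    hypothesis says that two different points still differ after one change in
    each of them, so that the sets are distinct. *)
Lemma code_tangent_rank s k n (A : 'I_s -> 'I_k.+1 -> 'I_n.+1) :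
  (forall i, injective (A i)) ->
  (forall i i' a j, i != i' -> exists b, [/\ b != a, A i' b != j & forall b', A i b' != A i' b]) ->
  tangent_rank s k n (s * (k.+1 * (n - k) + 1)).
Proof.
move=> Ainj far; pose E (h : 'I_k.+1 -> 'I_n.+1) : 'M[F]_(k.+1, n.+1) := \matrix_a delta_mx 0 (h a).
pose B (x : 'I_s * 'I_k.+1 * 'I_n.+1) := [forall b, A x.1.1 b != x.2].
pose T : finType := ('I_s + {x | B x})%type.
pose h (x : T) (b : 'I_k.+1) : 'I_n.+1 := match x with inl i => A i b
  | inr y => let: (i, a, j) := val y in if b == a then j else A i b end.
have Eh0 (g g' : 'I_k.+1 -> 'I_n.+1) a : (forall b, g b != g' a) -> minor (E g') g = 0.
  by move=> ne; apply: (@minor_norow _ _ _ _ _ a) => b; rewrite mxE mxE eqxx (negPf (ne b)).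
have Eh1 g : injective g -> minor (E g) g = 1.
  move=> gi; rewrite /minor (_ : colsub _ _ = 1%:M) ?det1 //; apply/matrixP => a b.
  by rewrite !mxE eqxx /= (inj_eq gi) eq_sym.
have Bp i a j : B (i, a, j) -> forall b, A i b != j by move=> /forallP.
have hinj x : injective (h x).
  case: x => [i|[[[i a] j] Bx]] b b'; first exact: Ainj.
  have nj := Bp _ _ _ Bx; rewrite /h /=.
  case: eqP => [->|_]; case: eqP => [-> //|_] e; last exact: Ainj e.
    by case/eqP: (nj b').
  by case/eqP: (nj b).
have hr i a j (Bx : B (i, a, j)) b : h (inr (exist (fun y => B y) (i, a, j) Bx)) b = if b == a then j else A i b by [].
have sep x x' : x != x' -> exists a, forall b, h x b != h x' a.
  case: x => [i|[[[i a] j] Bx]]; case: x' => [i'|[[[i' a'] j'] Bx']] nx.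
  - have ni : i != i' by apply: contra nx => /eqP ->.
    by have [b [_ _ nb]] := far i i' ord0 ord0 ni; exists b.
  - case: (eqVneq i i') => [e|ni].
      by exists a' => b; rewrite hr eqxx e; exact: (Bp _ _ _ Bx' b).
    have [b [ba _ nb]] := far i i' a' ord0 ni.
    by exists b => b'; rewrite hr (negPf ba); exact: nb.
  - have nj := Bp _ _ _ Bx; case: (eqVneq i' i) => [->|ni].
      exists a => b; rewrite hr; case: (b =P a) => [_|/eqP ba]; first by rewrite eq_sym nj.
      by rewrite (inj_eq (Ainj i)).
    rewrite eq_sym in ni; have [b [_ bj nb]] := far i i' ord0 j ni.
    by exists b => b'; rewrite hr; case: (b' =P a) => _; rewrite ?nb // eq_sym.
  - have nj := Bp _ _ _ Bx; have nj' := Bp _ _ _ Bx'.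
    case: (eqVneq i i') => [e|ni]; last first.
      have [b [ba bj nb]] := far i i' a' j ni.
      by exists b => b'; rewrite !hr (negPf ba); case: (b' =P a) => _; rewrite ?nb // eq_sym.
    case: (eqVneq j j') => [ej|nejj].
      have na : a != a'.
        apply: contra nx => /eqP ea; apply/eqP; congr inr; apply/val_inj => /=.
        by rewrite e ea ej.
      exists a => b; rewrite !hr (negPf na) -e; case: (b =P a) => [_|/eqP ba].
        by rewrite eq_sym nj.
      by rewrite (inj_eq (Ainj i)).
    by exists a' => b; rewrite !hr eqxx; case: (b =P a) => // _; rewrite e nj'.
exists (fun i => E (A i)).
have <- : #|T| = (s * (k.+1 * (n - k) + 1))%N.
  rewrite card_sum card_ord card_sig mulnDr muln1 addnC; congr (_ + _)%N.
  rewrite -sum1_card big_mkcond /=.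
  rewrite -(pair_bigA _ (fun y j => if B (y, j) then 1%N else 0%N)) /=.
  transitivity (\sum_(y : 'I_s * 'I_k.+1) (n - k))%N.
    apply: eq_bigr => -[i a] _; rewrite -big_mkcond sum1_card.
    have <- : #|~: [set A i b | b in 'I_k.+1]%SET| = (n - k)%N.
      by rewrite cardsCs finset.setCK card_imset ?card_ord ?subSS //; exact: Ainj.
    apply: eq_card => j; rewrite !inE; apply/forallP/negP => [nb /imsetP [b _ e]|nim b].
      by have := nb b; rewrite /= e eqxx.
    by apply/negP => /eqP /= e; apply: nim; rewrite -e imset_f.
  by rewrite sum_nat_const card_prod !card_ord mulnA.
apply: (rank_free (Q := fun x => E (h x))) => [x|c rel x].
  case: x => [i|[[[i a] j] Bx]]; apply: (sumsmx_sup i) => //; rewrite genmxE; first exact: plucker_tangent.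
  rewrite (_ : E _ = set_row (E (A i)) a (delta_mx 0 j)) ?tangent_mem //.
  by apply/matrixP => b l; rewrite !mxE hr; case: (b =P a) => _.
rewrite -[RHS](rel (h x)) (bigD1 x) //= Eh1 ?mulr1 ?big1 ?addr0 // => x' nx.
rewrite eq_sym in nx; have [a na] := sep _ _ nx.
by rewrite (Eh0 _ _ a) ?mulr0.
Qed.

End Lowers.

(** * Explicit points *)

Definition exceptions : seq (nat * nat * nat) := [:: (3, 2, 6); (3, 3, 7); (4, 3, 7); (4, 2, 8)]%N.

(** The expected dimension of the affine cone. *)
Definition expected_rank s k n := minn (s * (k.+1 * (n - k) + 1)) 'C(n.+1, k.+1).

Lemma tselect_computed :
  all (fun x : nat * (nat * nat) => let: (s, (k, n)) := x in ((s, k, n) \in exceptions) ||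
     tselect_ok s k.+1 (n - k) (expected_rank s k n))
    [seq (s, kn) | s <- iota 1 6, kn <- [:: (2, 5); (2, 6); (2, 7); (2, 8); (2, 9); (3, 7)]].
Proof. by vm_compute. Qed.

Lemma tfree_computed : all (fun s => tfree_ok s 3 8 && tfree_ok s 4 5) (iota 1 6).
Proof. by vm_compute. Qed.

(** Six 5-subsets of ten points; two of them have at most two common points. *)
Definition codewords : seq (seq nat) :=
  [:: [:: 0; 1; 2; 3; 4]; [:: 0; 1; 5; 6; 7]; [:: 0; 2; 5; 8; 9];
      [:: 1; 3; 6; 8; 9]; [:: 2; 4; 6; 7; 8]; [:: 3; 4; 5; 7; 9]]%N.

(** For k > 4 the same further elements are added to all six subsets, which keeps
    their distances. *)
Definition codeword i b := if (b < 5)%N then nth 0%N (nth [::] codewords i) b else (b + 5)%N.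

Lemma codeword_lt i b : (i < 6)%N -> (b < 5)%N -> (codeword i b < 10)%N.
Proof.
have main : all (fun i => all (fun b => codeword i b < 10)%N (iota 0 5)) (iota 0 6) by [].
move=> i6 b5; have := allP main i; rewrite mem_iota => /(_ i6) /allP /(_ b).
by rewrite mem_iota => /(_ b5).
Qed.

Lemma codeword_ge i b : (5 <= b)%N -> codeword i b = (b + 5)%N.
Proof. by move=> h; rewrite /codeword ifF // ltnNge h. Qed.

Lemma codeword_inj i : (i < 6)%N -> injective (codeword i).
Proof.
have main : all (fun i => uniq (nth [::] codewords i)) (iota 0 6) by [].
move=> i6 b b' e.
have u : uniq (nth [::] codewords i) by apply: (allP main); rewrite mem_iota.
have sz : size (nth [::] codewords i) = 5%N by case: i i6 {e u} => [|[|[|[|[|[|]]]]]].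
case: (ltnP b 5) => b5; case: (ltnP b' 5) => b'5.
- by move: e; rewrite /codeword b5 b'5 => /eqP; rewrite nth_uniq ?sz // => /eqP.
- by have := @codeword_lt i b i6 b5; rewrite e codeword_ge //; lia.
- by have := @codeword_lt i b' i6 b'5; rewrite -e codeword_ge //; lia.
- by move: e; rewrite !codeword_ge //; lia.
Qed.

(** The values a and j describe one change in each of the two subsets: two
    5-subsets with at most two common points differ in three elements, and at
    least one of these survives. *)
Lemma codeword_far i i' a j : (i < 6)%N -> (i' < 6)%N -> i != i' ->
  exists b, [/\ (b < 5)%N, b != a, codeword i' b != j & forall b', codeword i b' != codeword i' b].
Proof.
move=> i6 i'6 ni.
have main : all (fun i => all (fun i' => (i == i') || all (fun a => all (fun j =>
    has (fun b => [&& b != a, codeword i' b != j & codeword i' b \notin nth [::] codewords i])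
      (iota 0 5)) (iota 0 11)) (iota 0 6)) (iota 0 6)) (iota 0 6) by vm_compute.
have := allP main i; rewrite mem_iota => /(_ i6) /allP /(_ i'); rewrite mem_iota => /(_ i'6).
rewrite (negPf ni) orFb => /allP /(_ (minn a 5)); rewrite mem_iota => h1.
have /h1 /allP /(_ (minn j 10)) h2 : (0 <= minn a 5 < 0 + 6)%N by lia.
have /h2 /hasP [b] : minn j 10 \in iota 0 11 by rewrite mem_iota; lia.
rewrite mem_iota => b5 /and3P [ba bj nb]; exists b; split=> //.
- by apply: contra ba => /eqP <-; apply/eqP; lia.
- have := @codeword_lt i' b i'6 b5; move: bj; case: eqP => // ; lia.
move=> b'; apply: contra nb => /eqP e; rewrite -e.
case: (ltnP b' 5) => b'5.
  by rewrite /codeword b'5; apply: mem_nth; case: (i) i6 => [|[|[|[|[|[|]]]]]].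
by have := @codeword_lt i' b i'6 b5; rewrite -e codeword_ge //; lia.
Qed.

(** * The dimension of the secant varieties *)

Section Final.
Variable F : numFieldType.

Lemma tangent_rank_le s k n m m' : (m' <= m)%N -> tangent_rank F s k n m -> tangent_rank F s k n m'.
Proof. by move=> le [V rk]; exists V; exact: leq_trans le rk. Qed.

Lemma code_rank s k n : (4 <= k)%N -> (2 * k < n)%N -> (s <= 6)%N ->
  tangent_rank F s k n (s * (k.+1 * (n - k) + 1)).
Proof.
move=> k4 kn s6.
have lt i b : (i < 6)%N -> (b < k.+1)%N -> (codeword i b < n.+1)%N.
  move=> i6 bk; case: (ltnP b 5) => b5; last by rewrite codeword_ge //; lia.
  by apply: leq_trans (codeword_lt i6 b5) _; lia.
have is6 (i : 'I_s) : (i < 6)%N by apply: leq_trans s6.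
pose A (i : 'I_s) (b : 'I_k.+1) : 'I_n.+1 := inord (codeword i b).
have AE i b : A i b = codeword i b :> nat by rewrite inordK // lt.
apply: (@code_tangent_rank F s k n A) => [i b b' /(congr1 val)|i i' a j ni].
  by rewrite /= !AE => /(codeword_inj (is6 i)) /val_inj.
have [b [b5 ba bj far]] := @codeword_far i i' a j (is6 i) (is6 i') ni.
have bk : (b < k.+1)%N by apply: leq_trans b5 _; lia.
exists (Ordinal bk); split; rewrite -?val_eqE /= ?AE //.
by move=> b'; rewrite -val_eqE /= !AE far.
Qed.

(** Coordinate points for k >= 4.  Otherwise explicit points, extended by
    [tfree_step] for n >= 10 if k = 2 and for n >= 8 if k = 3. *)
Lemma lower_rank s k n : (2 <= k)%N -> (2 * k < n)%N -> (1 <= s <= 6)%N ->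
  (s, k, n) \notin exceptions -> tangent_rank F s k n (expected_rank s k n).
Proof.
move=> k2 kn /andP[s1 s6] nex.
have sI : s \in iota 1 6 by rewrite mem_iota; lia.
have fin : (k, n) \in [:: (2, 5); (2, 6); (2, 7); (2, 8); (2, 9); (3, 7)]%N ->
    tangent_rank F s k n (expected_rank s k n).
  move=> kf; have := allP tselect_computed (s, (k, n)).
  rewrite (allpairs_f (fun s kn => (s, kn)) sI kf) (negPf nex) => /(_ isT) ok.
  by have := tselect_rank F ok; rewrite subnKC //; lia.
have gen q0 : (0 < q0)%N -> (q0 <= n - k)%N -> tfree_ok s k.+1 q0 ->
    tangent_rank F s k n (expected_rank s k n).
  move=> p0 le ok; have := tfree_tangent_rank F p0 le ok; rewrite subnKC; last lia.
  by apply: tangent_rank_le; exact: geq_minl.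
have /allP /(_ s sI) /andP [ok3 ok4] := tfree_computed.
case: (ltnP k 4) => k4; last first.
  by apply: tangent_rank_le (code_rank k4 kn s6); exact: geq_minl.
case: (eqVneq k 2%N) => [ek|nk].
  case: (ltnP n 10) => n10; last by apply: (gen 8%N) => //; rewrite ?ek //; lia.
  apply: fin; rewrite ek; case: (n) kn n10 => [|[|[|[|[|[|[|[|[|[|]]]]]]]]]] //; rewrite ek //.
have ek : k = 3%N by lia.
case: (ltnP n 8) => n8; last by apply: (gen 5%N) => //; rewrite ?ek //; lia.
have en : n = 7%N by lia.
by apply: fin; rewrite ek en.
Qed.

Lemma rank_sumsmx_le s q (A : 'I_s -> 'M[F]_q) : (\rank (\sum_i A i)%MS <= \sum_i \rank (A i))%N.
Proof. by rewrite (leq_of_leqif (mxrank_sum_leqif _)). Qed.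

Definition coord_frame s r N (f : 'I_s -> 'I_r -> 'I_N) i : 'M[F]_(r, N) := \matrix_a delta_mx 0 (f i a).

Lemma coord_frame_mem s r N (f : 'I_s -> 'I_r -> 'I_N) i a j p (X : 'M_(p, N)) :
  f i a = j -> (coord_frame f i <= X)%MS -> ((delta_mx 0 j : 'rV[F]_N) <= X)%MS.
Proof. by move=> <-; apply: submx_trans; have := row_sub a (coord_frame f i); rewrite rowK. Qed.

Lemma coord_frame_free s r N (f : 'I_s -> 'I_r -> 'I_N) i : injective (f i) -> row_free (coord_frame f i).
Proof.
move=> fi; apply/inj_row_free => u uf; apply/rowP => a; rewrite mxE.
have := congr1 (fun w : 'rV_ _ => w 0 (f i a)) uf; rewrite !mxE (bigD1 a) //= !mxE !eqxx mulr1.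
by rewrite big1 ?addr0 // => b nb; rewrite !mxE (inj_eq fi) eq_sym (negPf nb) andbF mulr0.
Qed.

Lemma full_delta p N (X : 'M[F]_(p, N)) : (forall j : 'I_N, ((delta_mx 0 j : 'rV[F]_N) <= X)%MS) -> row_full X.
Proof. by move=> h; rewrite -sub1mx; apply/row_subP => j; rewrite row1. Qed.

Section Gen.
Variables (s k n : nat).
Local Notation points := (@points F s k n).
Local Notation generic := (@generic F s k n).

Lemma generic_free i : (k <= n)%N -> generic (fun v => row_free (points v i)).
Proof.
move=> kn; pose f (i : 'I_s) (a : 'I_k.+1) : 'I_n.+1 := widen_ord (kn : (k.+1 <= n.+1)%N) a.
apply: (@generic_imp _ _ _ _ (fun v => k.+1 <= \rank (points v i))%N) => [v rk|].
  by rewrite /row_free eqn_leq rank_leq_row.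
have g := @generic_rank F s k n k.+1 (fun V => V i) (@generic_points F s k n i) (coord_frame f) k.+1.
apply: g => [v|]; first exact: generic_points_eval.
by rewrite (eqP (coord_frame_free _)) // => a b /(congr1 val) /= /val_inj.
Qed.

Lemma upper_rank l C : (k <= n)%N ->
  irreducible_chain (secant_variety s (Gr F k n)) l C -> (l < expected_rank s k n)%N.
Proof.
move=> kn ch; rewrite /expected_rank leq_min; apply/andP; split.
  apply: upper_bound ch; apply: generic_imp (generic_all (generic_free^~ kn)) => v fr.
  apply: leq_trans (rank_sumsmx_le _) _.
  rewrite -[X in (X * _)%N]card_ord -sum_nat_const; apply: leq_sum => i _.
  by rewrite genmxE -[(n - k)%N]subSS rank_tangent.
have <- : #|rsubsets k.+1 n| = 'C(n.+1, k.+1) by rewrite card_draws card_ord.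
apply: upper_bound ch; exists 1; first exact: oner_neq0.
by move=> v _; exact: rank_leq_col.
Qed.

Lemma exceptional_dim m b : generic (fun v => \rank (\sum_i <<tangent (points v i)>>)%MS <= b)%N ->
  (b <= m)%N -> ~ has_dim (secant_variety s (Gr F k n)) m.
Proof.
move=> g le [[C ch] _]; have := upper_bound g ch.
by rewrite ltnNge le.
Qed.

End Gen.

Lemma generic_defect37 : @generic F 3 2 6 (fun v => \rank (\sum_i <<tangent (points v i)>>)%MS <= 34)%N.
Proof.
pose i1 : 'I_3 := inord 1.
pose E (V : 'I_3 -> 'M[F]_(3, 7)) := col_mx (V ord0) (col_mx (V i1) (row ord_max (V ord_max))).
pose Et := col_mx (@generic_points F 3 2 6 ord0) (col_mx (@generic_points F 3 2 6 i1) (row ord_max (@generic_points F 3 2 6 ord_max))).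
pose f (i a : 'I_3) : 'I_7 := inord (minn (3 * i + a) 6).
apply: (@generic_imp _ _ _ _ (fun v => 7 <= \rank (E (points v)))%N) => [v rk|].
  have full : row_full (E (points v)) by rewrite /row_full eqn_leq rank_leq_col.
  apply: leq_trans (defect37 full); apply: mxrankS; apply/sumsmx_subP => i _; rewrite genmxE.
  have [->|->|->] : [\/ i = ord0, i = i1 | i = ord_max].
    case: i => -[|[|[|//]]] h; [apply: Or31|apply: Or32|apply: Or33]; apply/val_inj => //=.
    by rewrite inordK.
  - by rewrite -addsmxA addsmxSl.
  - by rewrite (submx_trans _ (addsmxSl _ _)) ?addsmxSr.
  - exact: addsmxSr.
apply: (generic_rank (Et := Et) (V := coord_frame f)) => [v|].
  by rewrite /Et /E !map_col_mx map_row !generic_points_eval.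
rewrite (eqP (_ : row_full _)) //; apply: full_delta => j.
have jlt := ltn_ord j.
have fE (i a : 'I_3) : f i a = minn (3 * i + a) 6 :> nat by rewrite inordK //; lia.
have i3 x : (x < 3)%N -> (inord x : 'I_3) = x :> nat by move=> ?; rewrite inordK.
case: (ltnP j 3) => j3.
  apply: (@coord_frame_mem _ _ _ f ord0 (inord j)); last exact: sub_colu.
  by apply/val_inj; rewrite /= fE i3 //=; lia.
apply: submx_trans (sub_cold _ _); case: (ltnP j 6) => j6.
  apply: (@coord_frame_mem _ _ _ f i1 (inord (j - 3))); last exact: sub_colu.
  by apply/val_inj; rewrite /= fE !i3 //; lia.
apply: submx_trans (sub_cold _ _); rewrite rowK (_ : f _ _ = j) //.
by apply/val_inj; rewrite /= fE /=; lia.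
Qed.

(** A polynomial condition that holds at one point, here a tuple of coordinate
    subspaces, holds generically. *)
Lemma generic_frame s k n p (E : ('I_s -> 'M[F]_(k.+1, n.+1)) -> 'M[F]_(p, n.+1))
    (Et : 'M[{mpoly F[#|{: 'I_s * 'I_k.+1 * 'I_n.+1}|]}]_(p, n.+1)) f :
  (forall v, map_mx (meval v) Et = E (points v)) -> row_full (E (coord_frame f)) ->
  @generic F s k n (fun v => row_full (E (points v))).
Proof.
move=> hE full; have g := @generic_rank F s k n p E Et (coord_frame f) n.+1 hE.
apply: generic_imp (g _) => [v rk|]; last by rewrite (eqP full).
by rewrite /row_full eqn_leq rank_leq_col.
Qed.

Lemma generic_defect48 t : @generic F t.+3 3 7 (fun v =>
  \rank (tangent (points v (inord 0)) + tangent (points v (inord 1)) + tangent (points v (inord 2)))%MS <= 50)%N.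
Proof.
pose i_ (x : nat) : 'I_t.+3 := inord x.
have iE x : (x < 3)%N -> i_ x = x :> nat by move=> ?; rewrite inordK //; lia.
pose f (i : 'I_t.+3) (a : 'I_4) : 'I_8 := inord (if i == 0%N :> nat then a : nat else (4 + a)%N).
have fE i a : f i a = (if i == 0%N :> nat then a : nat else (4 + a)%N) :> nat.
  by have a_lt := ltn_ord a; rewrite inordK //; case: ifP => _; lia.
have a4 x : (x < 4)%N -> (inord x : 'I_4) = x :> nat by move=> ?; rewrite inordK.
pose X i := @generic_points F t.+3 3 7 (i_ i).
have g1 := @generic_frame t.+3 3 7 _ (fun V => col_mx (V (i_ 0%N)) (V (i_ 1%N))) (col_mx (X 0%N) (X 1%N)) f.
have g2 := @generic_frame t.+3 3 7 _ (fun V => col_mx (V (i_ 2%N)) (V (i_ 0%N))) (col_mx (X 2%N) (X 0%N)) f.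
have low i q (Y : 'M_(q, 8)) (j : 'I_8) : (j < 4)%N -> (i_ i == 0%N :> nat) ->
    (coord_frame f (i_ i) <= Y)%MS -> ((delta_mx 0 j : 'rV[F]_8) <= Y)%MS.
  move=> j4 i0; apply: (@coord_frame_mem _ _ _ f (i_ i) (inord j)).
  by apply/val_inj; rewrite /= fE i0 a4.
have high i q (Y : 'M_(q, 8)) (j : 'I_8) : (4 <= j)%N -> (i_ i != 0%N :> nat) ->
    (coord_frame f (i_ i) <= Y)%MS -> ((delta_mx 0 j : 'rV[F]_8) <= Y)%MS.
  move=> j4 i0; apply: (@coord_frame_mem _ _ _ f (i_ i) (inord (j - 4))).
  have j8 := ltn_ord j; apply/val_inj; rewrite /= fE (negPf i0) a4; lia.
apply: generic_imp (genericI (g1 _ _) (g2 _ _)) => [v [h1 h2]||||].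
- exact: defect48 h1 h2.
- by move=> v; rewrite map_col_mx !generic_points_eval.
- apply: full_delta => j; case: (ltnP j 4) => j4.
    by apply: (low 0%N) => //; rewrite ?iE ?sub_colu.
  by apply: (high 1%N) => //; rewrite ?iE ?sub_cold.
- by move=> v; rewrite map_col_mx !generic_points_eval.
- apply: full_delta => j; case: (ltnP j 4) => j4.
    by apply: (low 0%N) => //; rewrite ?iE ?sub_cold.
  by apply: (high 2%N) => //; rewrite ?iE ?sub_colu.
Qed.

Lemma generic_defect39 : @generic F 4 2 8 (fun v => \rank (\sum_i <<tangent (points v i)>>)%MS <= 75)%N.
Proof.
pose i_ (x : nat) : 'I_4 := inord x.
have iE x : (x < 4)%N -> i_ x = x :> nat by move=> ?; rewrite inordK.
pose f (i : 'I_4) (a : 'I_3) : 'I_9 := inord (3 * minn i 2 + a).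
have fE i a : f i a = (3 * minn i 2 + a)%N :> nat.
  by have a_lt := ltn_ord a; rewrite inordK //; lia.
have a3 x : (x < 3)%N -> (inord x : 'I_3) = x :> nat by move=> ?; rewrite inordK.
pose X i := @generic_points F 4 2 8 (i_ i).
have g1 := @generic_frame 4 2 8 _ (fun V => col_mx (V (i_ 0%N)) (col_mx (V (i_ 1%N)) (V (i_ 2%N))))
  (col_mx (X 0%N) (col_mx (X 1%N) (X 2%N))) f.
have g2 := @generic_frame 4 2 8 _ (fun V => col_mx (V (i_ 3%N)) (col_mx (V (i_ 0%N)) (V (i_ 1%N))))
  (col_mx (X 3%N) (col_mx (X 0%N) (X 1%N))) f.
have mem i q (Y : 'M_(q, 9)) (j : 'I_9) : (i < 4)%N -> (3 * minn i 2 <= j < 3 * minn i 2 + 3)%N ->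
    (coord_frame f (i_ i) <= Y)%MS -> ((delta_mx 0 j : 'rV[F]_9) <= Y)%MS.
  move=> i4 hj; apply: (@coord_frame_mem _ _ _ f (i_ i) (inord (j - 3 * minn i 2))).
  by apply/val_inj; rewrite /= fE iE // a3; lia.
have split3 (j : 'I_9) : [\/ (j < 3)%N, (3 <= j < 6)%N | (6 <= j < 9)%N].
  have j9 := ltn_ord j; case: (ltnP j 3) => j3; first by apply: Or31.
  by case: (ltnP j 6) => j6; [apply: Or32|apply: Or33]; lia.
apply: generic_imp (genericI (g1 _ _) (g2 _ _)) => [v [h1 h2]||||].
- apply: leq_trans (defect39 h1 h2); apply: mxrankS; apply/sumsmx_subP => i _; rewrite genmxE.
  rewrite -(inord_val i); case: i => -[|[|[|[|//]]]] /= _.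
  + by rewrite -!addsmxA addsmxSl.
  + by rewrite -!addsmxA (submx_trans _ (addsmxSr _ _)) // addsmxSl.
  + by rewrite (submx_trans _ (addsmxSl _ _)) // addsmxSr.
  + exact: addsmxSr.
- by move=> v; rewrite !map_col_mx !generic_points_eval.
- apply: full_delta => j; case: (split3 j) => hj.
  + by apply: (mem 0%N) => //; exact: sub_colu.
  + by apply: (mem 1%N) => //; apply: submx_trans (sub_cold _ _); exact: sub_colu.
  + by apply: (mem 2%N) => //; apply: submx_trans (sub_cold _ _); exact: sub_cold.
- by move=> v; rewrite !map_col_mx !generic_points_eval.
- apply: full_delta => j; case: (split3 j) => hj.
  + by apply: (mem 0%N) => //; apply: submx_trans (sub_cold _ _); exact: sub_colu.
  + by apply: (mem 1%N) => //; apply: submx_trans (sub_cold _ _); exact: sub_cold.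
  + by apply: (mem 3%N) => //; exact: sub_colu.
Qed.

Lemma generic_defect48_3 : @generic F 3 3 7 (fun v => \rank (\sum_i <<tangent (points v i)>>)%MS <= 50)%N.
Proof.
apply: generic_imp (generic_defect48 0) => v; apply: leq_trans; apply: mxrankS.
apply/sumsmx_subP => i _; rewrite genmxE -(inord_val i); case: i => -[|[|[|//]]] /= _.
- by rewrite -addsmxA addsmxSl.
- by rewrite (submx_trans _ (addsmxSl _ _)) ?addsmxSr.
- exact: addsmxSr.
Qed.

Lemma generic_defect48_4 : @generic F 4 3 7 (fun v => \rank (\sum_i <<tangent (points v i)>>)%MS <= 67)%N.
Proof.
have g := genericI (generic_defect48 1) (@generic_free 4 3 7 (inord 3) isT).
apply: generic_imp g => v [h1 fr]; have := rank_adds h1 (rank_tangent fr).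
apply: leq_trans; apply: mxrankS.
apply/sumsmx_subP => i _; rewrite genmxE -(inord_val i); case: i => -[|[|[|[|//]]]] /= _.
- by rewrite -!addsmxA addsmxSl.
- by rewrite -!addsmxA (submx_trans _ (addsmxSr _ _)) // addsmxSl.
- by rewrite (submx_trans _ (addsmxSl _ _)) // addsmxSr.
- exact: addsmxSr.
Qed.

Theorem expected_dimensionP s k n : (2 <= k)%N -> (2 * k < n)%N -> (1 <= s <= 6)%N ->
  expected_dimension F s k n <-> (s, k, n) \notin exceptions.
Proof.
move=> k2 kn s16.
have C0 : (0 < 'C(n.+1, k.+1))%N by rewrite bin_gt0; lia.
have e0 : (0 < expected_rank s k n)%N by rewrite leq_min C0 muln_gt0 addn1 !andbT; case/andP: s16.
rewrite /expected_dimension.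
rewrite (_ : minn _ _ = (expected_rank s k n).-1); last first.
  by rewrite /expected_rank; move: (s * _)%N 'C(_, _) => x y; lia.
split; last first.
  move=> nex; split.
    have [V rk] := lower_rank k2 kn s16 nex.
    by apply: (lower_bound (V := V)); rewrite prednK.
  have kn' : (k <= n)%N by lia.
  by move=> l C ch; rewrite -ltnS prednK //; exact: upper_rank ch.
rewrite !inE => hd; apply/negP => /or4P [] /eqP [es ek en]; move: hd; rewrite es ek en.
- exact: (exceptional_dim generic_defect37).
- exact: (exceptional_dim generic_defect48_3).
- exact: (exceptional_dim generic_defect48_4).
- exact: (exceptional_dim generic_defect39).
Qed.

End Final.

Theorem theorem1p4 (R : realType) (k n s : nat)
    (hk : (2 <= k)%N) (hkn : (2 * k <= n - 1)%N) (hs : (1 <= s <= 6)%N) :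
  expected_dimension R[i] s k n <->
  ~ ((s, k, n) \in [:: (3, 2, 6); (3, 3, 7); (4, 3, 7); (4, 2, 8)]%N).
Proof.
have kn : (2 * k < n)%N by lia.
have H := @expected_dimensionP R[i] s k n hk kn hs.
by split=> [/H /negP|/negP /H].
Qed.
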